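(* Let $\mathsf{f}\in\mathcal{D}'(\mathbb{R})$ and suppose that $\mathsf{f}=\mathsf{F}'$, where $\mathsf{F}\in\mathcal{D}'(\mathbb{R})$ is a Łojasiewicz distribution. Let $U\subseteq\mathbb{R}$ be an open set. Let $\phi\in\mathcal{D}(\mathbb{R})$ be a normalized, positive test function with $\operatorname{supp}\phi\subset[-R,R]$, and let $\theta>\arctan R$ (with $\theta<\pi/2$). Suppose that $$\mathsf{f}^{+}_{\phi,0}(x)\geq 0\quad\text{for almost every }x\in U,$$ and that there exists a countable set $E$ such that for each $x\in U\setminus E$ there is a constant $M_x>0$ with $$\mathsf{f}^{-}_{\phi,\theta}(x)\geq -M_x .$$ Then $\mathsf{f}$ is a measure in $U$.
   Context: Distributions are real. For $\mathsf f\in\mathcal D'(\mathbb R)$, $x_0\in\mathbb R$ and $\varepsilon\neq 0$, $\langle \mathsf f(x_0+\varepsilon y),\phi(y)\rangle:=|\varepsilon|^{-1}\langle \mathsf f(y),\phi((y-x_0)/\varepsilon)\rangle$. The distributional (Łojasiewicz) point value $\mathsf f(x_0)$ exists and equals $\gamma\in\mathbb R$ if $\lim_{\varepsilon\to0}\langle \mathsf f(x_0+\varepsilon y),\phi(y)\rangle=\gamma\int_{-\infty}^\infty\phi(y)\,dy$ for every $\phi\in\mathcal D(\mathbb R)$. A Łojasiewicz distribution is a distribution having a distributional point value at every $x_0\in\mathbb R$. A test function $\phi$ is normalized if $\int_{-\infty}^{\infty}\phi(x)\,dx=1$, and positive if $\phi\ge 0$. The $\phi$-transform of $\mathsf f$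 is $F(x,t)=\langle \mathsf f(x+ty),\phi(y)\rangle$ for $x\in\mathbb R$, $t>0$. For $0\le\theta<\pi/2$ let $C_{x_0,\theta}=\{(x,t): t>0,\ |x-x_0|\le(\tan\theta)t\}$, and $$\mathsf f^{+}_{\phi,\theta}(x_0)=\limsup_{(x,t)\to(x_0,0),\,(x,t)\in C_{x_0,\theta}}F(x,t),\qquad \mathsf f^{-}_{\phi,\theta}(x_0)=\liminf_{(x,t)\to(x_0,0),\,(x,t)\in C_{x_0,\theta}}F(x,t)$$ (values in $[-\infty,\infty]$; for $\theta=0$ these are radial limits $t\to0^+$ with $x=x_0$). ''Measure in $U$'' means that the restriction of $\mathsf f$ to $U$ is a positive Radon measure. *)

(* Defs.v *)
From HB Require Import structures.
From mathcomp Require Import all_boot all_order all_algebra.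
From mathcomp Require Import all_classical all_reals all_analysis.

Set Implicit Arguments.
Unset Strict Implicit.
Unset Printing Implicit Defensive.

Import Order.TTheory GRing.Theory Num.Theory.
Import numFieldNormedType.Exports.

Local Open Scope classical_set_scope.
Local Open Scope ring_scope.

Definition smooth (R : realType) (phi : R -> R) : Prop :=
  forall (n : nat) (x : R), derivable (derive1n n phi) x 1.

Definition supp (R : realType) (phi : R -> R) : set R :=
  closure [set x | phi x != 0].

Definition test_fun (R : realType) : set (R -> R) :=
  [set phi | smooth phi /\ compact (supp phi)].
Arguments test_fun {R}.

(* Continuity is the usual seminorm estimate on each D_K.  The carrier is a
   function on all of [R -> R], but only its values on [test_fun] are
   constrained, and only these are ever used. *)
Record schwartz_distribution (R : realType) := SchwartzDistribution {
  pairing :> (R -> R) -> R;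
  pairing_linear : forall (a : R) (phi psi : R -> R),
    test_fun phi -> test_fun psi ->
    pairing (fun x => a * phi x + psi x) = a * pairing phi + pairing psi;
  pairing_continuous : forall K : set R, compact K ->
    exists (C : R) (N : nat), forall phi : R -> R,
      test_fun phi -> supp phi `<=` K ->
      `|pairing phi| <=
        C * \sum_(k < N.+1) sup (range (fun x : R => `|derive1n k phi x|)) }.

(* < f(x0 + eps y), phi(y) >, meaningful for eps != 0 *)
Definition rescaled (R : realType) (f : schwartz_distribution R) (x0 eps : R)
    (phi : R -> R) : R :=
  `|eps|^-1 * f (fun y => phi ((y - x0) / eps)).

Definition has_point_value (R : realType) (f : schwartz_distribution R)
    (x0 gamma : R) : Prop :=
  forall phi : R -> R, test_fun phi ->
    rescaled f x0 eps phi @[eps --> 0^'] -->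
      gamma * \int[@lebesgue_measure R]_y phi y.

Definition lojasiewicz (R : realType) (f : schwartz_distribution R) : Prop :=
  forall x0 : R, exists gamma : R, has_point_value f x0 gamma.

Definition is_distr_derivative (R : realType)
    (f F : schwartz_distribution R) :
    Prop :=
  forall phi : R -> R, test_fun phi -> f phi = - F (derive1 phi).

Definition phi_transform (R : realType) (f : schwartz_distribution R)
    (phi : R -> R) (p : R * R) : R :=
  rescaled f p.1 p.2 phi.

Definition cone (R : realType) (x0 theta : R) : set (R * R) :=
  [set p | 0 < p.2 /\ `|p.1 - x0| <= tan theta * p.2].

Definition upper_value (R : realType) (f : schwartz_distribution R) (phi : R -> R)
    (theta x0 : R) : \bar R :=
  limf_esup (fun p : R * R => (phi_transform f phi p)%:E)
    (within (cone x0 theta) (nbhs (x0, 0 : R))).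

Definition lower_value (R : realType) (f : schwartz_distribution R) (phi : R -> R)
    (theta x0 : R) : \bar R :=
  limf_einf (fun p : R * R => (phi_transform f phi p)%:E)
    (within (cone x0 theta) (nbhs (x0, 0 : R))).

(* The Radon measure on U is carried by a Borel measure on the line, of which
   only the values on Borel subsets of U matter. *)
Definition measure_in (R : realType) (U : set R)
    (f : schwartz_distribution R) :
    Prop :=
  exists mu : {measure set (measurableTypeR R) -> \bar R},
    [/\ forall K : set R, compact K -> K `<=` U -> (mu K < +oo)%E,
        forall A : set (measurableTypeR R), measurable A -> A `<=` U ->
          mu A = ereal_sup [set mu K | K in [set K : set R |
                                              compact K /\ K `<=` A]]
      & forall phi : R -> R, test_fun phi -> supp phi `<=` U ->
          (f phi)%:E = (\int[mu]_(x in U) (phi x)%:E)%E].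

(* Main.v *)
(* Let phi_t(z) = phi(z/t)/t, u(x,t) = <f, phi_t(. - x)> and U(x,t) = <F, phi_t(. - x)>, so
   that u is the x-derivative of U and U(x,t) tends to the point value F(x) as t -> 0.
   Call f nonnegative near x if u >= 0 on a strip |y - x| < delta, 0 < t < delta; if this
   holds at every x of U, then x |-> F(x) is continuous and nondecreasing on the intervals
   of U and f is its Stieltjes measure.

   Let K be the set of points of U near which f is not nonnegative.  If K is not empty,
   Baire's theorem on the locally closed set K gives a portion of K that is either a single
   point of E or on which u >= -n on all cones C_(k,theta) of height 1/n.  In the second
   case u >= -n on a whole strip, because phi is supported in [-r, r] and r < tan theta:
   either (y,t) belongs to the cone over a point of K, or f is nonnegative near all of
   [y - r t, y + r t].  Then F(x) + n x is nondecreasing, and if F decreased somewhere a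
   rising sun argument would give a set of positive measure along which it falls with a
   fixed slope; at a density point of that set limsup u(x,t) < 0, contradicting the
   almost everywhere hypothesis.  In the first case f is nonnegative near all points but x0
   of a neighbourhood of x0, and the existence of the point value of F at x0 rules out
   any contribution of x0.  Both cases contradict the choice of K. *)

(* Every estimate rests on one identity: cut a continuous g off at a and b, convolve it with phi_t
   and pair it with f; the result is the integral of g(x) u(x,t) over [a, b]. On a partition kept
   fixed while t -> 0, a lower bound on u then compares <f, g> with a Riemann sum whose increments
   are those of the point values of F at the nodes. A one-sided bound controls the error, because
   |u| <= u + 2n when u >= -n and the integral of u is an increment of U. This comparison yields the
   sign of <f, g>, the bound on u at density points and the Stieltjes integral. The point values are
   continuous because U(x + s t, t) tends to F(x) for every fixed s, which bounds a jump at x by a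
   difference tending to 0. At an isolated point x0 only the part |x - x0| <= r t could be negative.
   Since f = F', that part is F tested at scale t against a derivative, whose integral is zero; as
   the test function still varies with t, it is expanded by Taylor's formula beyond the order of
   F. *)
Require Import Defs.
From HB Require Import structures.
From mathcomp Require Import all_boot all_order all_algebra.
From mathcomp Require Import all_classical all_reals all_analysis.
From mathcomp Require Import ring lra.

Set Implicit Arguments.
Unset Strict Implicit.
Unset Printing Implicit Defensive.

Import Order.TTheory GRing.Theory Num.Theory.
Import numFieldNormedType.Exports.

Local Open Scope classical_set_scope.
Local Open Scope ring_scope.

(** * Mean value estimates and primitives *)

Section Calculus.
Context {R : realType}.
Implicit Types (f g h P Q : R -> R) (a b c x y eps del B C s : R).

(** Multiplied out, the difference quotient leaves an inequality that is trivial at [e = 0];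
    differentiating convolutions and pairings reduces to checking it. *)
Lemma is_derive_eps f x d :
  (forall eps, 0 < eps -> exists2 del : R, 0 < del &
     forall e, `|e| < del -> `|f (x + e) - f x - e * d| <= eps * `|e|) ->
  is_derive x 1 f d.
Proof.
move=> H.
have L : h^-1 *: ((f \o shift x) (h *: 1) - f x) @[h --> 0^'] --> d.
  apply/cvgrPdist_le => eps e0; have [del d0 Hd] := H _ e0.
  near=> h.
  have h0 : h != 0 by near: h; exact: nbhs_dnbhs_neq.
  have hd : `|h| < del by near: h; apply: dnbhs0_lt.
  have := Hd h hd; rewrite /= [h *: 1]mulr1 [h + x]addrC => Hh.
  have -> : d - h^-1 *: (f (x + h) - f x) = - (h^-1 * (f (x + h) - f x - h * d)).
    by rewrite /GRing.scale /=; field.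
  by rewrite normrN normrM normfV mulrC ler_pdivrMr ?normr_gt0.
split; first by apply/cvg_ex; exists d.
by apply: cvg_lim => //.
Unshelve. all: by end_near. Qed.

Lemma is_derive_cont f (d : R -> R) : (forall x, is_derive x 1 f (d x)) -> continuous f.
Proof.
move=> H x; apply: differentiable_continuous; apply/derivable1_diffP.
by have [] := H x.
Qed.

Lemma deriv_incr f (d : R -> R) a b : (forall x, is_derive x 1 f (d x)) -> a <= b ->
  (forall x, a < x < b -> 0 <= d x) -> f a <= f b.
Proof.
move=> fd ab d0.
move: ab; rewrite le_eqVlt => /orP[/eqP->//|ab].
have [c cab E] := MVT ab (fun x _ => fd x)
  (continuous_subspaceT (is_derive_cont fd)).
rewrite -subr_ge0 E mulr_ge0 ?subr_ge0 ?(ltW ab)//.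
by apply: d0; move: cab; rewrite in_itv.
Qed.

Lemma deriv_le f g (df dg : R -> R) a b :
  (forall x, is_derive x 1 f (df x)) -> (forall x, is_derive x 1 g (dg x)) -> a <= b ->
  (forall x, a < x < b -> df x <= dg x) -> f b - f a <= g b - g a.
Proof.
move=> fd gd ab H.
have := @deriv_incr (g - f) (fun x => dg x - df x) a b _ ab _.
rewrite /= => /(_ (fun x => is_deriveB (gd x) (fd x))) H1.
suff : g a - f a <= g b - f b by lra.
by apply: H1 => x /H; lra.
Qed.

(** The bound is assumed on both sides of [a], so that the estimate serves either order of [a] and
    [b]. *)
Lemma deriv_bound f (d : R -> R) (B : R) a b : (forall x, is_derive x 1 f (d x)) ->
  (forall x, `|x - a| <= `|b - a| -> `|d x| <= B) -> `|f b - f a| <= B * `|b - a|.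
Proof.
move=> fd dB.
have idd x : is_derive x 1 (fun x => B * x) B.
  by apply: is_derive_eq; rewrite /GRing.scale /= mulr1.
have W x y : x <= y -> (forall z, x < z < y -> `|d z| <= B) -> `|f y - f x| <= B * (y - x).
  move=> xy H; rewrite ler_norml; apply/andP; split; last first.
    by rewrite mulrBr; apply: (deriv_le fd idd xy) => z /H /ler_normlW.
  have := @deriv_le (- f) _ (fun z => - d z) (fun=> B) x y
     (fun x => is_deriveN (fd x)) idd xy.
  rewrite /= => HH; suff : - f y - - f x <= B * y - B * x by lra.
  by apply: HH => z /H; rewrite ler_norml => /andP[]; lra.
have [ab|ba] := leP a b.
  rewrite (ger0_norm (_ : 0 <= b - a)) ?subr_ge0//; apply: W => // z /andP[az zb].
  by apply: dB; rewrite !ger0_norm; lra.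
rewrite distrC (distrC b) (ger0_norm (_ : 0 <= a - b)) ?subr_ge0 ?(ltW ba)//.
apply: W => [|z /andP[az zb]]; first exact: ltW.
by apply: dB; rewrite !ltr0_norm; lra.
Qed.

Lemma deriv_uniq f g (d : R -> R) a b :
  (forall x, is_derive x 1 f (d x)) -> (forall x, is_derive x 1 g (d x)) ->
  f b - f a = g b - g a.
Proof.
move=> fd gd; apply/eqP; rewrite eq_le.
wlog ab : a b / a <= b => [W|].
  have [ab|/ltW ba] := leP a b; first exact: W.
  by have /andP[p q] := W _ _ ba; apply/andP; lra.
by apply/andP; split; [apply: (deriv_le fd gd ab)|apply: (deriv_le gd fd ab)].
Qed.

End Calculus.

Section Primitive.
Context {R : realType}.
Implicit Types (f g h P Q : R -> R) (a b c x y eps del B C s : R).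
Local Notation mu := (@lebesgue_measure R).

Lemma is_derive_unique f x d d' :
  is_derive x 1 f d -> is_derive x 1 f d' -> d = d'.
Proof. by move=> [_ <-] [_ <-]. Qed.

Lemma derivD f g x d d' : is_derive x 1 f d -> is_derive x 1 g d' ->
  is_derive x 1 (fun y => f y + g y) (d + d').
Proof. by move=> p q; have := is_deriveD p q. Qed.

Lemma derivM f g x d d' : is_derive x 1 f d -> is_derive x 1 g d' ->
  is_derive x 1 (fun y => f y * g y) (d * g x + f x * d').
Proof.
move=> p q; have := is_deriveM p q => /is_derive_eq; apply.
by rewrite /GRing.scale /= addrC (mulrC d).
Qed.

Lemma derivZ k f x d : is_derive x 1 f d -> is_derive x 1 (fun y => k * f y) (k * d).
Proof. by move=> p; have := is_deriveZ k p. Qed.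

Lemma deriv_aff f d s c x : is_derive (s * (x - c)) 1 f d ->
  is_derive x 1 (fun y => f (s * (y - c))) (s * d).
Proof.
move=> fd.
have gd : is_derive x 1 (fun y => s * (y - c)) s.
  have H : is_derive x 1 (fun y => y + - c) (1 + 0).
    exact: (derivD (is_derive_id x 1) (is_derive_cst (- c) x 1)).
  by have /is_derive_eq := derivZ s H; apply; rewrite addr0 mulr1.
by have /is_derive_eq := @is_derive1_comp R f _ x _ _ fd gd; apply; rewrite mulrC.
Qed.

Lemma deriv_refl f d c x : is_derive (c - x) 1 f d ->
  is_derive x 1 (fun y => f (c - y)) (- d).
Proof.
move=> fd.
have e y : c - y = -1 * (y - c) by ring.
have -> : (fun y => f (c - y)) = (fun y => f (-1 * (y - c))).
  by apply/funext => y; rewrite e.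
rewrite -[- d]mulN1r; apply: (@deriv_aff f d (-1) c x); by rewrite -e.
Qed.

Lemma contD h g : continuous h -> continuous g -> continuous (fun x => h x + g x).
Proof. by move=> ch cg x; apply: (@continuousD _ R R); [exact: ch|exact: cg]. Qed.

Lemma contM h g : continuous h -> continuous g -> continuous (fun x => h x * g x).
Proof. by move=> ch cg x; apply: (@continuousM R R); [exact: ch|exact: cg]. Qed.

Lemma contZ k h : continuous h -> continuous (fun x => k * h x).
Proof. by apply: contM; exact: cst_continuous. Qed.

Lemma contB h g : continuous h -> continuous g -> continuous (fun x => h x - g x).
Proof. by move=> ch cg x; apply: (@continuousB _ R R); [exact: ch|exact: cg]. Qed.

Lemma cont_refl h y : continuous h -> continuous (fun x => h (y - x)).
Proof.
move=> ch x; apply: (@continuous_comp _ _ _ (fun x => y - x) h); last exact: ch.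
by apply: (@contB (fun=> y) id); [exact: cst_continuous|move=> ?; exact: cvg_id].
Qed.

Lemma cont_integrable h a b : continuous h -> mu.-integrable `[a, b] (EFin \o h).
Proof.
move=> ch; apply: continuous_compact_integrable; first exact: segment_compact.
exact: continuous_subspaceT.
Qed.

Lemma ex_prim h : continuous h -> exists P, forall x, is_derive x 1 P (h x).
Proof.
move=> ch; pose J a x := (\int[mu]_(t in `[a, x]) h t).
have Jd a x : a < x -> is_derive x 1 (J a) (h x).
  move=> ax.
  have [D E] := @continuous_FTC1_closed R h a x (x + 1) (ltr_pwDr ltr01 (lexx x))
    (cont_integrable _ _ ch) ax (ch x).
  by apply: (DeriveDef D); rewrite -derive1E; exact: E.
have JB a a' x : a' <= a -> a <= x -> J a' x - J a' a = J a x.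
  move=> a'a ax; rewrite /J Rintegral_itvB ?bnd_simp//; last exact: cont_integrable.
  by rewrite Rintegral_itv_obnd_cbnd//; apply: integrableS (cont_integrable a x ch) => //;
    apply: subset_itvr; rewrite bnd_simp.
(* The fundamental theorem wants a base point to the left of [x]. [N x] lies below both [x] and 0,
   and subtracting the integral up to 0 makes the choice immaterial. *)
pose N x := - (Num.trunc `|x|).+1%:R : R.
have NP x : N x < x /\ N x < 0.
  have := truncnS_gt `|x|; rewrite /N => H.
  by split; [have := ler_norm (- x); rewrite normrN; lra|have := normr_ge0 x; lra].
pose P x := J (N x) x - J (N x) 0.
exists P => x.
have Pm m y : m <= N y -> P y = J m y - J m 0.
  have [p q] := NP y.
  move=> mN; rewrite /P -(JB _ _ _ mN (ltW p)) -(JB _ _ _ mN (ltW q)); ring.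
(* One unit lower, so that [m] is an admissible base for every [y] with [|y - x| < 1]. *)
pose m := N x - 1.
have : is_derive x 1 (fun y => J m y + (- J m 0)) (h x + 0).
  by apply: derivD; apply: Jd; have [] := NP x; rewrite /m; lra.
rewrite addr0; apply: near_eq_is_derive.
near=> y; rewrite (Pm m)//.
suff : (Num.trunc `|y| <= (Num.trunc `|x|).+1)%N.
  by rewrite -(ler_nat R) /m /N -!natr1; lra.
rewrite -ltnS (@truncn_lt_nat R)//.
apply: (@le_lt_trans _ _ (`|x| + `|y - x|)).
  by rewrite -{1}(subrKC x y) ler_normD.
have : `|y - x| < 1 by near: y; rewrite /=; apply/nbhs_ballP; exists 1 => //= z; rewrite /ball/= distrC.
have := truncnS_gt `|x|; rewrite -!natr1; lra.
Unshelve. all: by end_near. Qed.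

(* [xget] picks any antiderivative, so that [integ] is an oriented integral whose
   properties reduce to mean value estimates. *)
Definition prim h : R -> R := xget (cst 0) [set P | forall x, is_derive x 1 P (h x)].

Definition integ h a b := prim h b - prim h a.

Lemma primP h : continuous h -> forall x, is_derive x 1 (prim h) (h x).
Proof.
move=> /ex_prim[P HP]; rewrite /prim.
by case: xgetP => [Q _ //|/(_ P)].
Qed.

Lemma integE h P a b : continuous h -> (forall x, is_derive x 1 P (h x)) ->
  integ h a b = P b - P a.
Proof. by move=> /primP ch HP; apply: deriv_uniq HP. Qed.

Lemma integ_Lebesgue h a b : continuous h -> a <= b ->
  integ h a b = \int[mu]_(t in `[a, b]) h t.
Proof.
move=> ch; rewrite le_eqVlt => /orP[/eqP->|ab].
  by rewrite /integ subrr set_itv1 Rintegral_set1.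
rewrite /Rintegral (@continuous_FTC2 _ h (prim h))//.
- exact: continuous_subspaceT.
- split.
  + by move=> x _; have [] := primP ch x.
  + by apply: cvg_at_right_filter; exact: (is_derive_cont (primP ch)).
  + by apply: cvg_at_left_filter; exact: (is_derive_cont (primP ch)).
- by move=> x _; rewrite derive1E; have [_ ->] := primP ch x.
Qed.

Lemma integ_cat h a b c : integ h a b + integ h b c = integ h a c.
Proof. by rewrite /integ; ring. Qed.

Lemma integD h g a b : continuous h -> continuous g ->
  integ (fun x => h x + g x) a b = integ h a b + integ g a b.
Proof.
move=> ch cg; have c : continuous (fun x => h x + g x).
  exact: contD.
have d x := derivD (primP ch x) (primP cg x).
by rewrite (integE _ _ c d) /integ; ring.
Qed.

Lemma integZ h k a b : continuous h ->
  integ (fun x => k * h x) a b = k * integ h a b.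
Proof.
move=> ch; have c : continuous (fun x => k * h x).
  exact: contZ.
have d x := derivZ k (primP ch x).
by rewrite (integE _ _ c d) /integ; ring.
Qed.

Lemma integB h g a b : continuous h -> continuous g ->
  integ (fun x => h x - g x) a b = integ h a b - integ g a b.
Proof.
move=> ch cg.
have -> : (fun x => h x - g x) = (fun x => h x + -1 * g x).
  by apply/funext => x; ring.
by rewrite integD ?integZ//; [ring|exact: contZ].
Qed.

Lemma integ_bound h B a b : continuous h ->
  (forall x, `|x - a| <= `|b - a| -> `|h x| <= B) -> `|integ h a b| <= B * `|b - a|.
Proof. by move=> ch; apply: deriv_bound (primP ch). Qed.

Lemma integ_le h g a b : continuous h -> continuous g -> a <= b ->
  (forall x, a < x < b -> h x <= g x) -> integ h a b <= integ g a b.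
Proof. by move=> ch cg ab H; apply: deriv_le ab H; exact: primP. Qed.

Lemma integ_eq h g a b : continuous h -> continuous g -> a <= b ->
  (forall x, a < x < b -> h x = g x) -> integ h a b = integ g a b.
Proof.
move=> ch cg ab H; apply/eqP; rewrite eq_le !integ_le// => x /H ->//.
Qed.

Lemma integ_cst k a b : integ (fun=> k) a b = k * (b - a).
Proof.
have c : continuous (fun _ : R => k) by exact: cst_continuous.
have d x : is_derive x 1 (fun x => k * x) k.
  by have /is_derive_eq := derivZ k (is_derive_id x (1:R)); apply; rewrite mulr1.
by rewrite (integE _ _ c d) mulrBr.
Qed.

(** One mean value estimate bounds the derivative of [f z - d y * z] by [C * |e|] near [y], a second
    one concludes; the constant [C] instead of [C / 2] is harmless. *)
Lemma deriv2_bound f d d2 C y e :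
  (forall x, is_derive x 1 f (d x)) -> (forall x, is_derive x 1 d (d2 x)) ->
  (forall x, `|d2 x| <= C) -> `|f (y + e) - f y - e * d y| <= C * `|e| ^+ 2.
Proof.
move=> fd dd d2C.
have C0 : 0 <= C := le_trans (normr_ge0 _) (d2C 0).
have gd x : is_derive x 1 (fun z => f z + (- d y) * z) (d x + (- d y) * 1).
  by apply: derivD => //; apply: derivZ; exact: is_derive_id.
have /= := @deriv_bound R _ _ (C * `|e|) y (y + e) gd.
have -> : y + e - y = e by ring.
rewrite -mulrA -expr2; have -> : f (y + e) + - d y * (y + e) - (f y + - d y * y) =
  f (y + e) - f y - e * d y by ring.
apply => x xe; rewrite mulr1.
apply: le_trans (deriv_bound dd (fun x _ => d2C x)) _.
by rewrite ler_wpM2l.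
Qed.

End Primitive.

(** * Test functions *)

Section Jets.
Context {R : realType}.
Implicit Types (g k : nat -> R -> R) (h : R -> R) (a b c x y s eps del B C : R).

(* A smooth function is carried along with all its derivatives: [g n] is the
   [n]-th derivative of [g 0]. *)
Definition jet g := forall n x, is_derive x 1 (g n) (g n.+1 x).

Definition vanish c h := forall x, c < `|x| -> h x = 0.

Definition tjet c g := jet g /\ vanish c (g 0%N).

Lemma jet_derive1n g n : jet g -> derive1n n (g 0%N) = g n.
Proof.
move=> jg; elim: n => // n IH; rewrite derive1nS IH.
by apply/funext => x; rewrite derive1E; have [_ ->] := jg n x.
Qed.

Lemma jet_cont g n : jet g -> continuous (g n).
Proof. by move=> jg; apply: is_derive_cont (jg n). Qed.

Lemma vanish_supp c h : vanish c h -> supp h `<=` `[- c, c].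
Proof.
move=> vh; have /closure_id -> : closed `[- c, c]%classic by exact: interval_closed.
apply: closure_subset => x /= hx; rewrite in_itv /= -ler_norml leNgt.
by apply: contra hx => /vh ->.
Qed.

Lemma supp_vanish c h : supp h `<=` `[- c, c] -> vanish c h.
Proof.
move=> sh x cx; apply/eqP/negPn/negP => hx.
have /sh : supp h x by apply: subset_closure.
by rewrite /= in_itv /= -ler_norml leNgt cx.
Qed.

Lemma tjet_test c g : tjet c g -> test_fun (g 0%N).
Proof.
move=> [jg vg]; split.
  by move=> n x; rewrite jet_derive1n//; have [] := jg n x.
apply: subclosed_compact (vanish_supp vg); first exact: closed_closure.
exact: segment_compact.
Qed.

Lemma test_tjet c h : test_fun h -> vanish c h -> tjet c (fun n => derive1n n h).
Proof.
move=> [sh _] vh; split=> // n x; rewrite derive1nS; split; first exact: sh.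
by rewrite derive1E.
Qed.

Lemma test_vanish h : test_fun h -> exists2 c : R, 0 < c & vanish c h.
Proof.
move=> [_ /compact_bounded[M [_ HM]]]; exists (`|M| + 1).
  by have := normr_ge0 M; lra.
move=> x xM; apply/eqP/negPn/negP => hx.
have : supp h x by apply: subset_closure.
move=> /(HM (`|M| + 1)); have := ler_norm M.
by move=> MM /(_ ltac:(lra)) /=; rewrite leNgt xM.
Qed.

Lemma vanish_deriv c h d : vanish c h -> (forall x, is_derive x 1 h (d x)) -> vanish c d.
Proof.
move=> vh hd x cx; apply: is_derive_unique (hd x) _.
apply: is_derive_eps => eps e0; exists (`|x| - c); first by rewrite subr_gt0.
move=> e ex; rewrite (vh (x + e)) ?(vh x)// ?subr0 ?mulr0 ?subr0 ?normr0.
  by rewrite mulr_ge0// ltW.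
have : `|x| <= `|x + e| + `|e| by rewrite -[X in `|X| <= _](addrK e) ler_normB.
lra.
Qed.

Lemma tjet_vanish c g n : tjet c g -> vanish c (g n).
Proof.
by move=> [jg vg]; elim: n => // n IH; apply: vanish_deriv (jg n).
Qed.

Lemma tjet_shift c g n : tjet c g -> tjet c (fun m => g (n + m)%N).
Proof.
move=> tg; split; last by rewrite addn0; exact: tjet_vanish.
by move=> m x; rewrite addnS; apply: tg.1.
Qed.

Lemma cont_vanish_bound c h : continuous h -> vanish c h ->
  exists2 B : R, 0 < B & forall x, `|h x| <= B.
Proof.
move=> ch vh.
have /compact_bounded[M [_ HM]] : compact (h @` `[- c, c]).
  by apply: continuous_compact; [exact: continuous_subspaceT|exact: segment_compact].
exists (`|M| + 1); first by have := normr_ge0 M; lra.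
have MM := ler_norm M.
move=> x; have [xc|/vh ->] := leP `|x| c; last by rewrite normr0; have := normr_ge0 M; lra.
apply: HM; first lra.
by exists x => //=; rewrite in_itv /= -ler_norml.
Qed.

Lemma tjet_bound c g n : tjet c g -> exists2 B : R, 0 < B & forall x, `|g n x| <= B.
Proof.
move=> tg; apply: (@cont_vanish_bound c); last exact: tjet_vanish.
by apply: jet_cont; exact: tg.1.
Qed.

Lemma tjetW c c' g : c <= c' -> tjet c g -> tjet c' g.
Proof. by move=> cc [jg vg]; split => // x /(le_lt_trans cc)/vg. Qed.

Lemma tjet_lin c g k s : tjet c g -> tjet c k -> tjet c (fun n x => s * g n x + k n x).
Proof.
move=> [jg vg] [jk vk]; split; last by move=> x cx; rewrite vg// vk// mulr0 addr0.
by move=> n x; apply: derivD => //; exact: derivZ.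
Qed.

Lemma tjet0 c : tjet c (fun _ _ => 0).
Proof. by split => // n x; exact: is_derive_cst. Qed.

Lemma tjet_aff c g s x : 0 < s -> tjet c g ->
  tjet (c / s + `|x|) (fun n y => s ^+ n * g n (s * (y - x))).
Proof.
move=> s0 [jg vg]; split.
  move=> n y; apply: is_derive_eq (derivZ _ (deriv_aff (jg n _))) _.
  by rewrite exprSr; ring.
move=> y cy; rewrite vg ?mulr0// normrM (gtr0_norm s0) mulrC -ltr_pdivrMr//.
have : `|y| <= `|y - x| + `|x| by rewrite -[X in `|X| <= _](subrK x) ler_normD.
lra.
Qed.

End Jets.

(** * Differentiation of a pairing with respect to a parameter *)

Section Pairing.
Context {R : realType}.
Variable f : schwartz_distribution R.
Implicit Types (g k : nat -> R -> R) (h : R -> R) (a b c x y s eps del B C : R).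

Lemma pair_lin c g k s : tjet c g -> tjet c k ->
  f (fun x => s * g 0%N x + k 0%N x) = s * f (g 0%N) + f (k 0%N).
Proof. by move=> tg tk; rewrite pairing_linear//; apply: tjet_test; eassumption. Qed.

Lemma pair0 : f (fun=> 0) = 0.
Proof.
have := @pair_lin 0 _ _ 1 (tjet0 0) (tjet0 0).
have -> : (fun x : R => 1 * 0 + 0) = (fun=> 0) :> (R -> R).
  by apply/funext => x; rewrite mulr0 addr0.
by move=> /= H; lra.
Qed.

Lemma pairZ c g s : tjet c g -> f (fun x => s * g 0%N x) = s * f (g 0%N).
Proof.
move=> tg; have := pair_lin s tg (tjet0 c); rewrite pair0 addr0 => <-.
by congr (f _); apply/funext => x; rewrite addr0.
Qed.

Lemma pairD c g k : tjet c g -> tjet c k ->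
  f (fun x => g 0%N x + k 0%N x) = f (g 0%N) + f (k 0%N).
Proof.
move=> tg tk; have := pair_lin 1 tg tk; rewrite mul1r => <-.
by congr (f _); apply/funext => x; rewrite mul1r.
Qed.

Lemma pairB c g k : tjet c g -> tjet c k ->
  f (fun x => g 0%N x - k 0%N x) = f (g 0%N) - f (k 0%N).
Proof.
move=> tg tk; have := pair_lin (-1) tk tg; rewrite mulN1r addrC => <-.
by congr (f _); apply/funext => x; rewrite mulN1r addrC.
Qed.

(** One common bound on finitely many derivatives replaces the sum of suprema. [C] and [N] depend on
    the radius [c] only, and [C] is positive so that it can be divided by. *)
Lemma pair_bound c : exists C, exists N : nat, 0 < C /\
  forall g B, tjet c g -> (forall n x, (n <= N)%N -> `|g n x| <= B) ->
    `|f (g 0%N)| <= C * B.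
Proof.
have [C [N H]] := pairing_continuous f (@segment_compact R (- c) c).
exists (`|C| * N.+1%:R + 1), N; split.
  by have := mulr_ge0 (normr_ge0 C) (ler0n R N.+1); lra.
move=> g B tg gB.
have B0 : 0 <= B := le_trans (normr_ge0 _) (gB 0%N 0 (leq0n _)).
apply: le_trans (H _ (tjet_test tg) (vanish_supp tg.2)) _.
set S := \sum_(_ < _) _.
have SB : S <= N.+1%:R * B.
  rewrite mulr_natl -[N.+1 in leRHS]card_ord -sumr_const; apply: ler_sum => i _.
  apply: ge_sup; first by eexists; exists 0.
  move=> _ [x _ <-]; rewrite (jet_derive1n _ tg.1); apply: gB.
  by rewrite -ltnS.
have S0 : 0 <= S.
  apply: sumr_ge0 => i _; apply: le_trans (normr_ge0 (derive1n i (g 0%N) 0)) _.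
  apply: ub_le_sup; last by exists 0.
  exists B => _ [x _ <-]; rewrite (jet_derive1n _ tg.1); apply: gB.
  by rewrite -ltnS.
apply: le_trans (ler_norm _) _; rewrite normrM (ger0_norm S0).
apply: le_trans (ler_wpM2l (normr_ge0 C) SB) _.
by rewrite mulrA; lra.
Qed.

(** [f] sees only the derivatives up to some order [N], so convergence of the difference quotients
    uniform in [y], for each [n] separately, is enough: finitely many [del] have a minimum. The
    fixed radius [c] keeps all supports in one compact set. *)
Lemma pair_derive (c : R) (G : R -> nat -> R -> R) D (q : R -> R) x :
  (forall e, `|e| < 1 -> tjet c (G e)) -> tjet c D ->
  (forall e, `|e| < 1 -> q (x + e) - q x = f (G e 0%N)) ->
  (forall n eps, 0 < eps -> exists2 del : R, 0 < del & forall e y, `|e| < del ->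
     `|G e n y - e * D n y| <= eps * `|e|) ->
  is_derive x 1 q (f (D 0%N)).
Proof.
move=> tG tD qE H; apply: is_derive_eps => eps e0.
have [C [N [C0 HC]]] := pair_bound c.
have [del d0 Hd] : exists2 del : R, 0 < del & forall n e y, (n <= N)%N -> `|e| < del ->
     `|G e n y - e * D n y| <= eps / C * `|e|.
  elim: N {HC} => [|N [d d0 IH]].
    have [d d0 Hd] := H 0%N _ (divr_gt0 e0 C0).
    by exists d => // n e y; rewrite leqn0 => /eqP->; exact: Hd.
  have [d' d'0 Hd'] := H N.+1 _ (divr_gt0 e0 C0).
  exists (Num.min d d'); first by rewrite lt_min d0.
  move=> n e y; rewrite leq_eqVlt lt_min => /orP[/eqP->|nN] /andP[p p'].
    exact: Hd'.
  exact: IH.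
exists (Num.min del 1); first by rewrite lt_min d0 ltr01.
move=> e; rewrite lt_min => /andP[ed e1].
rewrite qE// -(pairZ e tD).
have tD' : tjet c (fun n y => e * D n y).
  by split; [move=> n y; apply: derivZ; exact: tD.1|move=> y cy; rewrite tD.2 ?mulr0].
have tGD : tjet c (fun n y => G e n y - e * D n y).
  have := tjet_lin (-1) tD' (tG e e1).
  by congr tjet; apply/funext => n; apply/funext => y; ring.
rewrite -(pairB (tG e e1) tD').
apply: le_trans (HC (fun n y => G e n y - e * D n y) (eps / C * `|e|) tGD _) _.
  by move=> n y nN; exact: Hd.
by rewrite mulrA mulrCA divff ?gt_eqF// mulr1.
Qed.

End Pairing.

(** * Convolution *)

Section Convolution.
Context {R : realType}.
Implicit Types (g k : nat -> R -> R) (h : R -> R) (a b c x y s t r eps del B C : R).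

Lemma tjet_transl c k x : tjet c k -> tjet (c + `|x|) (fun n y => k n (y - x)).
Proof.
move=> /(tjet_aff x ltr01); rewrite divr1; congr tjet.
by apply/funext => n; apply/funext => y; rewrite expr1n !mul1r.
Qed.

Lemma tjet_boundN c g N : tjet c g ->
  exists2 B : R, 0 < B & forall n x, (n <= N)%N -> `|g n x| <= B.
Proof.
move=> tg; elim: N => [|N [B B0 HB]].
  have [B B0 HB] := tjet_bound 0 tg.
  by exists B => // n x; rewrite leqn0 => /eqP->.
have [B' B'0 HB'] := tjet_bound N.+1 tg.
exists (B + B'); first exact: addr_gt0.
move=> n x; rewrite leq_eqVlt => /orP[/eqP->|nN]; first by have := HB' x; lra.
by have := HB n x nN; lra.
Qed.

Lemma cont_bound_seg h a b : continuous h ->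
  exists2 B : R, 0 < B & forall x, a <= x <= b -> `|h x| <= B.
Proof.
move=> ch.
have /compact_bounded[M [_ HM]] : compact (h @` `[a, b]).
  by apply: continuous_compact; [exact: continuous_subspaceT|exact: segment_compact].
exists (`|M| + 1); first by have := normr_ge0 M; lra.
move=> x xab; apply: HM; first by have := ler_norm M; lra.
by exists x => //=; rewrite in_itv.
Qed.

(** All derivatives fall on [k], so that [h] need only be continuous and may be cut off sharply at
    [a] and [b]. *)
Definition conv a b h k (n : nat) y := integ (fun x => h x * k n (y - x)) a b.

Lemma cont_conv h k n y : continuous h -> jet k -> continuous (fun x => h x * k n (y - x)).
Proof. by move=> ch jk; apply: contM => //; apply: cont_refl; exact: jet_cont. Qed.

Lemma jet_conv a b h c k : continuous h -> tjet c k -> jet (conv a b h k).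
Proof.
move=> ch tk n y; have jk := tk.1.
have [B B0 HB] := @cont_bound_seg h (a - `|b - a|) (a + `|b - a|) ch.
have [C C0 HC] := tjet_bound n.+2 tk.
apply: is_derive_eps => eps e0.
(* The summand 1 keeps the divisor positive when [a = b]. *)
have BC0 : 0 < B * C * (`|b - a| + 1).
  by rewrite !mulr_gt0//; have := normr_ge0 (b - a); lra.
exists (eps / (B * C * (`|b - a| + 1))); first exact: divr_gt0.
move=> e; rewrite ltr_pdivlMr// => He.
have -> : conv a b h k n (y + e) - conv a b h k n y - e * conv a b h k n.+1 y =
  integ (fun x => h x * (k n (y - x + e) - k n (y - x) - e * k n.+1 (y - x))) a b.
  have c0 : continuous (fun x => h x * k n (y + e - x)) by exact: cont_conv.
  have c1 : continuous (fun x => h x * k n (y - x)) by exact: cont_conv.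
  have c2 : continuous (fun x => h x * k n.+1 (y - x)) by exact: cont_conv.
  rewrite /conv -integB// -integZ// -integB//; last 2 first.
  - exact: contB.
  - exact: contZ.
  congr integ; apply/funext => x.
  by rewrite (_ : y - x + e = y + e - x); ring.
apply: le_trans (@integ_bound _ _ (B * (C * `|e| ^+ 2)) _ _ _ _) _.
- apply: contM => //; apply: contB; last by apply: contZ; apply: cont_refl; exact: jet_cont.
  apply: contB; last by apply: cont_refl; exact: jet_cont.
  have -> : (fun x => k n (y - x + e)) = (fun x => k n (y + e - x)).
    by apply/funext => x; rewrite addrAC.
  by apply: cont_refl; exact: jet_cont.
- move=> x xab; rewrite normrM ler_pM//.
    by apply: HB; move: xab; rewrite ler_norml; lra.
  exact: deriv2_bound (jk n) (jk n.+1) HC.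
rewrite expr2.
have -> : B * (C * (`|e| * `|e|)) * `|b - a| = (`|e| * (B * C * `|b - a|)) * `|e| by ring.
rewrite ler_wpM2r//; apply: le_trans (ltW He).
rewrite ler_wpM2l//; have := mulr_gt0 B0 C0; rewrite mulrDr; lra.
Qed.

(** Every [x] with [|x - a| <= |b - a|] satisfies [|x| <= 2 * |a| + |b|], whence a radius that is
    crude but valid for both orders of the ends. *)
Lemma conv_vanish a b h c k n : continuous h -> tjet c k ->
  vanish (c + 2 * `|a| + `|b|) (conv a b h k n).
Proof.
move=> ch tk y cy.
have : `|conv a b h k n y| <= 0 * `|b - a|.
  apply: integ_bound; first exact: cont_conv tk.1.
  move=> x xab; rewrite (tjet_vanish n tk) ?mulr0 ?normr0//.
  have : `|b - a| <= `|b| + `|a| by exact: ler_normB.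
  have : `|y| <= `|y - x| + `|x - a| + `|a|.
    have := ler_normD (y - x + (x - a)) a; have := ler_normD (y - x) (x - a).
    by rewrite (_ : y - x + (x - a) + a = y); [lra|ring].
  lra.
by rewrite mul0r normr_le0 => /eqP.
Qed.

Lemma tjet_conv a b h c k : continuous h -> tjet c k ->
  tjet (c + 2 * `|a| + `|b|) (conv a b h k).
Proof. by move=> ch tk; split; [exact: jet_conv tk|exact: conv_vanish]. Qed.

(** Integration by parts; the boundary terms vanish because [g m] is zero at [a] and [b]. *)
Lemma conv_parts a b c c' g k m n : tjet c g -> tjet c' k -> a < - c -> c < b -> 
  conv a b (g m) k n.+1 = conv a b (g m.+1) k n.
Proof.
move=> tg tk ac cb; apply/funext => y.
have d x : is_derive x 1 (fun x => g m x * k n (y - x))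
   (g m.+1 x * k n (y - x) + g m x * (- k n.+1 (y - x))).
  by apply: derivM; [exact: tg.1|apply: deriv_refl; exact: tk.1].
have c1 : continuous (fun x => g m.+1 x * k n (y - x)).
  by apply: cont_conv tk.1; apply: jet_cont; exact: tg.1.
have c2 : continuous (fun x => g m x * k n.+1 (y - x)).
  by apply: cont_conv tk.1; apply: jet_cont; exact: tg.1.
apply/eqP; rewrite eq_sym -subr_eq0 -integB//.
have cB := contB c1 c2.
have d' x : is_derive x 1 (fun x => g m x * k n (y - x))
   (g m.+1 x * k n (y - x) - g m x * k n.+1 (y - x)).
  by rewrite -mulrN; exact: d.
rewrite (integE _ _ cB d') !(tjet_vanish m tg) ?mul0r ?subrr//.
  by have := ler_norm (- a); rewrite normrN; lra.
by have := ler_norm b; lra.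
Qed.

Lemma conv_partsn a b c c' g k n : tjet c g -> tjet c' k -> a < - c -> c < b -> 
  conv a b (g 0%N) k n = conv a b (g n) k 0%N.
Proof.
move=> tg tk ac cb; have H i m : conv a b (g m) k i = conv a b (g (m + i)%N) k 0%N.
  elim: i m => [|i IH] m; first by rewrite addn0.
  by rewrite (conv_parts _ _ tg tk)// IH addSnnS.
by rewrite H.
Qed.

(** The jet of phi_t(z) = phi(z / t) / t: each derivative costs one more factor [t^-1]. *)
Definition kern t k (n : nat) y := t^-1 ^+ n.+1 * k n (t^-1 * y).

Lemma tjet_kern r k t : 0 < t -> tjet r k -> tjet (r * t) (kern t k).
Proof.
move=> t0 tk; have ti : 0 < t^-1 by rewrite invr_gt0.
have := tjet_lin t^-1 (tjet_aff 0 ti tk) (tjet0 _).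
rewrite invrK normr0 addr0; congr tjet.
by apply/funext => n; apply/funext => y; rewrite subr0 addr0 /kern exprS mulrA.
Qed.

Lemma cont_transl h c : continuous h -> continuous (fun y => h (y - c)).
Proof.
move=> ch x; apply: (@continuous_comp _ _ _ (fun x => x - c) h); last exact: ch.
by apply: (@contB _ id (fun=> c)); [move=> ?; exact: cvg_id|exact: cst_continuous].
Qed.

Lemma integ_vanish h r a b : continuous h -> vanish r h -> 0 <= r ->
  a <= - r -> r <= b -> integ h a b = integ h (- r) r.
Proof.
move=> ch vh r0 ar rb.
rewrite -(integ_cat h a (- r) b) -(integ_cat h (- r) r b).
have -> : integ h a (- r) = 0.
  rewrite (@integ_eq _ h (fun=> 0))// ?integ_cst ?mul0r//; first exact: cst_continuous.
  by move=> x xr; apply: vh; rewrite ltr0_norm; lra.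
have -> : integ h r b = 0.
  rewrite (@integ_eq _ h (fun=> 0))// ?integ_cst ?mul0r//; first exact: cst_continuous.
  by move=> x xr; apply: vh; rewrite gtr0_norm; lra.
by rewrite addr0 add0r.
Qed.

Lemma integ_kern r k t a b y : 0 < r -> 0 < t -> tjet r k ->
  integ (k 0%N) (- r) r = 1 -> a <= y - r * t -> y + r * t <= b ->
  integ (fun x => kern t k 0%N (y - x)) a b = 1.
Proof.
move=> r0 t0 tk k1 ay yb; have ck : continuous (k 0%N) by exact: jet_cont tk.1.
have ti : 0 < t^-1 by rewrite invr_gt0.
have ckt : continuous (kern t k 0%N) by apply: jet_cont; exact: (tjet_kern t0 tk).1.
have d x : is_derive x 1 (fun x => - prim (k 0%N) (t^-1 * (y - x))) (kern t k 0%N (y - x)).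
  rewrite /kern expr1.
  have dP := deriv_aff (s := t^-1) (c := 0) (primP ck (t^-1 * (y - x - 0))).
  have -> : (fun x0 => - prim (k 0%N) (t^-1 * (y - x0))) =
     (fun x0 => -1 * prim (k 0%N) (t^-1 * (y - x0 - 0))).
     by apply/funext => z; rewrite subr0 mulN1r.
  have := derivZ (-1) (deriv_refl (f := fun z => prim (k 0%N) (t^-1 * (z - 0))) dP).
  by rewrite !subr0 mulN1r opprK.
have ckr : continuous (fun x => kern t k 0%N (y - x)) by exact: cont_refl.
rewrite (integE a b ckr d).
rewrite -k1 -(@integ_vanish _ _ (t^-1 * (y - b)) (t^-1 * (y - a)) ck tk.2 (ltW r0)).
- by rewrite /integ; ring.
- by rewrite mulrC ler_pdivrMr//; lra.
- by rewrite mulrC ler_pdivlMr//; lra.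
Qed.

Lemma kern_ge0 k t y : 0 < t -> (forall x, 0 <= k 0%N x) -> 0 <= kern t k 0%N y.
Proof. by move=> t0 k0; rewrite /kern mulr_ge0// exprn_ge0// invr_ge0 ltW. Qed.

(** A kernel of mass one supported in [[- r * t, r * t]] averages [g n] over points at distance at
    most [r * t], between which it varies by at most [B * r * t]. *)
Lemma conv_approx r k t c g n B y : 0 < r -> 0 < t -> t <= 1 -> tjet r k ->
  (forall x, 0 <= k 0%N x) ->
  integ (k 0%N) (- r) r = 1 -> 0 < c -> tjet c g -> (forall x, `|g n.+1 x| <= B) ->
  `|conv (- (c + 2 * r + 1)) (c + 2 * r + 1) (g n) (kern t k) 0%N y - g n y| <= B * r * t.
Proof.
move=> r0 t0 t1 tk k0 k1 c0 tg gB.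
have B0 : 0 <= B := le_trans (normr_ge0 _) (gB 0).
have tkt := tjet_kern t0 tk.
have rt : r * t <= r by rewrite ger_pMr.
have rt0 : 0 < r * t by rewrite mulr_gt0.
have ckt : continuous (kern t k 0%N) by apply: jet_cont; exact: tkt.1.
have cg : continuous (g n) by apply: jet_cont; exact: tg.1.
(* For [|y| > c + r] both terms vanish, as [r * t <= r]; for the other [y] the interval of
   integration contains the whole support of the kernel, which has mass 1 there. *)
have [yc|yc] := lerP `|y| (c + r); last first.
  rewrite (tjet_vanish n tg); last by lra.
  rewrite subr0; apply: (@le_trans _ _ 0); last first.
    by rewrite !mulr_ge0// ltW.
  apply: le_trans (@integ_bound _ _ 0 _ _ _ _) _; last by rewrite mul0r.
    exact: cont_conv tkt.1.
  move=> x _; have [xc|/(tjet_vanish n tg)->] := lerP `|x| c; last by rewrite mul0r normr0.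
  rewrite tkt.2 ?mulr0 ?normr0//.
  have : `|y| <= `|y - x| + `|x| by rewrite -[X in `|X| <= _](subrK x) ler_normD.
  lra.
move: (yc); rewrite ler_norml => /andP[yc1 yc2].
have K1 : integ (fun x => kern t k 0%N (y - x)) (- (c + 2 * r + 1)) (c + 2 * r + 1) = 1.
  by apply: (integ_kern r0 t0 tk k1); lra.
have ck2 : continuous (fun x => kern t k 0%N (y - x)) by exact: cont_refl.
have cgk : continuous (fun x => g n x * kern t k 0%N (y - x)) by exact: cont_conv tkt.1.
have KZ z : integ (fun x => z * kern t k 0%N (y - x)) (- (c + 2 * r + 1)) (c + 2 * r + 1) = z.
  by rewrite integZ// K1 mulr1.
have cZ z : continuous (fun x => z * kern t k 0%N (y - x)) by exact: contZ.
have -> : conv (- (c + 2 * r + 1)) (c + 2 * r + 1) (g n) (kern t k) 0%N y - g n y =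
  integ (fun x => g n x * kern t k 0%N (y - x) - g n y * kern t k 0%N (y - x))
    (- (c + 2 * r + 1)) (c + 2 * r + 1).
  by rewrite integB// KZ.
have E x : g n x * kern t k 0%N (y - x) - g n y * kern t k 0%N (y - x) =
   (g n x - g n y) * kern t k 0%N (y - x) by ring.
have est x : `|g n x * kern t k 0%N (y - x) - g n y * kern t k 0%N (y - x)|
   <= B * r * t * kern t k 0%N (y - x).
  rewrite E normrM (ger0_norm (kern_ge0 _ t0 k0)).
  have [xy|/tkt.2->] := lerP `|y - x| (r * t); last by rewrite !mulr0.
  rewrite ler_wpM2r// ?kern_ge0//.
  apply: le_trans (deriv_bound (tg.1 n) (fun z _ => gB z)) _.
  by rewrite -mulrA ler_wpM2l// distrC.
have ab : - (c + 2 * r + 1) <= c + 2 * r + 1 by lra.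
have cD : continuous (fun x => g n x * kern t k 0%N (y - x) - g n y * kern t k 0%N (y - x)).
  exact: contB.
rewrite ler_norml; apply/andP; split.
  rewrite -[X in X <= _]KZ; apply: integ_le => // x _.
  by have := est x; rewrite ler_norml mulNr => /andP[].
rewrite -[X in _ <= X]KZ; apply: integ_le => // x _.
by have := est x; rewrite ler_norml => /andP[].
Qed.

End Convolution.

Section Mollification.
Context {R : realType}.
Variable f : schwartz_distribution R.
Implicit Types (g k : nat -> R -> R) (h : R -> R) (a b c x y s t r eps del B C : R).

Definition mollify h x := f (fun y => h (y - x)).

(* This replaces Fubini: the pairing commutes with the integral because both sides
   have the same derivative in the endpoint. *)
Lemma pair_conv_derive a b h c k : continuous h -> tjet c k ->
  is_derive b 1 (fun x => f (conv a x h k 0%N)) (h b * mollify (k 0%N) b).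
Proof.
move=> ch tk.
have tkb := tjet_transl b tk.
rewrite /mollify -(pairZ f (h b) tkb).
(* Dominates the radii of all convolutions from [a] or [b] to [b + e] with [|e| < 1]. *)
pose c' := c + 2 * `|a| + 3 * `|b| + 1.
have b0 := normr_ge0 b; have a0 := normr_ge0 a.
have be e : `|e| < 1 -> `|b + e| <= `|b| + 1 by have := ler_normD b e; lra.
have tD : tjet c' (fun n y => h b * k n (y - b)).
  apply: (@tjetW _ (c + `|b|)); first by rewrite /c'; lra.
  have := tjet_lin (h b) tkb (tjet0 _).
  by congr tjet; apply/funext => n; apply/funext => y; rewrite addr0.
apply: (@pair_derive _ f c' (fun e => conv b (b + e) h k) _ _ _ _ tD).
- move=> e e1; apply: tjetW (tjet_conv b (b + e) ch tk).
  by have := be e e1; rewrite /c'; lra.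
- move=> e e1.
  have t1 : tjet c' (conv a (b + e) h k).
    by apply: tjetW (tjet_conv a (b + e) ch tk); have := be e e1; rewrite /c'; lra.
  have t2 : tjet c' (conv a b h k).
    by apply: tjetW (tjet_conv a b ch tk); have := be e e1; rewrite /c'; lra.
  rewrite -(pairB f t1 t2); congr (f _); apply/funext => y.
  by rewrite /conv -(integ_cat _ a b (b + e)); ring.
move=> n eps e0.
have [B B0 HB] := tjet_bound n tk.
have [B' B'0 HB'] := tjet_bound n.+1 tk.
pose hb := `|h b| + 1.
have hb0 : 0 < hb by rewrite /hb; have := normr_ge0 (h b); lra.
(* Half of [eps] pays for the variation of [h] near [b], the other half for that of [k n]. *)
have e1 : 0 < eps / (2 * B) by rewrite divr_gt0// mulr_gt0.
have e2 : 0 < eps / (2 * (hb * B')) by rewrite divr_gt0// !mulr_gt0.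
have : \forall x \near b, `|h b - h x| < eps / (2 * B).
  by have /cvgrPdist_lt := ch b; exact.
move=> /nbhs_ballP[d /= d0 Hd].
exists (Num.min d (eps / (2 * (hb * B')))); first by rewrite lt_min d0.
move=> e y; rewrite lt_min => /andP[ed ee].
have -> : e * (h b * k n (y - b)) = integ (fun=> h b * k n (y - b)) b (b + e).
  by rewrite integ_cst; ring.
rewrite -integB//; [|exact: cont_conv tk.1|exact: cst_continuous].
apply: le_trans (@integ_bound _ _ eps _ _ _ _) _; last 1 first.
- by rewrite addrC addKr.
- by apply: contB; [exact: cont_conv tk.1|exact: cst_continuous].
move=> x; have -> : b + e - b = e by ring.
move=> xb.
have -> : h x * k n (y - x) - h b * k n (y - b) =
  (h x - h b) * k n (y - x) + h b * (k n (y - x) - k n (y - b)) by ring.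
apply: le_trans (ler_normD _ _) _; rewrite !normrM.
have p1 : `|h x - h b| * `|k n (y - x)| <= eps / (2 * B) * B.
  rewrite ler_pM// distrC ltW//; apply: Hd; rewrite /ball/= distrC.
  exact: le_lt_trans ed.
have p2 : `|h b| * `|k n (y - x) - k n (y - b)| <= hb * (B' * (eps / (2 * (hb * B')))).
  rewrite ler_pM//; first by rewrite /hb; lra.
  apply: le_trans (deriv_bound (tk.1 n) (fun z _ => HB' z)) _.
  rewrite ler_wpM2l ?(ltW B'0)//.
  have -> : y - x - (y - b) = - (x - b) by ring.
  by rewrite normrN; apply: le_trans xb (ltW ee).
have -> : eps = eps / (2 * B) * B + hb * (B' * (eps / (2 * (hb * B')))).
  by field; rewrite !gt_eqF.
exact: lerD.
Qed.

Lemma mollify_derive x c k : tjet c k ->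
  is_derive x 1 (mollify (k 0%N)) (- mollify (k 1%N) x).
Proof.
move=> tk.
pose D n y := -1 * k n.+1 (y - x) + 0.
pose c' := c + `|x| + 1.
have tk1 : tjet (c + `|x|) (fun n y => k n.+1 (y - x)).
  exact: tjet_transl (tjet_shift 1 tk).
have tD : tjet c' D.
  apply: (@tjetW _ (c + `|x|)); first by rewrite /c'; lra.
  exact: tjet_lin tk1 (tjet0 _).
have -> : - mollify (k 1%N) x = f (D 0%N).
  rewrite -mulN1r -(pairZ f (-1) tk1); congr (f _).
  by apply/funext => y; rewrite /D addr0.
have tT e : `|e| < 1 -> tjet c' (fun n y => k n (y - (x + e))).
  move=> e1; apply: tjetW (tjet_transl (x + e) tk).
  by have := ler_normD x e; rewrite /c'; lra.
have tx : tjet c' (fun n y => k n (y - x)).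
  by apply: tjetW (tjet_transl x tk); rewrite /c'; lra.
apply: (@pair_derive _ f c' (fun e n y => k n (y - (x + e)) - k n (y - x)) _ _ _ _ tD).
- move=> e e1; have := tjet_lin (-1) tx (tT e e1); congr tjet.
  by apply/funext => n; apply/funext => y; rewrite addrC mulN1r.
- by move=> e e1; rewrite /mollify -(pairB f (tT e e1) tx).
move=> n eps e0; have [B B0 HB] := tjet_bound n.+2 tk.
exists (eps / B); first exact: divr_gt0.
move=> e y; rewrite ltr_pdivlMr// => He; rewrite /D.
have := deriv2_bound (y - x) (- e) (tk.1 n) (tk.1 n.+1) HB.
have -> : y - x + - e = y - (x + e) by ring.
rewrite normrN expr2 mulrA.
have -> : k n (y - (x + e)) - k n (y - x) - e * (-1 * k n.+1 (y - x) + 0) =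
  k n (y - (x + e)) - k n (y - x) - - e * k n.+1 (y - x) by ring.
move=> /le_trans; apply; rewrite ler_wpM2r// mulrC; exact: ltW.
Qed.

(** Integration by parts turns the [n]-th derivative of the convolution into the convolution of
    [g n], which converges uniformly. [f] sees derivatives up to [N], and the rate for each involves
    the next one, hence bounds up to [N.+1]. *)
Lemma pair_conv_cvg r k c g : 0 < r -> tjet r k -> (forall x, 0 <= k 0%N x) ->
  integ (k 0%N) (- r) r = 1 -> 0 < c -> tjet c g ->
  forall eps, 0 < eps -> exists2 del : R, 0 < del & forall t, 0 < t -> t < del ->
    `|f (conv (- (c + 2 * r + 1)) (c + 2 * r + 1) (g 0%N) (kern t k) 0%N) - f (g 0%N)| <= eps.
Proof.
move=> r0 tk k0 k1 c0 tg eps e0.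
set b := c + 2 * r + 1.
pose c' := r + 3 * b.
have b0 : 0 < b by rewrite /b; lra.
have [C [N [C0 HC]]] := pair_bound f c'.
have [B B0 HB] := tjet_boundN N.+1 tg.
have CB : 0 < C * (B * r) by rewrite !mulr_gt0.
exists (Num.min 1 (eps / (C * (B * r)))); first by rewrite lt_min ltr01 divr_gt0.
move=> t t0; rewrite lt_min => /andP[/ltW t1 te].
have tkt := tjet_kern t0 tk.
have cg : continuous (g 0%N) by apply: jet_cont; exact: tg.1.
have t2 : tjet c' (conv (- b) b (g 0%N) (kern t k)).
  apply: tjetW (tjet_conv (- b) b cg tkt); rewrite /c' normrN gtr0_norm//.
  have : r * t <= r by rewrite ger_pMr.
  lra.
have t3 : tjet c' g by apply: tjetW tg; rewrite /c' /b; lra.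
rewrite -(pairB f t2 t3).
have tl := tjet_lin (-1) t3 t2.
have E : (fun n x => -1 * g n x + conv (- b) b (g 0%N) (kern t k) n x) =
  (fun n x => conv (- b) b (g 0%N) (kern t k) n x - g n x).
  by apply/funext => n; apply/funext => x; rewrite addrC mulN1r.
rewrite E in tl.
apply: le_trans (HC _ (B * r * t) tl _) _.
  move=> n y nN; rewrite (conv_partsn _ tg tkt); rewrite /b; [|lra|lra].
  by apply: conv_approx => // x; apply: HB.
have -> : C * (B * r * t) = t * (C * (B * r)) by ring.
by rewrite -ler_pdivlMr// ltW.
Qed.

End Mollification.

(** * Points of descent of a monotone function *)

Section RisingSun.
Context {R : realType}.
Implicit Types (a b c x y s t M eps del : R).
Local Notation mu := (@lebesgue_measure R).

(** When g(x) = F(x) + n x and the slope is n - m, these are the points after which F falls with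
    slope at least m all the way to [b]. *)
Definition descent (g : R -> R) M b : set R :=
  [set n | forall y, n <= y -> y <= b -> g y - g n <= M * (y - n)].

Lemma descent_closed (g : R -> R) M a b : continuous g ->
  closed (descent g M b `&` `[a, b]).
Proof.
move=> cg x clx.
have xab : `[a, b]%classic x.
  have : closed `[a, b]%classic by exact: interval_closed.
  by apply; apply: closure_subset clx => z [].
split=> // y; rewrite le_eqVlt => /orP[/eqP<- _|xy yb]; first by rewrite !subrr mulr0.
apply/ler_addgt0Pr => e e0.
pose d z := g z - M * z.
have cd : continuous d.
  move=> z; apply: (@continuousB _ R R); first exact: cg.
  by apply: (@continuousM R R); [exact: cst_continuous|exact: cvg_id].
have : \forall z \near x, `|d x - d z| < e /\ z < y.
  near=> z; split; last by near: z; exact: lt_nbhsl.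
  by near: z; have /cvgrPdist_lt := cd x; apply.
move=> /clx[z [[dz _] [xz zy]]].
have := dz y (ltW zy) yb.
by move: xz; rewrite ltr_norml /d => /andP[]; rewrite !mulrBr; lra.
Unshelve. all: by end_near. Qed.

(* If the set [N] of points of descent were null, enclose it in an open [W] of small
   measure and let [s] be the supremum of the [x] such that
   [d a - M * mu (W `&` [a, x]) <= d y] for some [y >= x].  A maximum of [d] on
   [[x, b]] is attained in [N], hence [N s]; but [W] contains a neighbourhood of [s], on
   which [d] falls with slope at most [M], so the inequality propagates to the right
   of [s] up to [b]. *)
Lemma rising_sun (g : R -> R) M a b : continuous g -> {homo g : x y / x <= y} -> a < b -> 0 < M ->
  g b - g a < M * (b - a) -> (0 < mu (descent g M b `&` `[a, b]))%E.
Proof.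
move=> cg ng ab M0 gab; set N := descent _ _ _ `&` _.
have clN : closed N by exact: descent_closed.
have mN : measurable N by exact: measurable_realfun.closed_measurable.
rewrite lt0e measure_ge0 andbT; apply/negP => /eqP N0.
pose d z := g z - M * z.
have cd : continuous d.
  move=> z; apply: (@continuousB _ R R); first exact: cg.
  by apply: (@continuousM R R); [exact: cst_continuous|exact: cvg_id].
have dab : d b < d a by rewrite /d; move: gab; rewrite mulrBr; lra.
(* Reaching [b] with [m b < eps] will bound the drop [d a - d b] by [M * eps], which is half of
   it. *)
pose eps := (d a - d b) / (2 * M).
have e0 : 0 < eps by rewrite divr_gt0 ?subr_gt0// mulr_gt0.
have Nfin : (mu N < +oo)%E by rewrite N0 ltry.
have [W [oO NO Oe]] := lebesgue_regularity_outer mN Nfin e0.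
have mO : measurable W by exact: measurable_realfun.open_measurable.
have mOe : (mu W < eps%:E)%E.
  have : (mu W <= mu N + mu (W `\` N))%E.
    by rewrite -{1}(setDUK NO); apply: measureU2 => //; exact: measurableD.
  by rewrite [X in (_ <= X + _)%E]N0 add0e => /le_lt_trans; apply.
pose m x := fine (mu (W `&` `[a, x])).
have mfin x : mu (W `&` `[a, x]) \is a fin_num.
  rewrite ge0_fin_numE//; apply: le_lt_trans (lt_trans mOe (ltry _)).
  by apply: le_measure; rewrite ?inE//; exact: measurableI.
have mle x : m x < eps.
  rewrite -lte_fin fineK//; apply: le_lt_trans mOe.
  by apply: le_measure; rewrite ?inE//; exact: measurableI.
have m0 x : 0 <= m x by rewrite fine_ge0.
(* An interval inside [W] counts with its full length; taken half-open at [y], it is disjoint from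
   [[a, x]] even if [x = y]. *)
have mincr x y y' : a <= x -> x <= y -> y <= y' -> (`[y, y']%classic `<=` W) ->
    m x + (y' - y) <= m y'.
  move=> ax xy; rewrite le_eqVlt => /orP[/eqP<- _|yy' yO].
    rewrite subrr addr0 /m fine_le//; apply: le_measure; rewrite ?inE//; try exact: measurableI.
    by apply: setIS; apply: subset_itvl; rewrite bnd_simp.
  rewrite -lee_fin EFinD !fineK//.
  have -> : (y' - y)%:E = mu `]y, y']%classic.
    by rewrite /= lebesgue_measure_itv /= lte_fin yy' EFinB.
  rewrite -(measureU mu)//.
  - apply: le_measure; rewrite ?inE; [|exact: measurableI|].
      by apply: measurableU => //; exact: measurableI.
    move=> z [[Oz]|] /=; rewrite !in_itv /= => /andP[p q].
      by split => //; rewrite p; apply: le_trans q _; lra.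
    split; first by apply: yO; rewrite /= in_itv /=; lra.
    by rewrite ?in_itv /=; lra.
  - exact: measurableI.
  - by rewrite -subset0 => z [[_ /=]]; rewrite in_itv /= => p; rewrite in_itv /= => q; lra.
pose T x := a <= x <= b /\ exists2 y, x <= y <= b & d a - M * m x <= d y.
have Ta : T a.
  split; first by rewrite lexx ltW.
  by exists a; [rewrite lexx ltW|have := mulr_ge0 (ltW M0) (m0 a); lra].
have Tb : has_sup T by split; [exists a|exists b => x [/andP[]]].
pose s := sup T.
have sab : a <= s <= b.
  rewrite ub_le_sup//; last by case: Tb.
  by apply: ge_sup; [exists a|move=> x [/andP[]]].
have step x : T x -> exists2 y, x <= y <= s & N y /\ d a - M * m x <= d y.
  move=> Tx; have [/andP[ax xb] [y0 /andP[xy0 y0b] Hy0]] := Tx.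
  have [y + ymax] := @EVT_max R d x b xb (continuous_subspaceT cd).
  rewrite in_itv /= => /andP[xy yb].
  have dy : d a - M * m x <= d y.
    by apply: le_trans Hy0 (ymax _ _); rewrite in_itv /= xy0.
  exists y; last first.
    split => //; split; last by rewrite /= in_itv /= yb (le_trans ax).
    move=> z yz zb; have := ymax z; rewrite in_itv /= zb (le_trans xy yz) => /(_ isT).
    by rewrite /d mulrBr; lra.
  rewrite xy /=; apply: ub_le_sup; first by case: Tb.
  split; first by rewrite yb (le_trans ax).
  exists y; rewrite ?lexx//; apply: le_trans dy.
  have : m x <= m y.
    rewrite /m fine_le//; apply: le_measure; rewrite ?inE//; try exact: measurableI.
    by apply: setIS; apply: subset_itvl; rewrite bnd_simp.
  by move=> /(ler_wpM2l (ltW M0)); lra.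
(* The maxima attained between points of [T] and [s] accumulate at [s], and [N] is closed. *)
have Ns : N s.
  apply: clN => B /nbhs_ballP[e /= e'0 sB].
  have [x Tx sx] := sup_adherent e'0 Tb.
  have [y /andP[xy ys] [Ny _]] := step x Tx.
  exists y; split => //; apply: sB; rewrite /ball /= -/s in sx *.
  by rewrite ger0_norm; lra.
have [e /= e'0 sB] : exists2 e : R, 0 < e & ball s e `<=` W.
  by have /nbhs_ballP[e] := open_nbhs_nbhs (conj oO (NO _ Ns)); exists e.
have [x Tx sx] := sup_adherent e'0 Tb; rewrite -/s in sx.
have [y /andP[xy ys] [Ny dy]] := step x Tx.
have [/andP[ax xb] _] := Tx.
(* To the right of [s] unless [b] intervenes; since [T y'] will force [y' <= s], it must be [b]. *)
pose y' := Num.min (s + e / 2) b.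
have sy' : s <= y' by rewrite le_min; have /andP[_ ->] := sab; rewrite andbT; lra.
have y'b : y' <= b by rewrite ge_min lexx orbT.
have y'e : y' <= s + e / 2 by rewrite ge_min lexx.
have yy' : y <= y' by lra.
have yO : `[y, y']%classic `<=` W.
  move=> z; rewrite /= in_itv /= => /andP[yz zy]; apply: sB; rewrite /ball/=.
  by rewrite ltr_norml; lra.
have mm := mincr x y y' ax xy yy' yO.
have dy' : d a - M * m y' <= d y'.
  have gg := ng _ _ yy'.
  have : M * (m x + (y' - y)) <= M * m y' by rewrite ler_wpM2l// ltW.
  by move: dy; rewrite /d mulrDr mulrBr; lra.
have Ty' : T y'.
  split; first by rewrite y'b andbT; lra.
  by exists y'; rewrite ?lexx.
have y's : y' <= s by apply: ub_le_sup; case: Tb.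
have y'E : y' = b.
  apply/eqP; rewrite eq_le y'b /= leNgt; apply/negP => lt.
  have : s + e / 2 <= y'.
    by move: lt; rewrite /y' gt_min => /orP[?|]; [rewrite le_min lexx; lra|rewrite ltxx].
  lra.
have := mle b; rewrite y'E in dy'.
rewrite /eps ltr_pdivlMr ?mulr_gt0//; lra.
Qed.

End RisingSun.

(** * Lebesgue density at small scales *)

Section Density.
Context {R : realType}.
Implicit Types (a b c x y s t M eps del : R).
Local Notation mu := (@lebesgue_measure R).

(** An interval []y - eta * t, y[] free of [N] lies in the ball of radius [2 * t] about [x] and
    takes up the fraction [eta / 4] of it, which Lebesgue density forbids for small [t]. The ends
    [a], [b] and the set [Z] are avoided because they are null. *)
Lemma density_point (N Z : set R) a b : measurable N -> N `<=` `[a, b] ->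
  (0 < mu N)%E -> mu.-negligible Z ->
  exists x, [/\ N x, ~ Z x, a < x < b & forall eta : R, 0 < eta -> eta < 1 ->
    exists2 del : R, 0 < del & forall t, 0 < t -> t < del -> forall y, `|y - x| <= t ->
      exists n, N n /\ y - eta * t < n < y].
Proof.
move=> mN Nab N0 nZ.
have nD := lebesgue_density mN.
have n1 c : mu.-negligible [set c].
  by exists [set c]; split => //; exact: lebesgue_measure_set1.
have nE : mu.-negligible [set a; b] by exact: negligibleU (n1 a) (n1 b).
have nA := negligibleU nZ (negligibleU nE nD).
have [x Nx xA] : exists2 x, N x & ~ (Z `|` ([set a; b] `|` ~` [set x |
    (fun r => mu (N `&` ball x r) * (mu (ball x r))^-1)%E r @[r --> 0^'+] --> (\1_N x)%:E])) x.
  apply: contrapT => H; move: N0; rewrite lt_neqAle => /andP[/eqP + _]; apply.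
  apply/esym/measure_negligible => //; apply: negligibleS nA => x Nx; apply: contrapT => nx.
  by apply: H; exists x.
exists x; move: xA => /not_orP[nZx /not_orP[nEx /contrapT Dx]]; split => //.
  have := Nab _ Nx; rewrite /= in_itv /= => /andP[ax xb].
  by rewrite !lt_neqAle ax xb !andbT; apply/andP; split; apply/eqP => E; apply: nEx; [left|right].
move=> eta eta0 eta1.
have : \forall t \near 0^'+, ((1 - eta / 4)%:E < mu (N `&` ball x t) * (mu (ball x t))^-1)%E.
  move: Dx => /=; rewrite indicE mem_set//= => Dx.
  have lt1 : ((1 - eta / 4)%:E < (1%:R)%:E :> \bar R)%E by rewrite lte_fin; lra.
  exact: Dx (open_ereal_gt' lt1).
move=> [d /= d0 Hd]; exists (d / 2); first by rewrite divr_gt0.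
move=> t t0 td y yx; apply: contrapT => nN.
have et0 : 0 < eta * t by rewrite mulr_gt0.
have ett : eta * t < t by rewrite gtr_pMl.
have /= := Hd (2 * t); rewrite sub0r normrN gtr0_norm ?mulr_gt0// => /(_ ltac:(lra) isT).
rewrite lebesgue_measure_ball; last by lra.
apply/negP; rewrite -leNgt.
have -> : (2 * t) *+ 2 = 4 * t :> R by rewrite -mulr_natl; ring.
rewrite inver gt_eqF ?mulr_gt0// lee_pdivrMr ?mulr_gt0//.
have mN' : measurable (N `&` ball x (2 * t)).
  by apply: measurableI => //; exact: measurable_realfun.measurable_ball.
pose J := `]y - eta * t, y[%classic.
have mI : mu J = (eta * t)%:E.
  rewrite /= lebesgue_measure_itv /= lte_fin ifT; last by lra.
  by rewrite -EFinB; congr EFin; ring.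
have : (mu (N `&` ball x (2 * t)) + mu J <= mu (ball x (2 * t)))%E.
  rewrite -(measureU mu)//.
  - apply: le_measure; rewrite ?inE; [apply: measurableU; [exact: mN'|exact: measurable_itv]|exact: measurable_realfun.measurable_ball|].
    move=> z [[]//|]; rewrite /J /= in_itv /= /ball /= => /andP[p q].
    by move: yx; rewrite ler_norml ltr_norml; lra.
  - exact: measurable_itv.
  - rewrite -subset0 => z [[Nz _]] ; rewrite /J /= in_itv /= => zy; apply: nN.
    by exists z.
rewrite mI lebesgue_measure_ball; last by lra.
have -> : (2 * t) *+ 2 = 4 * t :> R by rewrite -mulr_natl; ring.
have -> : ((1 - eta / 4)%:E * (4 * t)%:E = (4 * t)%:E - (eta * t)%:E)%E.
  by rewrite -EFinM -EFinB; congr EFin; field.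
by rewrite leeBrDr.
Qed.

End Density.

(** * The transforms of a distribution and of its primitive *)

Section Limits.
Context {R : realType}.
Implicit Types (h : R -> R) (a b c x y s t eps del : R).

Lemma cvg0_le h k l l' : h t @[t --> 0^'+] --> l -> k t @[t --> 0^'+] --> l' ->
  (exists2 del : R, 0 < del & forall t, 0 < t -> t < del -> h t <= k t) -> l <= l'.
Proof.
move=> hl kl [del d0 H]; apply: (ler_cvg_to hl kl).
near=> t; apply: H.
  by near: t; exact: nbhs_right_gt.
by near: t; exact: nbhs_right_lt.
Unshelve. all: by end_near. Qed.

Lemma cvg0P h l : (forall eps, 0 < eps -> exists2 del : R, 0 < del &
    forall t, 0 < t -> t < del -> `|h t - l| <= eps) -> h t @[t --> 0^'+] --> l.
Proof.
move=> H; apply/cvgrPdist_le => eps /H[del d0 Hd].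
near=> t; rewrite distrC; apply: Hd.
  by near: t; exact: nbhs_right_gt.
by near: t; exact: nbhs_right_lt.
Unshelve. all: by end_near. Qed.

Lemma cvg0_ltP h l : h t @[t --> 0^'+] --> l -> forall eps, 0 < eps ->
  exists2 del : R, 0 < del & forall t, 0 < t -> t < del -> `|h t - l| < eps.
Proof.
move=> /cvgrPdist_lt hl eps /hl [/= d d0 Hd]; exists d => // t t0 td.
by rewrite distrC; apply: Hd => //=; rewrite sub0r normrN gtr0_norm.
Qed.

Lemma integ_transl h a b s : continuous h ->
  integ (fun y => h (y - s)) a b = integ h (a - s) (b - s).
Proof.
move=> ch; have cs : continuous (fun y => h (y - s)) by exact: cont_transl.
have d x : is_derive x 1 (fun y => prim h (y - s)) (h (x - s)).
  have := deriv_aff (s := 1) (c := s) (primP ch (1 * (x - s))).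
  by rewrite !mul1r; congr is_derive; apply/funext => y; rewrite mul1r.
by rewrite (integE _ _ cs d).
Qed.

Lemma integ_shrink h a b a' b' : continuous h -> a' <= a -> b <= b' ->
  (forall y, y <= a -> h y = 0) -> (forall y, b <= y -> h y = 0) ->
  integ h a' b' = integ h a b.
Proof.
move=> ch aa bb ha hb; rewrite -(integ_cat h a' a b') -(integ_cat h a b b').
have c0 : continuous (fun _ : R => 0 : R) by exact: cst_continuous.
have -> : integ h a' a = 0.
  rewrite (integ_eq ch c0 aa) ?integ_cst ?mul0r// => x /andP[_ /ltW]; exact: ha.
have -> : integ h b b' = 0; last by rewrite add0r addr0.
rewrite (integ_eq ch c0 bb) ?integ_cst ?mul0r// => x /andP[/ltW + _]; exact: hb.
Qed.

Lemma integ_test h c : continuous h -> 0 <= c -> vanish c h ->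
  \int[@lebesgue_measure R]_x h x = integ h (- c) c.
Proof.
move=> ch c0 vh; rewrite integ_Lebesgue//; last by lra.
rewrite [RHS]Rintegral_mkcond; congr Rintegral; apply/funext => x.
rewrite /patch; case: ifPn => //; rewrite notin_setE /= in_itv /= -ler_norml.
by move=> /negP; rewrite -ltNge => /vh.
Qed.

End Limits.

Section Setting.
Context {R : realType} (f F : schwartz_distribution R)
  (hfF : is_distr_derivative f F) (hF : lojasiewicz F)
  (k : nat -> R -> R) (r : R) (r0 : 0 < r) (tk : tjet r k)
  (k0 : forall x, 0 <= k 0%N x) (k1 : integ (k 0%N) (- r) r = 1).
Implicit Types (g : nat -> R -> R) (h : R -> R) (a b c x y s t M eps del : R).

(* The phi-transforms of [f] and [F] at the point [(x, t)]; since [f] is the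
   derivative of [F], [utr t] is the derivative of [Utr t]. *)
Definition utr t x := mollify f (kern t k 0%N) x.
Definition Utr t x := mollify F (kern t k 0%N) x.

(** The sign from differentiating the translated kernel cancels the one in the definition of the
    distributional derivative. *)
Lemma mollify_primitive c g x : tjet c g ->
  is_derive x 1 (mollify F (g 0%N)) (mollify f (g 0%N) x).
Proof.
move=> tg; have /is_derive_eq := mollify_derive F x tg; apply.
have tx := tjet_transl x tg.
rewrite /mollify (hfF (tjet_test tx)); congr (- F _).
by rewrite -derive1n1 (jet_derive1n 1 tx.1).
Qed.

Lemma Utr_derive t x : 0 < t -> is_derive x 1 (Utr t) (utr t x).
Proof. by move=> t0; exact: mollify_primitive (tjet_kern t0 tk). Qed.

Lemma utr_cont t : 0 < t -> continuous (utr t).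
Proof.
by move=> t0; apply: is_derive_cont => x; exact: mollify_derive (tjet_kern t0 tk).
Qed.

Definition pvalue x : R := xget 0 [set gamma | has_point_value F x gamma].

Lemma pvalueP x : has_point_value F x (pvalue x).
Proof.
rewrite /pvalue; have [g Hg] := hF x.
by case: xgetP => [y _ //|/(_ g)].
Qed.

Lemma mollify_kernE c g t x (T : schwartz_distribution R) : 0 < t -> tjet c g ->
  mollify T (kern t g 0%N) x = t^-1 * T (fun y => g 0%N ((y - x) / t)).
Proof.
move=> t0 tg; have ti : 0 < t^-1 by rewrite invr_gt0.
have ta := tjet_aff x ti tg.
have -> : (fun y => g 0%N ((y - x) / t)) = (fun y => t^-1 ^+ 0 * g 0%N (t^-1 * (y - x))).
  by apply/funext => y; rewrite expr0 mul1r mulrC.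
rewrite -(pairZ T t^-1 ta).
by congr (T _); apply/funext => y; rewrite /kern expr1 expr0 mul1r.
Qed.

Lemma pvalue_cvg x c g : 0 <= c -> tjet c g ->
  mollify F (kern t g 0%N) x @[t --> 0^'+] --> pvalue x * integ (g 0%N) (- c) c.
Proof.
move=> c0 tg; have := cvg_dnbhs_at_right (@pvalueP x _ (tjet_test tg)).
rewrite (integ_test _ c0 tg.2); last by apply: jet_cont; exact: tg.1.
apply: cvg_trans; apply: near_eq_cvg; near=> t.
have t0 : 0 < t by near: t; exact: nbhs_right_gt.
by rewrite (mollify_kernE _ _ t0 tg) /rescaled gtr0_norm.
Unshelve. all: by end_near. Qed.

Lemma Utr_cvg x : Utr t x @[t --> 0^'+] --> pvalue x.
Proof. by have := pvalue_cvg (x := x) (ltW r0) tk; rewrite k1 mulr1. Qed.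

(** [Utr t (x + s * t)] is the transform at [x] itself for the kernel translated by [s], which still
    has integral one. Limits along slanted lines are what excludes jumps of [pvalue]. *)
Lemma Utr_cvg_shift x s : Utr t (x + s * t) @[t --> 0^'+] --> pvalue x.
Proof.
have ts := tjet_transl s tk.
have s0 := normr_ge0 s.
have ck : continuous (k 0%N) by apply: jet_cont; exact: tk.1.
have := pvalue_cvg (x := x) (addr_ge0 (ltW r0) s0) ts.
rewrite integ_transl// (integ_vanish ck tk.2 (ltW r0)); last 2 first.
- by have := ler_norm (- s); rewrite normrN; lra.
- by have := ler_norm s; lra.
rewrite k1 mulr1; apply: cvg_trans; apply: near_eq_cvg; near=> t.
have t0 : 0 < t by near: t; exact: nbhs_right_gt.
rewrite /Utr /mollify; congr (F _); apply/funext => y; rewrite /kern.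
by congr (_ * k _ _); field; rewrite gt_eqF.
Unshelve. all: by end_near. Qed.

Lemma pair_conv_lim c g a b : tjet c g -> a <= b ->
  (forall y, y <= a -> g 0%N y = 0) -> (forall y, b <= y -> g 0%N y = 0) ->
  f (conv a b (g 0%N) (kern t k) 0%N) @[t --> 0^'+] --> f (g 0%N).
Proof.
move=> tg ab ga gb; apply: cvg0P => eps e0.
pose d := `|c| + `|a| + `|b| + 1.
have [[a0 b0] c0] := (normr_ge0 a, normr_ge0 b, normr_ge0 c).
have d0 : 0 < d by rewrite /d; lra.
have tg' : tjet d g by apply: tjetW tg; rewrite /d; have := ler_norm c; lra.
have [del del0 Hd] := pair_conv_cvg f r0 tk k0 k1 d0 tg' e0.
exists del => // t t0 td; have := Hd t t0 td.
have cg : continuous (g 0%N) by apply: jet_cont; exact: tg.1.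
have jk := (tjet_kern t0 tk).1.
congr (`|f _ - _| <= _); apply/funext => y; rewrite /conv.
have ck := cont_conv (n := 0) (y := y) cg jk.
have aN := ler_norm (- a); rewrite normrN in aN.
apply: integ_shrink => //.
- by rewrite /d; have := r0; lra.
- by rewrite /d; have := r0; have := ler_norm b; lra.
- by move=> x /ga ->; rewrite mul0r.
- by move=> x /gb ->; rewrite mul0r.
Qed.

Definition bounded_below M del a b :=
  forall x t, a <= x <= b -> 0 < t -> t < del -> - M <= utr t x.

Definition strip M x := exists2 del : R, 0 < del & bounded_below M del (x - del) (x + del).

Lemma strip_compact M (K : set R) : compact K -> (forall x, K x -> strip M x) ->
  exists2 del : R, 0 < del & forall x t, K x -> 0 < t -> t < del -> - M <= utr t x.
Proof.
move=> /compact_near_coveringP cK HK.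
have := @cK R 0^'+ (fun t x => - M <= utr t x) _ _.
case => [x /HK [del d0 Hd]|/= d d0 Hd].
  exists (`]x - del, x + del[%classic, [set t | 0 < t < del]).
    split => /=; first by apply: near_in_itvoo; rewrite in_itv /=; lra.
    near=> t; apply/andP; split; near: t; [exact: nbhs_right_gt|exact: nbhs_right_lt].
  by move=> [y t] /= [+ /andP[]]; rewrite in_itv /= => yx t0 td; apply: Hd => //; lra.
exists d => // x t Kx t0 td; apply: Hd => //=.
by rewrite sub0r normrN gtr0_norm.
Unshelve. all: by end_near. Qed.

Lemma vanish_out h x : ~ supp h x -> h x = 0.
Proof. by move=> hx; apply/eqP/negPn/negP => h0; apply: hx; exact: subset_closure. Qed.

(** The pairing is the limit of the integrals of [g] times [utr t], nonnegative once [t] is below a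
    height common to the whole compact support. *)
Lemma pair_ge0 c g : tjet c g -> (forall x, 0 <= g 0%N x) ->
  (forall x, supp (g 0%N) x -> strip 0 x) -> 0 <= f (g 0%N).
Proof.
move=> tg g0 gs; have [del d0 Hd] := strip_compact (tjet_test tg).2 gs.
pose c' := `|c| + 1; have c'0 : 0 < c' by rewrite /c'; have := normr_ge0 c; lra.
have tg' : tjet c' g by apply: tjetW tg; rewrite /c'; have := ler_norm c; lra.
have cg : continuous (g 0%N) by apply: jet_cont; exact: tg.1.
have L : f (conv (- c') c' (g 0%N) (kern t k) 0%N) @[t --> 0^'+] --> f (g 0%N).
  apply: pair_conv_lim tg' _ _ _; first lra.
  - by move=> y yc; apply: tg.2; rewrite ler0_norm; have := ler_norm c; have := normr_ge0 c; rewrite /c' in yc; lra.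
  - by move=> y yc; apply: tg.2; rewrite ger0_norm; have := ler_norm c; have := normr_ge0 c; rewrite /c' in yc; lra.
apply: cvg0_le (@cvg_cst _ _ _ _ _) L _; exists del => // t t0 td.
have tkt := tjet_kern t0 tk.
have D x := pair_conv_derive f (- c') x cg tkt.
apply: le_trans (deriv_incr (a := - c') (b := c') D _ _); last 2 first.
- lra.
- move=> x _; have [/Hd H|/vanish_out->] := pselect (supp (g 0%N) x); last by rewrite mul0r.
  by rewrite mulr_ge0//; have := H t t0 td; rewrite oppr0.
have -> : conv (- c') (- c') (g 0%N) (kern t k) 0%N = fun=> 0.
  by apply/funext => y; rewrite /conv /integ subrr.
by rewrite pair0.
Qed.

Lemma utrE t x : 0 < t -> utr t x = t^-1 * f (fun y => k 0%N ((y - x) / t)).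
Proof. by move=> t0; exact: mollify_kernE tk. Qed.

(** Replacing [g] by its value at [p] costs [eps] times the integral of [|utr t|], and
    [|utr t| <= utr t + 2 * M] by the lower bound; the right side integrates to an increment of
    [Utr t] plus [2 * M * (q - p)]. *)
Lemma cell_estimate g c t p q M eps : tjet c g -> 0 < t -> p <= q -> 0 <= eps -> 0 <= M ->
  (forall x, p <= x <= q -> `|g 0%N x - g 0%N p| <= eps) ->
  (forall x, p <= x <= q -> - M <= utr t x) ->
  `|f (conv p q (g 0%N) (kern t k) 0%N) - g 0%N p * (Utr t q - Utr t p)| <=
  eps * (Utr t q - Utr t p + 2 * M * (q - p)).
Proof.
move=> tg t0 pq e0 M0 osc lb.
have cg : continuous (g 0%N) by apply: jet_cont; exact: tg.1.
have tkt := tjet_kern t0 tk.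
have D x := pair_conv_derive f p x cg tkt.
have E : f (conv p p (g 0%N) (kern t k) 0%N) = 0.
  have -> : conv p p (g 0%N) (kern t k) 0%N = fun=> 0; last by rewrite pair0.
  by apply/funext => y; rewrite /conv /integ subrr.
have idM x : is_derive x 1 (fun x => 2 * M * x) (2 * M * 1).
  by apply: derivZ; exact: is_derive_id.
(* [z = 1] and [z = -1] give the upper and the lower comparison function. *)
have V z x : is_derive x 1 (fun x => g 0%N p * Utr t x + z * (eps * (Utr t x + 2 * M * x)))
   (g 0%N p * utr t x + z * (eps * (utr t x + 2 * M * 1))).
  apply: derivD; first by apply: derivZ; exact: Utr_derive.
  by do 2 apply: derivZ; apply: derivD => //; exact: Utr_derive.
have est x : p < x < q ->
    `|(g 0%N x - g 0%N p) * utr t x| <= eps * (utr t x + 2 * M * 1).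
  move=> xpq; have xpq' : p <= x <= q by lra.
  rewrite normrM; apply: ler_pM => //; first exact: osc.
  by rewrite ler_norml; have := lb x xpq'; lra.
have up := deriv_le D (V 1) pq; have lo := deriv_le (V (-1)) D pq.
rewrite ler_norml; apply/andP; split.
  have : forall x, p < x < q ->
    g 0%N p * utr t x + -1 * (eps * (utr t x + 2 * M * 1)) <= g 0%N x * utr t x.
    by move=> x /est; rewrite ler_norml => /andP[]; lra.
  by move=> /lo; rewrite E; lra.
have : forall x, p < x < q ->
  g 0%N x * utr t x <= g 0%N p * utr t x + 1 * (eps * (utr t x + 2 * M * 1)).
  by move=> x /est; rewrite ler_norml => /andP[]; lra.
by move=> /up; rewrite E; lra.
Qed.

Lemma pair_conv_cat g a b c c' h : continuous h -> tjet c' g ->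
  f (conv a c h g 0%N) = f (conv a b h g 0%N) + f (conv b c h g 0%N).
Proof.
move=> ch tg; pose d := c' + 2 * `|a| + 2 * `|b| + `|c|.
have [[a0 b0] c0] := (normr_ge0 a, normr_ge0 b, normr_ge0 c).
have t1 : tjet d (conv a b h g) by apply: tjetW (tjet_conv a b ch tg); rewrite /d; lra.
have t2 : tjet d (conv b c h g) by apply: tjetW (tjet_conv b c ch tg); rewrite /d; lra.
rewrite -(pairD f t1 t2); congr (f _); apply/funext => y.
by rewrite /conv integ_cat.
Qed.

(* On the cells that are not [act] the test function vanishes and nothing is assumed
   of the distribution. *)
Lemma riemann_estimate g c (p : nat -> R) n (act : pred nat) M del eps :
  tjet c g -> 0 <= M -> 0 < del -> 0 <= eps ->
  (forall i, (i < n)%N -> p i <= p i.+1) ->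
  (forall y, y <= p 0%N -> g 0%N y = 0) -> (forall y, p n <= y -> g 0%N y = 0) ->
  (forall i, (i < n)%N -> ~~ act i -> forall x, p i <= x <= p i.+1 -> g 0%N x = 0) ->
  (forall i, (i < n)%N -> act i -> bounded_below M del (p i) (p i.+1)) ->
  (forall i, (i < n)%N -> forall x, p i <= x <= p i.+1 -> `|g 0%N x - g 0%N (p i)| <= eps) ->
  `|f (g 0%N) - \sum_(0 <= i < n) g 0%N (p i) * (pvalue (p i.+1) - pvalue (p i))| <=
  eps * \sum_(0 <= i < n | act i)
     (pvalue (p i.+1) - pvalue (p i) + 2 * M * (p i.+1 - p i)).
Proof.
move=> tg M0 d0 e0 pm p0 pn off on osc.
have cg : continuous (g 0%N) by apply: jet_cont; exact: tg.1.
have p0n : p 0%N <= p n.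
  elim: n pm {pn off on osc} => // m IH pm.
  by apply: le_trans (pm m (ltnSn m)); apply: IH => i im; apply: pm; exact: ltnW.
(* The inequality is proved at height [t] on the fixed partition; in the limit only the point values
   at the nodes survive. *)
have LH : `|f (conv (p 0%N) (p n) (g 0%N) (kern t k) 0%N) -
     \sum_(0 <= i < n) g 0%N (p i) * (Utr t (p i.+1) - Utr t (p i))| @[t --> 0^'+] -->
   `|f (g 0%N) - \sum_(0 <= i < n) g 0%N (p i) * (pvalue (p i.+1) - pvalue (p i))|.
  apply: cvg_norm; apply: cvgB; first exact: pair_conv_lim tg p0n p0 pn.
  apply: cvg_big; first exact: add_continuous.
  by move=> i _; apply: cvgM; [exact: cvg_cst|apply: cvgB; exact: Utr_cvg].
have RH : eps * \sum_(0 <= i < n | act i) (Utr t (p i.+1) - Utr t (p i) + 2 * M * (p i.+1 - p i))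
    @[t --> 0^'+] -->
  eps * \sum_(0 <= i < n | act i) (pvalue (p i.+1) - pvalue (p i) + 2 * M * (p i.+1 - p i)).
  apply: cvgM; first exact: cvg_cst.
  apply: cvg_big; first exact: add_continuous.
  by move=> i _; apply: cvgD; [apply: cvgB; exact: Utr_cvg|exact: cvg_cst].
apply: cvg0_le LH RH _; exists del => // t t0 td.
have tkt := tjet_kern t0 tk.
have -> : f (conv (p 0%N) (p n) (g 0%N) (kern t k) 0%N) =
  \sum_(0 <= i < n) f (conv (p i) (p i.+1) (g 0%N) (kern t k) 0%N).
  elim: {p0 pn pm p0n off on osc} n => [|m IH].
    rewrite big_geq//; have -> : conv (p 0%N) (p 0%N) (g 0%N) (kern t k) 0%N = fun=> 0.
      by apply/funext => y; rewrite /conv /integ subrr.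
    by rewrite pair0.
  by rewrite (@pair_conv_cat _ _ (p m) _ _ _ cg tkt) IH big_nat_recr.
rewrite -sumrB; apply: le_trans (ler_norm_sum _ _ _) _.
rewrite mulr_sumr [leRHS]big_mkcond /= big_nat [leRHS]big_nat; apply: ler_sum => i /andP[_ lin].
case: ifPn => acti.
  apply: (cell_estimate tg t0) => //; [exact: pm|exact: osc|].
  by move=> x xp; exact: (on i lin acti x t xp t0 td).
have z x : p i <= x <= p i.+1 -> g 0%N x = 0 by apply: off.
have pi := pm i lin.
rewrite z ?lexx ?pi// mul0r subr0.
have -> : conv (p i) (p i.+1) (g 0%N) (kern t k) 0%N = fun=> 0.
  apply/funext => y; rewrite /conv (@integ_eq _ _ (fun=> 0))// ?integ_cst ?mul0r//.
  - exact: cont_conv tkt.1.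
  - exact: cst_continuous.
  - by move=> x /andP[xp px]; rewrite z ?mul0r// !ltW.
by rewrite pair0 normr0.
Qed.

(** [Utr t z + M * z] is nondecreasing in [z] for each [t < del], and this survives the pointwise
    limit. *)
Lemma pvalue_incr M del a b : 0 < del -> bounded_below M del a b ->
  forall x y, a <= x -> x <= y -> y <= b -> pvalue x + M * x <= pvalue y + M * y.
Proof.
move=> d0 lb x y ax xy yb.
have L z : Utr t z + M * z @[t --> 0^'+] --> pvalue z + M * z.
  by apply: cvgD; [exact: Utr_cvg|exact: cvg_cst].
apply: cvg0_le (L x) (L y) _; exists del => // t t0 td.
have idM (z : R) : is_derive z 1 (fun x => M * x) (M * 1).
  by apply: derivZ; exact: is_derive_id.
apply: (deriv_incr (fun z => derivD (Utr_derive z t0) (idM z)) xy) => z zxy.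
by have := lb z t _ t0 td; rewrite mulr1 => H; have := H ltac:(lra); lra.
Qed.

End Setting.

(** * Continuity of the point values *)

Section Continuity.
Context {R : realType} (f F : schwartz_distribution R)
  (hfF : is_distr_derivative f F) (hF : lojasiewicz F)
  (k : nat -> R -> R) (r : R) (r0 : 0 < r) (tk : tjet r k)
  (k0 : forall x, 0 <= k 0%N x) (k1 : integ (k 0%N) (- r) r = 1).
Implicit Types (g : nat -> R -> R) (h : R -> R) (a b c x y s t M eps del : R).

(* A mollified indicator function of [[a, b]], which [f] sends to the increment of
   [Utr t] between [a] and [b]. *)
Definition plateau t a b := conv a b (fun=> 1) (kern t k).

Let ckern t : 0 < t -> continuous (kern t k 0%N).
Proof. by move=> t0; apply: jet_cont; exact: (tjet_kern t0 tk).1. Qed.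

Lemma plateauE t a b y : plateau t a b 0%N y = integ (fun x => kern t k 0%N (y - x)) a b.
Proof. by rewrite /plateau /conv; congr integ; apply/funext => x; rewrite mul1r. Qed.

Lemma tjet_plateau t a b : 0 < t ->
  tjet (r * t + 2 * `|a| + `|b|) (plateau t a b).
Proof. by move=> t0; apply: tjet_conv (tjet_kern t0 tk); exact: cst_continuous. Qed.

Lemma plateau_ge0 t a b y : 0 < t -> a <= b -> 0 <= plateau t a b 0%N y.
Proof.
move=> t0 ab; rewrite plateauE.
have ck : continuous (fun x => kern t k 0%N (y - x)) by apply: cont_refl; exact: ckern.
have c0 : continuous (fun _ : R => 0 : R) by exact: cst_continuous.
have := integ_le c0 ck ab (fun x _ => kern_ge0 (y - x) t0 k0).
by rewrite integ_cst mul0r.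
Qed.

Lemma plateau_eq1 t a b y : 0 < t -> a <= y - r * t -> y + r * t <= b ->
  plateau t a b 0%N y = 1.
Proof. by move=> t0 ay yb; rewrite plateauE (integ_kern r0 t0 tk k1). Qed.

(** Enlarging the interval until it holds the whole kernel adds nonnegative pieces and brings the
    value to exactly 1. *)
Lemma plateau_le1 t a b y : 0 < t -> a <= b -> plateau t a b 0%N y <= 1.
Proof.
move=> t0 ab; pose a' := Num.min a (y - r * t); pose b' := Num.max b (y + r * t).
have a1 : a' <= a by rewrite ge_min lexx.
have a2 : a' <= y - r * t by rewrite ge_min lexx orbT.
have b1 : b <= b' by rewrite le_max lexx.
have b2 : y + r * t <= b' by rewrite le_max lexx orbT.
rewrite -(plateau_eq1 t0 a2 b2).
have E : plateau t a' b' 0%N y = plateau t a' a 0%N y + plateau t a b 0%N y + plateau t b b' 0%N y.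
  by rewrite !plateauE !integ_cat.
by have := plateau_ge0 y t0 a1; have := plateau_ge0 y t0 b1; rewrite E; lra.
Qed.

Lemma plateau_eq0 t a b y : 0 < t -> a <= b -> y + r * t <= a \/ b + r * t <= y ->
  plateau t a b 0%N y = 0.
Proof.
move=> t0 ab H; rewrite plateauE.
rewrite (@integ_eq _ _ (fun=> 0)) ?integ_cst ?mul0r//.
- by apply: cont_refl; exact: ckern.
- exact: cst_continuous.
move=> x xab; apply: (tjet_kern t0 tk).2.
case: H => H; [rewrite ltr0_norm|rewrite gtr0_norm]; have := mulr_gt0 r0 t0; lra.
Qed.

Lemma pair_plateau t a b : 0 < t -> f (plateau t a b 0%N) = Utr F k t b - Utr F k t a.
Proof.
move=> t0; have c1 : continuous (fun _ : R => 1 : R) by exact: cst_continuous.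
have D x := pair_conv_derive f a x c1 (tjet_kern t0 tk).
have D' x : is_derive x 1 (fun x => f (plateau t a x 0%N)) (utr f k t x).
  by apply: is_derive_eq (D x) _; rewrite mul1r.
rewrite -(deriv_uniq a b D' (fun x => Utr_derive hfF tk x t0)).
rewrite (_ : plateau t a a 0%N = fun=> 0) ?pair0 ?subr0//.
by apply/funext => y; rewrite plateauE /integ subrr.
Qed.

(** The plateau over half-width [(r + 1) * t] equals 1 on [[x - t, x + t]] and vanishes beyond
    [(2 * r + 1) * t]. Integrated against [utr s], its middle gives an increment of [Utr s] and each
    flank, of length [2 * r * t], loses at most [M] per unit length. Then [s] tends to 0 with [t]
    fixed, so that jumps of [pvalue] are controlled by [Utr] at the single scale [t]. *)
Lemma pvalue_plateau M del a b t x : 0 <= M -> 0 < del -> bounded_below f k M del a b ->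
  0 < t -> a <= x - (2 * r + 1) * t -> x + (2 * r + 1) * t <= b ->
  pvalue F (x + t) - pvalue F (x - t) <=
  Utr F k t (x + (r + 1) * t) - Utr F k t (x - (r + 1) * t) + 2 * M * (2 * r * t).
Proof.
move=> M0 d0 lb t0 ax xb.
rewrite -(pair_plateau _ _ t0); set P := plateau _ _ _.
have rt := mulr_gt0 r0 t0.
have tE : (2 * r + 1) * t = 2 * (r * t) + t by ring.
have xb' : x + (2 * (r * t) + t) <= b by rewrite -tE.
have ax' : a <= x - (2 * (r * t) + t) by rewrite -tE.
have tP : tjet _ P := tjet_plateau _ _ t0.
have cP : continuous (P 0%N) by apply: jet_cont; exact: tP.1.
have pq : x - (r + 1) * t <= x + (r + 1) * t by rewrite mulrDl mul1r; lra.
pose p0 := x - (2 * r + 1) * t; pose p1 := x + (2 * r + 1) * t.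
have p0E : p0 = x - (2 * (r * t) + t) by rewrite /p0; ring.
have p1E : p1 = x + (2 * (r * t) + t) by rewrite /p1; ring.
have p01 : p0 <= p1 by rewrite p0E p1E; lra.
have P0 y : y <= p0 -> P 0%N y = 0.
  by rewrite p0E => yp; apply: plateau_eq0 => //; left; rewrite mulrDl; lra.
have P1 y : p1 <= y -> P 0%N y = 0.
  by rewrite p1E => yp; apply: plateau_eq0 => //; right; rewrite mulrDl; lra.
have L := pair_conv_lim (f := f) r0 tk k0 k1 tP p01 P0 P1.
have L1 : f (conv p0 p1 (P 0%N) (kern s k) 0%N) + 2 * M * (2 * r * t) @[s --> 0^'+] -->
   f (P 0%N) + 2 * M * (2 * r * t) by apply: cvgD L _; exact: cvg_cst.
have L2 : Utr F k s (x + t) - Utr F k s (x - t) @[s --> 0^'+] -->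
    pvalue F (x + t) - pvalue F (x - t).
  by apply: cvgB; exact: (Utr_cvg hF r0 tk k1).
apply: (cvg0_le L2 L1); exists del => // s s0 sd.
have tks := tjet_kern s0 tk.
have D y := pair_conv_derive f p0 y cP tks.
have -> : 2 * M * (2 * r * t) = M * ((x - t) - p0) + M * (p1 - (x + t)).
  by rewrite p0E p1E; ring.
have idM (y : R) : is_derive y 1 (fun x => - M * x) (- M).
  by apply: is_derive_eq (derivZ (- M) (is_derive_id y (1:R))) _; rewrite mulr1.
have side y : p0 < y < p1 -> - M <= P 0%N y * utr f k s y.
  move=> /andP[py yp].
  have U : - M <= utr f k s y by apply: lb => //; rewrite p0E p1E in py yp; lra.
  have Pge0 : 0 <= P 0%N y by apply: plateau_ge0.
  have Ple1 : P 0%N y <= 1 by apply: plateau_le1.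
  have [u0|/ltW u0] := leP 0 (utr f k s y); first by have := mulr_ge0 Pge0 u0; lra.
  by have := ler_wnM2r u0 Ple1; lra.
have le1 : p0 <= x - t by rewrite p0E; lra.
have le2 : x - t <= x + t by lra.
have le3 : x + t <= p1 by rewrite p1E; lra.
have s1 := deriv_le idM D le1; have s3 := deriv_le idM D le3.
have s2 := deriv_le (fun y => Utr_derive hfF tk y s0) D le2.
have {}s1 := s1 (fun y H => side y ltac:(lra)).
have {}s3 := s3 (fun y H => side y ltac:(lra)).
have {}s2 : Utr F k s (x + t) - Utr F k s (x - t) <=
    f (conv p0 (x + t) (P 0%N) (kern s k) 0%N) - f (conv p0 (x - t) (P 0%N) (kern s k) 0%N).
  apply: s2 => y yx; rewrite /P plateau_eq1 ?mul1r// mulrDl; lra.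
have E : f (conv p0 p0 (P 0%N) (kern s k) 0%N) = 0.
  rewrite (_ : conv p0 p0 _ _ _ = fun=> 0) ?pair0//.
  by apply/funext => y; rewrite /conv /integ subrr.
rewrite /= E in s1; rewrite /= in s3; clear -s1 s2 s3; clearbody p0 p1; lra.
Qed.

(** The bound of [pvalue_plateau] tends to 0 with [t], since both slanted values of [Utr] tend to
    [pvalue F x]; monotonicity of [pvalue F z + M * z] carries it to all [y] near [x]. *)
Lemma pvalue_cont M del a b x : 0 <= M -> 0 < del -> bounded_below f k M del a b ->
  a < x < b -> {for x, continuous (pvalue F)}.
Proof.
move=> M0 d0 lb xab.
have L : Utr F k t (x + (r + 1) * t) - Utr F k t (x - (r + 1) * t) @[t --> 0^'+] --> (0 : R).
  have L1 := @Utr_cvg_shift _ _ hF _ _ r0 tk k1 x (r + 1).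
  have L2 := @Utr_cvg_shift _ _ hF _ _ r0 tk k1 x (- (r + 1)).
  have E : (fun t => Utr F k t (x + (r + 1) * t) - Utr F k t (x - (r + 1) * t)) =
     (fun t => Utr F k t (x + (r + 1) * t) - Utr F k t (x + - (r + 1) * t)).
    by apply/funext => t; rewrite mulNr.
  by have L3 := cvgB L1 L2; rewrite subrr in L3; rewrite E; exact: L3.
apply/cvgrPdist_le => eps e0.
have e2 : 0 < eps / 2 by rewrite divr_gt0.
have [d1 d10 H1] := cvg0_ltP L e2.
(* [4 * M * r * t] is the loss on the flanks, [3 * M * t] the cost of passing from [x - t], [x + t]
   to [x], [y]; the 1 makes [w] positive. *)
pose w := 4 * M * r + 3 * M + 1.
have w0 : 0 < w by rewrite /w; have := mulr_ge0 M0 (ltW r0); lra.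
pose z := Num.min (x - a) (b - x).
have z0 : 0 < z by rewrite lt_min; apply/andP; lra.
have rr : 0 < 2 * r + 1 by have := r0; lra.
pose t := Num.min (d1 / 2) (Num.min (eps / 2 / w) (z / (2 * r + 1))).
have t0 : 0 < t by rewrite !lt_min !divr_gt0.
have td1 : t < d1 by apply: (@le_lt_trans _ _ (d1 / 2)); [rewrite ge_min lexx|lra].
have tw : w * t <= eps / 2 by rewrite mulrC -ler_pdivlMr// !ge_min lexx orbT.
have tz : (2 * r + 1) * t <= z by rewrite mulrC -ler_pdivlMr// !ge_min lexx !orbT.
have za : z <= x - a by rewrite ge_min lexx.
have zb : z <= b - x by rewrite ge_min lexx orbT.
have J : pvalue F (x + t) - pvalue F (x - t) <= eps / 2 + 4 * M * r * t.
  have j1 : a <= x - (2 * r + 1) * t by lra.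
  have j2 : x + (2 * r + 1) * t <= b by lra.
  apply: le_trans (pvalue_plateau M0 d0 lb t0 j1 j2) _.
  have := H1 t t0 td1; rewrite subr0 => /ltr_normlW H.
  rewrite /= in H; have -> : 2 * M * (2 * r * t) = 4 * M * r * t by ring.
  lra.
have tt : t <= (2 * r + 1) * t.
  by rewrite mulrDl mul1r; have := mulr_gt0 r0 t0; rewrite -mulrA; lra.
rewrite /w in tw; clear H1 L e2 td1 xab; clearbody z t; clear w w0.
near=> y.
have yx : `|x - y| < t by near: y; apply/nbhs_ballP; exists t => //= z.
move: yx; rewrite ltr_norml => /andP[yx1 yx2].
have G := pvalue_incr hfF hF r0 tk k1 d0 lb.
have g1 := G (x - t) y ltac:(lra) ltac:(lra) ltac:(lra).
have g2 := G y (x + t) ltac:(lra) ltac:(lra) ltac:(lra).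
have g3 := G (x - t) x ltac:(lra) ltac:(lra) ltac:(lra).
have g4 := G x (x + t) ltac:(lra) ltac:(lra) ltac:(lra).
have Mxy : M * (x - y) <= M * t by rewrite ler_wpM2l//; lra.
have Myx : M * (y - x) <= M * t by rewrite ler_wpM2l//; lra.
clear -tw g1 g2 g3 g4 Mxy Myx J t0 M0 e0.
rewrite ler_norml; lra.
Unshelve. all: by end_near. Qed.

End Continuity.

(** * Removing the lower bound by the almost everywhere hypothesis *)

Section Monotonicity.
Context {R : realType} (f F : schwartz_distribution R)
  (hfF : is_distr_derivative f F) (hF : lojasiewicz F)
  (k : nat -> R -> R) (r : R) (r0 : 0 < r) (tk : tjet r k)
  (k0 : forall x, 0 <= k 0%N x) (k1 : integ (k 0%N) (- r) r = 1).
Implicit Types (g : nat -> R -> R) (h : R -> R) (a b c x y s t M eps del : R).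
Local Notation mu := (@lebesgue_measure R).

Lemma integ_kern_transl t a b x : 0 < t -> a <= x - r * t -> x + r * t <= b ->
  integ (fun y => kern t k 0%N (y - x)) a b = 1.
Proof.
move=> t0 ax xb; have ck : continuous (k 0%N) by apply: jet_cont; exact: tk.1.
have ckt : continuous (kern t k 0%N) by apply: jet_cont; exact: (tjet_kern t0 tk).1.
have c1 : continuous (fun y => kern t k 0%N (y - x)) by exact: cont_transl.
have d y : is_derive y 1 (fun y => prim (k 0%N) (t^-1 * (y - x))) (kern t k 0%N (y - x)).
  by rewrite /kern expr1; exact: deriv_aff (primP ck _).
rewrite (integE _ _ c1 d) -[LHS]/(integ (k 0%N) _ _).
by rewrite (integ_vanish ck tk.2 (ltW r0))// mulrC ?ler_pdivrMr ?ler_pdivlMr//; lra.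
Qed.

Lemma kern_transl_jet t x : 0 < t ->
  tjet (r * t + `|x|) (fun n y => kern t k n (y - x)).
Proof. by move=> t0; apply: tjet_transl; exact: tjet_kern. Qed.

(** [vanish] speaks of [|z| > r * t] only; at [|z| = r * t] the kernel is zero by continuity, tested
    at points [w] pushed slightly outwards. *)
Lemma kern_transl_vanish t x y : 0 < t -> y <= x - r * t \/ x + r * t <= y ->
  kern t k 0%N (y - x) = 0.
Proof.
move=> t0 H.
have ckt : continuous (kern t k 0%N) by apply: jet_cont; exact: (tjet_kern t0 tk).1.
have v := (tjet_kern t0 tk).2.
have rt := mulr_gt0 r0 t0.
suff E z : r * t <= `|z| -> kern t k 0%N z = 0.
  apply: E; case: H => H; [rewrite ler0_norm|rewrite ger0_norm]; lra.
rewrite le_eqVlt => /orP[/eqP E|]; last exact: v.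
apply/eqP; rewrite -normr_le0; apply/ler_addgt0Pr => e e0; rewrite add0r.
have /cvgrPdist_lt/(_ e e0)/nbhs_ballP[d /= d0 Hd] := ckt z.
pose w := z + Num.sg z * (d / 2).
have z0 : z != 0 by rewrite -normr_gt0 -E.
have Ew : z - w = - (Num.sg z * (d / 2)) by rewrite /w; ring.
have bw : ball z d w.
  rewrite /ball /= Ew normrN normrM normr_sg z0 mul1r gtr0_norm; lra.
have := Hd w bw; rewrite (v w) ?subr0; first exact: ltW.
rewrite /w E; move: z0; rewrite neq_lt => /orP[z0|z0].
  by rewrite ltr0_sg// !ltr0_norm; lra.
by rewrite gtr0_sg// !gtr0_norm; lra.
Qed.

(** The radial upper limit spelled out with quantifiers; [Z] absorbs the exceptional null set, so
    that the condition can be stated at every point. *)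
Definition upper_ge0 (Z : set R) x := Z x \/
  forall eta del : R, 0 < eta -> 0 < del ->
    exists t, [/\ 0 < t, t < del & - eta < utr f k t x].

(** [utr t x] is near the Riemann sum of the kernel against increments of [pvalue F], each at most
    [M'] times the cell. Since [M' <= 0], the Riemann sum of the kernel itself is wanted from below:
    it is its integral 1 up to [eps] times the length. *)
Lemma utr_le_partition M M' del t x eps (p : nat -> R) n :
  0 <= M -> 0 < del -> M' <= 0 -> 0 < t -> 0 <= eps ->
  (forall i, (i < n)%N -> p i <= p i.+1) ->
  p 0%N <= x - r * t -> x + r * t <= p n ->
  (forall i, (i < n)%N -> bounded_below f k M del (p i) (p i.+1)) ->
  (forall i, (i < n)%N -> forall y, p i <= y <= p i.+1 ->
     `|kern t k 0%N (y - x) - kern t k 0%N (p i - x)| <= eps) ->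
  (forall i, (i < n)%N -> pvalue F (p i.+1) - pvalue F (p i) <= M' * (p i.+1 - p i)) ->
  utr f k t x <= M' * (1 - eps * (p n - p 0%N)) + 2 * M * (eps * (p n - p 0%N)).
Proof.
move=> M0 d0 M'0 t0 e0 pm px xp lb osc dG.
have tg := kern_transl_jet x t0.
have := riemann_estimate hfF hF r0 tk k0 k1 (p := p) (n := n) (act := predT) tg M0 d0 e0 pm.
have uE : utr f k t x = f (fun y => kern t k 0%N (y - x)) by [].
rewrite /= -uE => H.
have {}H := H (fun y yp => kern_transl_vanish (x := x) t0 (or_introl (le_trans yp px))).
have {}H := H (fun y yp => kern_transl_vanish (x := x) t0 (or_intror (le_trans xp yp))).
have {}H := H (fun i _ (h : ~~ true) => False_ind _ (elimN idP h isT)) (fun i lin _ => lb i lin) osc.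
have K0 i : 0 <= kern t k 0%N (p i - x) by exact: kern_ge0.
have s1 : \sum_(0 <= i < n) kern t k 0%N (p i - x) * (pvalue F (p i.+1) - pvalue F (p i)) <=
   M' * \sum_(0 <= i < n) kern t k 0%N (p i - x) * (p i.+1 - p i).
  rewrite mulr_sumr [leLHS]big_nat [leRHS]big_nat; apply: ler_sum => i /andP[_ lin].
  by rewrite mulrCA; apply: ler_wpM2l => //; exact: dG.
have s2 : 1 - eps * (p n - p 0%N) <=
    \sum_(0 <= i < n) kern t k 0%N (p i - x) * (p i.+1 - p i).
  have c1 : continuous (fun y => kern t k 0%N (y - x)) by exact: (jet_cont (n := 0%N) tg.1).
  rewrite -(integ_kern_transl t0 px xp) -telescope_sumr// mulr_sumr lerBlDr -big_split /=.
  have -> : integ (fun y => kern t k 0%N (y - x)) (p 0%N) (p n) =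
      \sum_(0 <= i < n) integ (fun y => kern t k 0%N (y - x)) (p i) (p i.+1).
    by rewrite telescope_sumr.
  rewrite [leLHS]big_nat [leRHS]big_nat; apply: ler_sum => i /andP[_ lin].
  rewrite -mulrDl -integ_cst; apply: integ_le => //; first exact: cst_continuous.
    exact: pm.
  move=> y /andP[/ltW py /ltW yp]; have := osc i lin y; rewrite py yp => /(_ isT).
  by rewrite ler_norml; lra.
(* The increments of [pvalue F] are nonpositive, so only the [2 * M] part of the error remains. *)
have s3 : \sum_(0 <= i < n | predT i)
     (pvalue F (p i.+1) - pvalue F (p i) + 2 * M * (p i.+1 - p i)) <= 2 * M * (p n - p 0%N).
  rewrite -telescope_sumr// mulr_sumr big_nat_cond [leRHS]big_nat.
  rewrite [leLHS](eq_bigl (fun i => (0 <= i < n)%N)); last by move=> i; rewrite andbT.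
  apply: ler_sum => i /andP[_ lin].
  have := dG i lin; have : M' * (p i.+1 - p i) <= 0.
    by rewrite mulr_le0_ge0// subr_ge0 pm.
  lra.
have {}s3 := ler_wpM2l e0 s3.
have {}s2 := ler_wnM2l M'0 s2.
by move: H; rewrite ler_norml => /andP[_]; lra.
Qed.

(* The partition points are taken in [N], along which [pvalue F] falls with slope
   [m]; that is possible as soon as [N] is [eta]-dense at the scale [t]. *)
Lemma utr_le_dense M del a b t x m eta B (N : set R) :
  0 < M -> 0 < del -> bounded_below f k M del a b -> N `<=` `[a, b] -> 0 < m ->
  (forall p q, N p -> N q -> p <= q -> pvalue F q - pvalue F p <= - m * (q - p)) ->
  0 < B -> (forall y, `|k 1%N y| <= B) -> 0 < eta -> eta * (r + 2) <= 1 -> 0 < t ->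
  (forall y, `|y - x| <= (r + 2) * t ->
     exists p, N p /\ y - eta * ((r + 2) * t) < p < y) ->
  utr f k t x <= - m * (1 - eta * (2 * B * (r + 2) * (2 * r + 3))) +
    2 * M * (eta * (2 * B * (r + 2) * (2 * r + 3))).
Proof.
move=> M0 d0 lb Nab m0 Nd B0 HB eta0 etar t0 HD; have r0' := r0.
(* From [B / t ^+ 2], a bound on the slope of the kernel, the cell length [2 * sg] and the total
   length [(2 * r + 3) * t]: the powers of [t] cancel and [eta * Q] is left. *)
set Q := 2 * B * (r + 2) * (2 * r + 3).
have [sg sgE] : exists sg : R, sg = eta * ((r + 2) * t) by eexists.
have sg0 : 0 < sg by rewrite sgE !mulr_gt0//; lra.
rewrite -sgE in HD.
have sgt : sg <= t by rewrite sgE mulrA -[leRHS]mul1r ler_wpM2r// ltW.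
have rt := mulr_gt0 r0' t0.
(* Node [i] is sought at most [sg] to the left of [x - r * t + i%:R * sg]. The lower bound on [n]
   puts the last node beyond [x + r * t], the upper one keeps all targets within [(r + 2) * t] of
   [x]. *)
have [n [n1 n2]] : exists n : nat, 2 * r * t + sg <= n%:R * sg /\
    n%:R * sg <= 2 * r * t + 2 * sg.
  have q0 : 0 <= 2 * r * t / sg by rewrite divr_ge0 ?(ltW sg0)// -mulrA mulr_ge0// ltW.
  exists (Num.trunc (2 * r * t / sg)).+2; set n := Num.trunc _.
  have -> : n.+2%:R = n%:R + 2 :> R by rewrite -2!natr1; ring.
  split.
    have := truncnS_gt (2 * r * t / sg); rewrite -/n ltr_pdivrMr// -natr1 => H.
    by lra.
  have : n%:R <= 2 * r * t / sg by rewrite truncn_le.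
  by rewrite ler_pdivlMr// => H; lra.
have /choice[p Hp] (i : nat) : exists p, (i <= n)%N -> N p /\
    x - r * t + i%:R * sg - sg < p < x - r * t + i%:R * sg.
  have [lin|] := leqP i n; last by exists 0.
  have i0 : 0 <= i%:R * sg by rewrite mulr_ge0 ?ler0n// ltW.
  have ile : i%:R * sg <= n%:R * sg by rewrite ler_wpM2r ?ler_nat// ltW.
  have [|z [Nz zy]] := HD (x - r * t + i%:R * sg); last by exists z.
  by rewrite ler_norml; lra.
have pS i : (i < n)%N -> p i < p i.+1 /\ p i.+1 - p i <= 2 * sg.
  move=> lin; have [_ h1] := Hp i (ltnW lin); have [_ h2] := Hp i.+1 lin.
  by rewrite -natr1 in h2; split; lra.
have pN i : (i <= n)%N -> a <= p i <= b.
  by move=> lin; have [/Nab] := Hp i lin; rewrite /= in_itv.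
have [_ h0] := Hp 0%N (leq0n n); have [_ hn] := Hp n (leqnn n).
rewrite mul0r addr0 in h0.
have tp2 : 0 < t ^+ 2 by rewrite exprn_gt0.
have px : p 0%N <= x - r * t by lra.
have xp : x + r * t <= p n by lra.
have len : p n - p 0%N <= (2 * r + 3) * t by lra.
have len0 : 0 <= p n - p 0%N by lra.
have [eps epsE] : exists eps : R, eps = B / t ^+ 2 * (2 * sg) by eexists.
have e0 : 0 < eps by rewrite epsE mulr_gt0 ?divr_gt0// mulr_gt0.
have m0' : - m <= 0 by rewrite oppr_le0 ltW.
have pm i : (i < n)%N -> p i <= p i.+1 by move=> /pS[/ltW].
have lbp i : (i < n)%N -> bounded_below f k M del (p i) (p i.+1).
  move=> lin z s zp; apply: lb.
  by have := pN i (ltnW lin); have := pN i.+1 lin; lra.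
have osc i : (i < n)%N -> forall y, p i <= y <= p i.+1 ->
    `|kern t k 0%N (y - x) - kern t k 0%N (p i - x)| <= eps.
  move=> lin z zp; have tg := kern_transl_jet x t0.
  have b1 w : `|kern t k 1%N (w - x)| <= B / t ^+ 2.
    rewrite /kern normrM normrX normfV (gtr0_norm t0) -exprVn mulrC.
    by rewrite ler_wpM2r ?HB// exprn_ge0// invr_ge0 ltW.
  apply: le_trans (deriv_bound (tg.1 0%N) (fun w _ => b1 w)) _.
  rewrite epsE ler_wpM2l ?divr_ge0 ?(ltW B0) ?(ltW tp2)//.
  by have [_] := pS i lin; rewrite ger0_norm; lra.
have dG i : (i < n)%N -> pvalue F (p i.+1) - pvalue F (p i) <= - m * (p i.+1 - p i).
  by move=> lin; apply: Nd; [exact: (Hp i (ltnW lin)).1|exact: (Hp i.+1 lin).1|exact: pm].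
apply: le_trans (utr_le_partition (ltW M0) d0 m0' t0 (ltW e0) pm px xp lbp osc dG) _.
have el : eps * (p n - p 0%N) <= eta * Q.
  apply: le_trans (ler_wpM2l (ltW e0) len) _.
  by rewrite epsE sgE /Q le_eqVlt; apply/orP; left; apply/eqP; field; rewrite gt_eqF.
have := ler_wpM2l (ltW m0) el; have := ler_wpM2l (ltW M0) el; lra.
Qed.

Lemma pvalue_incr_ae M del a0 b0 (Z : set R) : 0 < M -> 0 < del ->
  bounded_below f k M del a0 b0 -> mu.-negligible Z ->
  (forall x, a0 < x < b0 -> upper_ge0 Z x) ->
  forall a b, a0 < a -> a <= b -> b < b0 -> pvalue F a <= pvalue F b.
Proof.
move=> M0 d0 lb nZ up a b a0a ab bb0; rewrite leNgt; apply/negP => pba.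
have {}ab : a < b.
  by move: ab; rewrite le_eqVlt => /orP[/eqP E|//]; move: pba; rewrite E ltxx.
have G := pvalue_incr hfF hF r0 tk k1 d0 lb.
(* Clamping to [[a, b]] makes [g] continuous and monotone on the whole line, as [rising_sun]
   requires. *)
pose cl x := Num.min b (Num.max a x).
have clab x : a <= cl x <= b by rewrite /cl ge_min lexx le_min le_max lexx (ltW ab).
have clE x : a <= x -> x <= b -> cl x = x.
  by move=> ax xb; rewrite /cl (max_idPr ax) (min_idPr xb).
pose g x := pvalue F (cl x) + M * cl x.
have ccl : continuous cl.
  move=> x; apply: (@continuous_min R R (fun=> b) (fun y => Num.max a y)).
    exact: cst_continuous.
  apply: (@continuous_max R R (fun=> a) id); first exact: cst_continuous.
  exact: cvg_id.
have cg : continuous g.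
  apply: (@contD _ (fun x => pvalue F (cl x)) (fun x => M * cl x)); last exact: contZ.
  move=> x; apply: (@continuous_comp _ _ _ cl (pvalue F)); first exact: ccl.
  by apply: (pvalue_cont hfF hF r0 tk k0 k1 (ltW M0) d0 lb); have := clab x; lra.
have ng : {homo g : x y / x <= y}.
  move=> x y xy; apply: G; [by have := clab x; lra| |by have := clab y; lra].
  rewrite /cl le_min; apply/andP; split; first by rewrite ge_min lexx.
  rewrite ge_min; apply/orP; right; rewrite ge_max; apply/andP.
  by split; rewrite le_max ?lexx ?xy ?orbT.
pose d := pvalue F a - pvalue F b; have dp : 0 < d by rewrite subr_gt0.
have dM : d <= M * (b - a).
  by have := G a b (ltW a0a) (ltW ab) (ltW bb0); rewrite /d mulrBr; lra.
have ba : 0 < b - a by rewrite subr_gt0.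
(* Half the mean slope of the fall: the mean slope [M - 2 * m] of [g] is then strictly below
   [M - m]. *)
pose m := d / (b - a) / 2.
have m0 : 0 < m by rewrite !divr_gt0.
have mM : m < M.
  have : d / (b - a) <= M by rewrite ler_pdivrMr.
  by rewrite /m; have := divr_gt0 dp ba; lra.
have gM : g b - g a < (M - m) * (b - a).
  rewrite /g !clE ?lexx ?(ltW ab)//.
  have -> : (M - m) * (b - a) = M * b - M * a - d / 2 by rewrite /m; field; rewrite gt_eqF.
  by rewrite /d; lra.
have Mm : 0 < M - m by rewrite subr_gt0.
have N0 := rising_sun cg ng ab Mm gM.
set N := descent _ _ _ `&` _ in N0.
have mN : measurable N by apply: measurable_realfun.closed_measurable; exact: descent_closed.
have Nab : N `<=` `[a, b] by move=> x [].
have [x [Nx nZx /andP[ax xb] D]] := density_point mN Nab N0 nZ.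
have Nd p q : N p -> N q -> p <= q -> pvalue F q - pvalue F p <= - m * (q - p).
  move=> [np +] [_] /=; rewrite !in_itv /= => /andP[ap pb] /andP[aq qb] pq.
  by have := np q pq qb; rewrite /g !clE//; lra.
have [B B0 HB] := tjet_bound 1%N tk.
have r0' := r0.
pose Q := 2 * B * (r + 2) * (2 * r + 3).
have r2 : 0 < r + 2 by lra.
have Q0 : 0 < Q by rewrite !mulr_gt0//; lra.
have QM0 : 0 < Q * (m + 2 * M) by rewrite mulr_gt0//; lra.
(* The last condition turns the bound of [utr_le_dense] into [- m / 2], which contradicts
   [upper_ge0]. *)
have [eta [eta0 eta1 etar etaQ]] : exists eta : R,
    [/\ 0 < eta, eta < 1, eta * (r + 2) <= 1 & eta * (Q * (m + 2 * M)) <= m / 2].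
  exists (Num.min (2^-1) (Num.min (r + 2)^-1 (m / 2 / (Q * (m + 2 * M))))); split.
  - by rewrite !lt_min !invr_gt0 r2 !divr_gt0 ?ltr0n.
  - by apply: (@le_lt_trans _ _ 2^-1); [rewrite ge_min lexx|lra].
  - by rewrite -ler_pdivlMr ?div1r// !ge_min lexx orbT.
  - by rewrite -ler_pdivlMr// !ge_min lexx !orbT.
have [dl dl0 HD] := D eta eta0 eta1.
have xab : a0 < x < b0 by lra.
case: (up x xab) => // up'.
have [t [t0 tdl]] := up' (m / 2) (dl / (r + 2)) (divr_gt0 m0 (ltr0Sn R 1)) (divr_gt0 dl0 r2).
rewrite ltNge => /negP; apply.
have tau0 : 0 < (r + 2) * t by rewrite mulr_gt0.
have taud : (r + 2) * t < dl by rewrite mulrC -ltr_pdivlMr.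
have lb' : bounded_below f k M del a b.
  by move=> y s yab; apply: lb; lra.
apply: le_trans (utr_le_dense M0 d0 lb' Nab m0 Nd B0 HB eta0 etar t0 (HD _ tau0 taud)) _.
by rewrite -/Q; lra.
Qed.

(** The Riemann sums of a nonnegative function against nondecreasing values are nonnegative, and
    refining the partition removes the error. *)
Lemma pair_ge0_incr M del a0 b0 a b c g : 0 <= M -> 0 < del ->
  bounded_below f k M del a0 b0 ->
  (forall a b, a0 < a -> a <= b -> b < b0 -> pvalue F a <= pvalue F b) ->
  a0 < a -> a < b -> b < b0 -> tjet c g -> (forall x, 0 <= g 0%N x) ->
  (forall x, x <= a -> g 0%N x = 0) -> (forall x, b <= x -> g 0%N x = 0) ->
  0 <= f (g 0%N).
Proof.
move=> M0 d0 lb G a0a ab bb0 tg g0 ga gb.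
(* The error factor of the Riemann sum is [W - 1]; the extra 1 makes [W] a positive divisor. *)
pose W := pvalue F b - pvalue F a + 2 * M * (b - a) + 1.
have Gab := G a b a0a (ltW ab) bb0.
have ba : 0 < b - a by rewrite subr_gt0.
have W0 : 0 < W by rewrite /W; have := mulr_ge0 M0 (ltW ba); lra.
have [B B0 HB] := tjet_bound 1%N tg.
apply/ler_addgt0Pr => e e0.
pose eps := e / W; have eps0 : 0 < eps by rewrite divr_gt0.
pose n := (Num.trunc ((b - a) * B / eps)).+1.
have n0 : 0 < n%:R :> R by rewrite ltr0n.
have nB : (b - a) / n%:R * B <= eps.
  have := truncnS_gt ((b - a) * B / eps); rewrite ltr_pdivrMr// -/n => /ltW H.
  by rewrite mulrAC ler_pdivrMr// [leRHS]mulrC.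
pose st := (b - a) / n%:R; have st0 : 0 < st by rewrite divr_gt0.
pose p (i : nat) := a + i%:R * st.
have pS i : p i.+1 = p i + st by rewrite /p -natr1; ring.
have p0 : p 0%N = a by rewrite /p mul0r addr0.
have pn : p n = b by rewrite /p /st; field; rewrite gt_eqF.
have pab i : (i <= n)%N -> a <= p i <= b.
  move=> lin; apply/andP; split; first by rewrite /p lerDl mulr_ge0 ?ler0n// ltW.
  by rewrite -[leRHS]pn /p lerD2l ler_wpM2r ?ler_nat// ltW.
have H := riemann_estimate hfF hF r0 tk k0 k1 (p := p) (n := n) (act := predT) tg M0 d0 (ltW eps0).
have : `|f (g 0%N) - \sum_(0 <= i < n) g 0%N (p i) * (pvalue F (p i.+1) - pvalue F (p i))| <=
     eps * \sum_(0 <= i < n | predT i) (pvalue F (p i.+1) - pvalue F (p i) + 2 * M * (p i.+1 - p i)).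
  apply: H => //.
  - by move=> i _; rewrite pS; lra.
  - by rewrite p0.
  - by rewrite pn.
  - move=> i lin _ x t xp; apply: lb.
    by have := pab i (ltnW lin); have := pab i.+1 lin; lra.
  - move=> i lin x xp; apply: le_trans (deriv_bound (tg.1 0%N) (fun z _ => HB z)) _.
    apply: le_trans nB; rewrite mulrC ler_wpM2r ?(ltW B0)// ger0_norm; last by lra.
    by move: xp; rewrite pS -/st; lra.
have -> : \sum_(0 <= i < n | predT i) (pvalue F (p i.+1) - pvalue F (p i) + 2 * M * (p i.+1 - p i))
    = W - 1.
  rewrite big_split /= -mulr_sumr !telescope_sumr// pn p0 /W; ring.
have : 0 <= \sum_(0 <= i < n) g 0%N (p i) * (pvalue F (p i.+1) - pvalue F (p i)).
  rewrite big_nat; apply: sumr_ge0 => i /andP[_ lin]; apply: mulr_ge0 => //.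
  rewrite subr_ge0; apply: G; have := pab i (ltnW lin); have := pab i.+1 lin; rewrite pS; lra.
have -> : eps * (W - 1) = e - eps by rewrite /eps; field; rewrite gt_eqF.
by rewrite ler_norml; lra.
Qed.

Lemma strip_improve M x (Z : set R) : 0 < M -> strip f k M x -> mu.-negligible Z ->
  (exists2 del : R, 0 < del & forall y, `|y - x| < del -> upper_ge0 Z y) -> strip f k 0 x.
Proof.
move=> M0 [d d0 lb] nZ [e e0 up].
pose w := Num.min d e; have w0 : 0 < w by rewrite lt_min d0.
have wd : w <= d by rewrite ge_min lexx.
have we : w <= e by rewrite ge_min lexx orbT.
have lb' : bounded_below f k M d (x - w) (x + w).
  by move=> y t yx; apply: lb; lra.
have G : forall a b, x - w < a -> a <= b -> b < x + w -> pvalue F a <= pvalue F b.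
  apply: (pvalue_incr_ae M0 d0 lb' nZ) => y yx; apply: up.
  by rewrite ltr_norml; lra.
have r1 : 0 < r + 1 by have := r0; lra.
(* The distance of [y] from [x] and the reach [r * t] of the kernel both stay within [w / 4], inside
   the window of half-width [3 / 4 * w]. *)
exists (w / 4 / (r + 1)); first by rewrite !divr_gt0.
have ww : w / 4 / (r + 1) <= w / 4.
  by rewrite ler_pdivrMr// ler_pMr; have := r0; lra.
move=> y t yx t0; rewrite ltr_pdivlMr// mulrDr mulr1 => tw; rewrite oppr0.
have rt := mulr_gt0 r0 t0; rewrite mulrC in rt.
apply: (@pair_ge0_incr M d (x - w) (x + w) (x - 3 / 4 * w) (x + 3 / 4 * w) _
  (fun n z => kern t k n (z - y)) (ltW M0) d0 lb' G _ _ _ (kern_transl_jet y t0)).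
- lra.
- lra.
- lra.
- by move=> z; exact: kern_ge0.
- by move=> z zx; apply: kern_transl_vanish => //; left; rewrite mulrC; lra.
- by move=> z zx; apply: kern_transl_vanish => //; right; rewrite mulrC; lra.
Qed.

End Monotonicity.

(** * Isolated points *)

Section Taylor.
Context {R : realType}.
Implicit Types (g : nat -> R -> R) (h : R -> R) (a b c x y s t B : R).

Lemma derivX n x : is_derive x 1 (fun y => y ^+ n.+1) (n.+1%:R * x ^+ n).
Proof.
elim: n => [|n IH].
  by rewrite expr0 mulr1; have := is_derive_id x (1 : R).
have := derivM (is_derive_id x (1 : R)) IH.
rewrite (_ : (fun y => id y * y ^+ n.+1) = fun y => y ^+ n.+2); last first.
  by apply/funext => y; rewrite [RHS]exprS.
by move=> /is_derive_eq; apply; rewrite -[n.+2%:R]natr1 /= [x ^+ n.+1]exprS; ring.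
Qed.

Lemma cont_pow n : continuous (fun y : R => y ^+ n).
Proof.
case: n => [|n].
  by rewrite (_ : (fun y => y ^+ 0) = fun=> 1)//; exact: cst_continuous.
exact: is_derive_cont (derivX n).
Qed.

Lemma deriv_sum (h d : nat -> R -> R) n x : (forall i, is_derive x 1 (h i) (d i x)) ->
  is_derive x 1 (fun y => \sum_(0 <= i < n) h i y) (\sum_(0 <= i < n) d i x).
Proof.
move=> hd; elim: n => [|n IH].
  rewrite big_geq//; rewrite (_ : (fun y => _) = fun=> 0).
    exact: is_derive_cst.
  by apply/funext => y; rewrite big_geq.
rewrite big_nat_recr//= (_ : (fun y => _) = fun y => \sum_(0 <= i < n) h i y + h n y).
  exact: derivD.
by apply/funext => y; rewrite big_nat_recr.
Qed.

(** The expansion of [g 1] is integrated term by term and the remainder by the mean value estimate,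
    so that no factorial appears. *)
Lemma taylor_bound g x N B : jet g -> (forall y, `|g N y| <= B) ->
  exists c : nat -> R, forall s,
    `|g 0%N (x + s) - \sum_(0 <= j < N) c j * s ^+ j| <= B * `|s| ^+ N.
Proof.
elim: N g => [|N IH] g jg gB.
  by exists (fun=> 0) => s; rewrite big_geq// subr0 expr0 mulr1.
have [c Hc] := IH (fun n => g n.+1) (fun n => jg n.+1) gB.
have B0 : 0 <= B := le_trans (normr_ge0 _) (gB 0).
pose c' j := if j is i.+1 then c i / i.+1%:R else g 0%N x.
exists c' => s.
pose q s := \sum_(0 <= j < N) c' j.+1 * s ^+ j.+1.
have qE z : \sum_(0 <= j < N.+1) c' j * z ^+ j = g 0%N x + q z.
  by rewrite big_nat_recl// expr0 mulr1.
have qd (z : R) : is_derive z 1 q (\sum_(0 <= j < N) c j * z ^+ j).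
  apply: (@deriv_sum (fun j z => c' j.+1 * z ^+ j.+1) (fun j z => c j * z ^+ j)) => j.
  apply: is_derive_eq (derivZ (c' j.+1) (derivX j z)) _.
  by rewrite /c' mulrA divfK// pnatr_eq0.
have gd (z : R) : is_derive z 1 (fun z => g 0%N (x + z)) (g 1%N (x + z)).
  have -> : (fun z => g 0%N (x + z)) = (fun z => g 0%N (1 * (z - - x))).
    by apply/funext => w; congr (g _ _); ring.
  apply: is_derive_eq (deriv_aff (jg 0%N _)) _.
  by rewrite mul1r; congr (g _ _); ring.
have D z := derivD (gd z) (derivZ (-1) (qd z)).
have E z : g 1%N (x + z) + -1 * \sum_(0 <= j < N) c j * z ^+ j =
  g 1%N (x + z) - \sum_(0 <= j < N) c j * z ^+ j by rewrite mulN1r.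
have q0 : q 0 = 0 by rewrite /q big1// => j _; rewrite expr0n mulr0.
have -> : g 0%N (x + s) - \sum_(0 <= j < N.+1) c' j * s ^+ j =
    (g 0%N (x + s) + -1 * q s) - (g 0%N (x + 0) + -1 * q 0).
  by rewrite qE q0 addr0; ring.
have -> : B * `|s| ^+ N.+1 = B * `|s| ^+ N * `|s - 0| by rewrite subr0 exprSr mulrA.
apply: (deriv_bound D) => z; rewrite !subr0 => zs; rewrite E; apply: le_trans (Hc z) _.
by rewrite ler_wpM2l// lerXn2r// nnegrE.
Qed.

End Taylor.

Section IsolatedPoint.
Context {R : realType} (f F : schwartz_distribution R)
  (hfF : is_distr_derivative f F) (hF : lojasiewicz F)
  (k : nat -> R -> R) (r : R) (r0 : 0 < r) (tk : tjet r k)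
  (k0 : forall x, 0 <= k 0%N x) (k1 : integ (k 0%N) (- r) r = 1).
Context (x0 : R).
Implicit Types (g : nat -> R -> R) (h : R -> R) (a b c x y s t M eps del : R).

Definition dconv h n := conv (- r) r h k n.+1.

Lemma tjet_dconv h : continuous h -> tjet (4 * r) (dconv h).
Proof.
move=> ch; have := tjet_shift 1 (tjet_conv (- r) r ch tk).
apply: tjetW; rewrite normrN gtr0_norm//; have := r0; lra.
Qed.

(* Up to sign, [f] tested against the part of the convolution [h * phi_t] that comes
   from [|x - x0| <= r * t], with [h] given in the variable [(x - x0) / t]. *)
Definition local_mean h t := mollify F (kern t (dconv h) 0%N) x0.

Lemma tjet_mean h t : continuous h -> 0 < t ->
  tjet (4 * r * t + `|x0|) (fun n y => kern t (dconv h) n (y - x0)).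
Proof. by move=> ch t0; apply: tjet_transl; apply: tjet_kern => //; exact: tjet_dconv. Qed.

Lemma conv_lin a b h h' s n y : continuous h -> continuous h' ->
  conv a b (fun x => s * h x + h' x) k n y = s * conv a b h k n y + conv a b h' k n y.
Proof.
move=> ch ch'; have [c1 c2] := (cont_conv (n := n) (y := y) ch tk.1, cont_conv (n := n) (y := y) ch' tk.1).
rewrite /conv -integZ// -integD//; last exact: contZ.
by congr integ; apply/funext => x; ring.
Qed.

Lemma local_mean_lin h h' s t : continuous h -> continuous h' -> 0 < t ->
  local_mean (fun x => s * h x + h' x) t = s * local_mean h t + local_mean h' t.
Proof.
move=> ch ch' t0; have [t1 t2] := (tjet_mean ch t0, tjet_mean ch' t0).
rewrite /local_mean /mollify -(pair_lin F s t1 t2); congr (F _); apply/funext => y.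
by rewrite /kern /dconv conv_lin//; ring.
Qed.

Lemma local_mean_sum (c : nat -> R) (h : nat -> R -> R) h' n t :
  (forall i, continuous (h i)) -> continuous h' -> 0 < t ->
  local_mean (fun x => \sum_(0 <= i < n) c i * h i x + h' x) t =
  \sum_(0 <= i < n) c i * local_mean (h i) t + local_mean h' t.
Proof.
move=> ch ch' t0; elim: n h' ch' => [|n IH] h' ch'.
  rewrite big_geq// add0r; congr local_mean; apply/funext => x.
  by rewrite big_geq// add0r.
rewrite big_nat_recr//= -addrA -local_mean_lin// -IH//; last first.
  by apply: contD => //; exact: contZ.
by congr local_mean; apply/funext => x; rewrite big_nat_recr//= addrA.
Qed.

(** [dconv h] is the derivative of a compactly supported function, hence has integral zero, and the
    point value of [F] is multiplied by 0. *)
Lemma local_mean_cvg h : continuous h -> local_mean h t @[t --> 0^'+] --> (0 : R).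
Proof.
move=> ch; have tb := tjet_dconv ch; have tc := tjet_conv (- r) r ch tk.
(* The convolution vanishes strictly beyond [4 * r], so it is evaluated at [5 * r]. *)
have r4 : 0 <= 5 * r by have := r0; lra.
have tb' : tjet (5 * r) (dconv h) by apply: tjetW tb; have := r0; lra.
have := pvalue_cvg hF (x := x0) r4 tb'.
have cb : continuous (dconv h 0%N) by exact: (jet_cont (n := 0%N) tb.1).
have dc x : is_derive x 1 (conv (- r) r h k 0%N) (dconv h 0%N x) := tc.1 0%N x.
rewrite (integE _ _ cb dc) !(conv_vanish 0%N ch tk) ?subrr ?mulr0//.
- by rewrite !normrN !gtr0_norm; have := r0; lra.
- by rewrite !normrN !gtr0_norm; have := r0; lra.
Qed.

(** The finite order [N] of [F] on a fixed compact set costs the power [t^-1 ^+ N.+1] of the kernel;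
    [h] enters only through its size near [[- r, r]], so the constants also serve functions varying
    with [t]. *)
Lemma local_mean_bound : exists C, exists N : nat, 0 < C /\
  forall h D t, continuous h -> 0 <= D -> 0 < t -> t <= 1 ->
    (forall x, `|x| <= 3 * r -> `|h x| <= D) -> `|local_mean h t| <= C * D * t^-1 ^+ N.+1.
Proof.
have r0' := r0.
have [C [N [C0 HC]]] := pair_bound F (4 * r + `|x0|).
have [B B0 HB] := tjet_boundN N.+1 tk.
exists (C * (B * (2 * r))), N; split; first by rewrite !mulr_gt0//; lra.
move=> h D t ch D0 t0 t1 hD.
have tm : tjet (4 * r + `|x0|) (fun n y => kern t (dconv h) n (y - x0)).
  apply: tjetW (tjet_mean ch t0); rewrite lerD2r ler_piMr//; lra.
have ti : 1 <= t^-1 by rewrite invf_ge1.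
apply: le_trans (HC _ (D * B * (2 * r) * t^-1 ^+ N.+1) tm _) _; last first.
  by rewrite le_eqVlt; apply/orP; left; apply/eqP; ring.
move=> n y nN; rewrite /kern normrM ger0_norm; last by rewrite exprn_ge0// invr_ge0 ltW.
rewrite mulrC; apply: ler_pM => //; first by rewrite exprn_ge0// invr_ge0 ltW.
  have e : `|r - - r| = 2 * r by rewrite gtr0_norm; lra.
  rewrite -e; apply: integ_bound; first exact: cont_conv tk.1.
  move=> x xr; rewrite normrM ler_pM//; last exact: HB.
  apply: hD; move: xr; rewrite e.
  by rewrite !ler_norml; lra.
exact: ler_weXn2l.
Qed.

Lemma cvg_pow n : (fun t : R => t ^+ n) t @[t --> 0^'+] --> (0 ^+ n : R).
Proof. by apply: cvg_at_right_filter; exact: cont_pow. Qed.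

Lemma cont_affine h s : continuous h -> continuous (fun y => h (x0 + s * y)).
Proof.
move=> ch x; apply: (@continuous_comp _ _ _ (fun y => x0 + s * y) h); last exact: ch.
apply: (@contD _ (fun=> x0) (fun y => s * y)); first exact: cst_continuous.
by apply: (@contZ _ s id) => y; exact: cvg_id.
Qed.

(* Each Taylor monomial contributes a limit [pvalue F x0] times the integral of a
   derivative, which is zero; the Taylor remainder beats the negative powers of [t]
   allowed by the finite order [N] of [F]. *)
Lemma local_mean_zoom c g : tjet c g ->
  local_mean (fun s => g 0%N (x0 + t * s)) t @[t --> 0^'+] --> (0 : R).
Proof.
move=> tg; have [C [N [C0 HC]]] := local_mean_bound.
(* One order above the exponent [N.+1] of the loss, so that a factor [t] is left over. *)
have [B B0 HB] := tjet_bound N.+2 tg.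
have [p Hp] := taylor_bound x0 tg.1 HB.
have cg : continuous (g 0%N) by exact: (jet_cont (n := 0%N) tg.1).
pose rho t s := g 0%N (x0 + t * s) - \sum_(0 <= j < N.+2) p j * (t * s) ^+ j.
have crho t : continuous (rho t).
  apply: contB; first exact: cont_affine.
  elim: N.+2 => [|n IH].
    by rewrite (_ : (fun s => _) = fun=> 0); [exact: cst_continuous|apply/funext => s; rewrite big_geq].
  rewrite (_ : (fun s => _) = fun s => \sum_(0 <= j < n) p j * (t * s) ^+ j + p n * t ^+ n * s ^+ n).
    by apply: contD => //; apply: contZ; exact: cont_pow.
  by apply/funext => s; rewrite big_nat_recr//= exprMn mulrA.
have E t : 0 < t -> local_mean (fun s => g 0%N (x0 + t * s)) t =
   \sum_(0 <= j < N.+2) p j * t ^+ j * local_mean (fun s => s ^+ j) t + local_mean (rho t) t.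
  move=> t0; rewrite -local_mean_sum//; last by move=> i; exact: cont_pow.
  congr local_mean; apply/funext => s; rewrite /rho.
  under eq_bigr do rewrite -mulrA -exprMn.
  by rewrite subrKC.
have L1 : \sum_(0 <= j < N.+2) p j * t ^+ j * local_mean (fun s => s ^+ j) t @[t --> 0^'+]
    --> \sum_(0 <= j < N.+2) p j * 0 ^+ j * (0 : R).
  apply: cvg_big; first exact: add_continuous.
  move=> i _; apply: cvgM; last by apply: local_mean_cvg; exact: cont_pow.
  by apply: cvgM; [exact: cvg_cst|exact: cvg_pow].
rewrite big1 in L1; last by move=> i _; rewrite mulr0.
have r3 : 0 < 3 * r by have := r0; lra.
pose K := C * (B * (3 * r) ^+ N.+2) + 1.
have K0 : 0 < K.
  have : 0 <= C * (B * (3 * r) ^+ N.+2).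
    by rewrite mulr_ge0 ?(ltW C0)// mulr_ge0 ?(ltW B0)// exprn_ge0// ltW.
  by rewrite /K; lra.
apply: cvg0P => eps e0.
have e2 : 0 < eps / 2 by rewrite divr_gt0.
have [d d0 Hd] := cvg0_ltP L1 e2.
exists (Num.min d (Num.min 1 (eps / 2 / K))); first by rewrite !lt_min d0 ltr01 divr_gt0.
move=> t t0; rewrite !lt_min => /and3P[td /ltW t1]; rewrite ltr_pdivlMr// => tK.
rewrite subr0 E//; apply: le_trans (ler_normD _ _) _.
have := Hd t t0 td; rewrite /= subr0 => h1.
suff : `|local_mean (rho t) t| <= eps / 2 by lra.
have D0 : 0 <= B * (t * (3 * r)) ^+ N.+2.
  apply: mulr_ge0; first exact: ltW.
  by apply: exprn_ge0; apply: mulr_ge0; exact: ltW.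
apply: le_trans (HC (rho t) _ t (crho t) D0 t0 t1 _) _.
  move=> s sr; apply: le_trans (Hp _) _; rewrite ler_wpM2l ?(ltW B0)//.
  apply: lerXn2r; rewrite ?nnegrE //; first by apply: mulr_ge0; exact: ltW.
  by rewrite normrM gtr0_norm// ler_wpM2l// ltW.
have -> : C * (B * (t * (3 * r)) ^+ N.+2) * t^-1 ^+ N.+1 = t * (C * (B * (3 * r) ^+ N.+2)).
  rewrite exprMn [t ^+ N.+2]exprS exprVn; field.
  by rewrite expf_neq0// gt_eqF.
by move: tK; rewrite /K mulrDr mulr1; lra.
Qed.

Lemma integ_scale h t a b : continuous h -> 0 < t ->
  integ (fun x => h (t^-1 * (x - x0))) (x0 + t * a) (x0 + t * b) = t * integ h a b.
Proof.
move=> ch t0.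
have c1 : continuous (fun x => h (t^-1 * (x - x0))).
  apply: (@cont_transl _ (fun z => h (t^-1 * z))) => x.
  apply: (@continuous_comp _ _ _ (fun y => t^-1 * y) h); last exact: ch.
  by apply: (@contZ _ t^-1 id) => y; exact: cvg_id.
have d y : is_derive y 1 (fun x => t * prim h (t^-1 * (x - x0))) (h (t^-1 * (y - x0))).
  apply: is_derive_eq (derivZ t (deriv_aff (primP ch (t^-1 * (y - x0))))) _.
  by rewrite mulrA divff ?mul1r// gt_eqF.
rewrite (integE _ _ c1 d) /integ.
have e z : t^-1 * (x0 + t * z - x0) = z by field; rewrite gt_eqF.
by rewrite !e; ring.
Qed.

(** [f = F'] moves a derivative onto the convolution, and the substitution [x = x0 + t * s] brings
    the interval to [[- r, r]], leaving a fixed shape at scale [t]. *)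
Lemma pair_middle c g t : tjet c g -> 0 < t ->
  f (conv (x0 - r * t) (x0 + r * t) (g 0%N) (kern t k) 0%N) =
  - local_mean (fun s => g 0%N (x0 + t * s)) t.
Proof.
move=> tg t0; have cg : continuous (g 0%N) by exact: (jet_cont (n := 0%N) tg.1).
have tc := tjet_conv (x0 - r * t) (x0 + r * t) cg (tjet_kern t0 tk).
rewrite (hfF (tjet_test tc)) -derive1n1 (jet_derive1n 1 tc.1); congr (- F _).
apply/funext => y; rewrite /conv /kern /dconv /conv.
pose h s := g 0%N (x0 + t * s) * k 1%N (t^-1 * (y - x0) - s).
have ch : continuous h by apply: cont_conv tk.1; exact: cont_affine.
have := integ_scale (- r) r ch t0; rewrite mulrN [t * r]mulrC => H.
rewrite -/h expr1.
have -> : (fun x => g 0%N x * (t^-1 ^+ 2 * k 1%N (t^-1 * (y - x)))) =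
   (fun x => t^-1 ^+ 2 * h (t^-1 * (x - x0))).
  apply/funext => x; rewrite /h.
  have -> : x0 + t * (t^-1 * (x - x0)) = x by field; rewrite gt_eqF.
  have -> : t^-1 * (y - x0) - t^-1 * (x - x0) = t^-1 * (y - x) by ring.
  by ring.
rewrite integZ ?H; first by field; rewrite gt_eqF.
apply: (@cont_transl _ (fun z => h (t^-1 * z))) => x.
apply: (@continuous_comp _ _ _ (fun y => t^-1 * y) h); last exact: ch.
by apply: (@contZ _ t^-1 id) => z; exact: cvg_id.
Qed.

Lemma utr_ge0_of_strip t y : 0 < t ->
  (forall x, y - r * t <= x <= y + r * t -> strip f k 0 x) -> 0 <= utr f k t y.
Proof.
move=> t0 H; apply: (pair_ge0 r0 tk k0 k1 (kern_transl_jet tk y t0)).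
  by move=> x; exact: kern_ge0.
move=> x sx; apply: H.
have : closed `[y - r * t, y + r * t]%classic by exact: interval_closed.
move=> /closure_id cl; suff : `[y - r * t, y + r * t]%classic x by rewrite /= in_itv.
rewrite cl; apply: closure_subset sx => z /= /eqP zn; rewrite in_itv /=.
apply/andP; split; rewrite leNgt; apply/negP => zy; apply: zn.
  by apply: (kern_transl_vanish r0 tk) => //; left; exact: ltW.
by apply: (kern_transl_vanish r0 tk) => //; right; exact: ltW.
Qed.

(** For [|y - x0| > r * t] the kernel at [(y, t)] misses [x0], so [utr t y >= 0]. Only the middle
    piece of the integral of [g] times [utr t] can be negative, and it tends to 0 by
    [local_mean_zoom]. *)
Lemma strip_isolated (rho : R) : 0 < rho ->
  (forall y, y != x0 -> `|y - x0| < rho -> strip f k 0 y) -> strip f k 0 x0.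
Proof.
move=> rho0 H; have r0' := r0.
have r1 : 0 < r + 1 by lra.
have U y t : 0 < t -> r * t < `|y - x0| -> `|y - x0| + r * t < rho -> 0 <= utr f k t y.
  move=> t0 yx yr; apply: utr_ge0_of_strip => // x xy; have rt := mulr_gt0 r0 t0.
  have xn : `|x - y| <= r * t by rewrite ler_norml; lra.
  apply: H; last first.
    have -> : x - x0 = (x - y) + (y - x0) by ring.
    by apply: le_lt_trans (ler_normD _ _) _; lra.
  by apply: contraTneq xn => ->; rewrite -ltNge distrC.
pose w := rho / 2.
have w0 : 0 < w by rewrite divr_gt0.
have P g c : tjet c g -> (forall x, 0 <= g 0%N x) ->
    (forall x, x <= x0 - w -> g 0%N x = 0) -> (forall x, x0 + w <= x -> g 0%N x = 0) ->
    0 <= f (g 0%N).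
  move=> tg g0 ga gb.
  have cg : continuous (g 0%N) by exact: (jet_cont (n := 0%N) tg.1).
  have ab : x0 - w <= x0 + w by lra.
  have L := pair_conv_lim (f := f) r0 tk k0 k1 tg ab ga gb.
  have L0 : - local_mean (fun s => g 0%N (x0 + t * s)) t @[t --> 0^'+] --> (0 : R).
    have L1 := cvgN (local_mean_zoom tg).
    by rewrite -[X in _ --> X]oppr0; exact: L1.
  apply: (cvg0_le L0 L); exists (w / (r + 1)); first by rewrite divr_gt0.
  move=> t t0; rewrite ltr_pdivlMr// mulrDr mulr1 => tw.
  have rt := mulr_gt0 r0 t0; rewrite mulrC in rt.
  rewrite /= -(pair_middle tg t0).
  have tkt := tjet_kern t0 tk.
  rewrite (@pair_conv_cat _ _ _ (x0 - w) (x0 - r * t) (x0 + w) _ _ cg tkt).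
  rewrite (@pair_conv_cat _ _ _ (x0 - r * t) (x0 + r * t) (x0 + w) _ _ cg tkt).
  have side a b : a <= b -> (forall y, a < y < b -> 0 <= utr f k t y) ->
      0 <= f (conv a b (g 0%N) (kern t k) 0%N).
    move=> leab Hu; have D y := pair_conv_derive f a y cg tkt.
    have E : f (conv a a (g 0%N) (kern t k) 0%N) = 0.
      rewrite (_ : conv a a _ _ _ = fun=> 0) ?pair0//.
      by apply/funext => y; rewrite /conv /integ subrr.
    rewrite -E; apply: (deriv_incr D leab) => y /Hu; exact: mulr_ge0.
  have s1 : 0 <= f (conv (x0 - w) (x0 - r * t) (g 0%N) (kern t k) 0%N).
    apply: side; first by rewrite mulrC; lra.
    move=> y yx; apply: U => //; rewrite mulrC in yx *; rewrite ltr0_norm; rewrite /w in tw yx; lra.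
  have s2 : 0 <= f (conv (x0 + r * t) (x0 + w) (g 0%N) (kern t k) 0%N).
    apply: side; first by rewrite mulrC; lra.
    move=> y yx; apply: U => //; rewrite mulrC in yx *; rewrite gtr0_norm; rewrite /w in tw yx; lra.
  by lra.
exists (w / 2 / (r + 1)); first by rewrite !divr_gt0.
have ww : w / 2 / (r + 1) <= w / 2 by rewrite ler_pdivrMr// ler_pMr; lra.
move=> y t yx t0; rewrite ltr_pdivlMr// mulrDr mulr1 oppr0 => tw.
have rt := mulr_gt0 r0 t0; rewrite mulrC in rt.
apply: P (kern_transl_jet tk y t0) _ _ _.
- by move=> z; exact: kern_ge0.
- by move=> z zx; apply: (kern_transl_vanish r0 tk) => //; left; rewrite mulrC; lra.
- by move=> z zx; apply: (kern_transl_vanish r0 tk) => //; right; rewrite mulrC; lra.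
Qed.

End IsolatedPoint.

(** * The Baire argument *)

Section Baire.
Context {R : realType}.
Implicit Types (x y z rho : R).

(** If no portion lies in a [C i], every ball centred in [K] contains a smaller one centred in [K]
    whose points of [K] avoid [C i]. Nested over all [i], these balls shrink to a point of [K]
    outside every [C i]. *)
Lemma baire_portion (K : set R) (C : nat -> set R) : K !=set0 ->
  (forall x, K x -> exists2 rho : R, 0 < rho & closed (K `&` `[x - rho, x + rho])) ->
  (forall i x, K x -> ~ C i x ->
     exists2 rho : R, 0 < rho & forall y, K y -> `|y - x| < rho -> ~ C i y) ->
  (forall x, K x -> exists i, C i x) ->
  exists i x (rho : R), [/\ K x, 0 < rho & forall y, K y -> `|y - x| < rho -> C i y].
Proof.
move=> [x0 Kx0] Kcl Ccl Kcov; apply: contrapT => Hno.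
have [rho0 rho00 cl0] := Kcl x0 Kx0.
have step (p : nat * (R * R)) : exists q : R * R, K p.2.1 -> 0 < p.2.2 ->
    [/\ K q.1, 0 < q.2, q.2 <= p.2.2 / 2, `|q.1 - p.2.1| + q.2 < p.2.2 &
      forall y, K y -> `|y - q.1| <= q.2 -> ~ C p.1 y].
  case: p => i [x rho] /=.
  have [[Kx r0]|] := pselect (K x /\ 0 < rho); last first.
    by move=> H; exists (0, 0) => Kx r0; exfalso; apply: H.
  have [y [Ky yx nCy]] : exists y, [/\ K y, `|y - x| < rho & ~ C i y].
    apply: contrapT => H; apply: Hno; exists i, x, rho; split => // y Ky yx.
    by apply: contrapT => nC; apply: H; exists y.
  have [d d0 Hd] := Ccl i y Ky nCy.
  (* The three terms make the radii halve, keep the closed ball clear of [C i], and nest it in the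
     previous ball. *)
  pose s := Num.min (rho / 2) (Num.min (d / 2) ((rho - `|y - x|) / 2)).
  have s0 : 0 < s by rewrite !lt_min !divr_gt0 ?subr_gt0.
  have s1 : s <= rho / 2 by rewrite ge_min lexx.
  have s2 : s <= d / 2 by rewrite !ge_min lexx orbT.
  have s3 : s <= (rho - `|y - x|) / 2 by rewrite !ge_min lexx !orbT.
  exists (y, s) => _ _ /=; split => //; first by lra.
  by move=> z Kz zy; apply: Hd => //; lra.
have [G HG] := choice step.
pose s := fix s n := if n is m.+1 then G (m, s m) else (x0, rho0).
have sP n : K (s n).1 /\ 0 < (s n).2.
  elim: n => [//|n [Kn rn]]; have [h1 h2 _ _ _] := HG (n, s n) Kn rn.
  by split.
have sS n : [/\ (s n.+1).2 <= (s n).2 / 2,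
   `|(s n.+1).1 - (s n).1| + (s n.+1).2 < (s n).2 &
      forall y, K y -> `|y - (s n.+1).1| <= (s n.+1).2 -> ~ C n y].
  have [Kn rn] := sP n; have [_ _ h3 h4 h5] := HG (n, s n) Kn rn.
  by split.
have nest n m : `|(s (n + m)%N).1 - (s n).1| + (s (n + m)%N).2 <= (s n).2.
  elim: m => [|m IH]; first by rewrite addn0 subrr normr0 add0r.
  rewrite addnS; have [_ h _] := sS (n + m)%N.
  have := ler_normD ((s (n + m).+1).1 - (s (n + m)%N).1) ((s (n + m)%N).1 - (s n).1).
  by rewrite subrKA; lra.
(* The radii at least halve; decay like the inverse of [n.+1] is all that the limit asks for. *)
have small n : (s n).2 * n.+1%:R <= rho0.
  elim: n => [|n IH]; first by rewrite mulr1.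
  have [h _ _] := sS n; have [_ p0] := sP n; have [_ p1] := sP n.+1.
  apply: le_trans IH; rewrite -(natr1 n.+1) -natr1.
  have n0 : 0 <= n%:R :> R by [].
  have := ler_wpM2r n0 h; rewrite mulrAC => h'; have := mulr_ge0 (ltW p0) n0; lra.
pose A := [set (s n).1 - (s n).2 | n in setT].
have Aub n : ubound A ((s n).1 + (s n).2).
  move=> _ [m _ <-]; have [nm|mn] := leqP n m.
    have := nest n (m - n)%N; rewrite subnKC// => H.
    have [_ p0] := sP m; have := ler_norm ((s m).1 - (s n).1); lra.
  have := nest m (n - m)%N; rewrite subnKC ?(ltnW mn)// => H.
  have [_ p0] := sP n; have := ler_norm (- ((s n).1 - (s m).1)); rewrite normrN; lra.
have A0 : A !=set0 by exists ((s 0%N).1 - (s 0%N).2); exists 0%N.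
pose z := sup A.
have zs n : `|z - (s n).1| <= (s n).2.
  have h1 : z <= (s n).1 + (s n).2 by apply: ge_sup => //; exact: Aub.
  have h2 : (s n).1 - (s n).2 <= z.
    by apply: ub_le_sup; [exists ((s 0%N).1 + (s 0%N).2); exact: Aub|exists n].
  by rewrite ler_norml; lra.
have [Kz _] : (K `&` `[x0 - rho0, x0 + rho0]) z.
  apply: cl0 => B /nbhs_ballP[e /= e0 sB].
  pose n := Num.trunc (rho0 / e).
  have ne : (s n).2 < e.
    have := truncnS_gt (rho0 / e); rewrite ltr_pdivrMr// -/n => H.
    have n0 : 0 < n.+1%:R :> R by rewrite ltr0n.
    by rewrite -(ltr_pM2r n0); have := small n; rewrite [e * _]mulrC; lra.
  exists (s n).1; split; last first.
    by apply: sB; rewrite /ball /=; have := zs n; lra.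
  split; first by have [] := sP n.
  have := nest 0%N n; rewrite add0n /= => H; have [_ p0] := sP n.
  rewrite in_itv /= -ler_distl; lra.
have [i Ci] := Kcov z Kz.
by have [_ _ /(_ z Kz (zs i.+1))] := sS i.
Qed.

End Baire.

Section Positivity.
Context {R : realType} (f F : schwartz_distribution R)
  (hfF : is_distr_derivative f F) (hF : lojasiewicz F)
  (k : nat -> R -> R) (r : R) (r0 : 0 < r) (tk : tjet r k)
  (k0 : forall x, 0 <= k 0%N x) (k1 : integ (k 0%N) (- r) r = 1).
Implicit Types (a b c x y s t M eps del T : R).

Definition cone_bound T M del x := forall y t, 0 < t -> t < del ->
  `|y - x| <= T * t -> - M <= utr f k t y.

Lemma strip_near x : strip f k 0 x ->
  exists2 rho : R, 0 < rho & forall y, `|y - x| < rho -> strip f k 0 y.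
Proof.
move=> [d d0 H]; exists (d / 2); first by rewrite divr_gt0.
move=> y; rewrite ltr_norml => yx; exists (d / 2); first by rewrite divr_gt0.
by move=> z t zy t0 td; apply: H => //; lra.
Qed.

Lemma strip_everywhere (U E Z : set R) T : r < T -> open U -> countable E ->
  lebesgue_measure.-negligible Z ->
  (forall x, U x -> upper_ge0 f k Z x) ->
  (forall x, U x -> ~ E x -> exists M del, 0 < del /\ cone_bound T M del x) ->
  forall x, U x -> strip f k 0 x.
Proof.
move=> rT oU cE nZ up lo x1 Ux1; apply: contrapT => nx1.
have r0' := r0.
pose K := U `&` [set x | ~ strip f k 0 x].
have Unear x : U x -> exists2 rho : R, 0 < rho & forall y, `|y - x| <= rho -> U y.
  move=> Ux; have /nbhs_ballP[d /= d0 Hd] := open_nbhs_nbhs (conj oU Ux).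
  exists (d / 2); first by rewrite divr_gt0.
  by move=> y yx; apply: Hd; rewrite /ball /= distrC; lra.
have [e eI] : exists e : R -> nat, {in E &, injective e}.
  by move: cE => /countable_injP[e He]; exists e.
pose Dn n := [set x | cone_bound T n.+1%:R n.+1%:R^-1 x].
(* Odd indices give the sets of points with a uniform bound on their cones, even
   indices the points of [E]. *)
pose C i := if odd i then Dn i./2 else [set x | E x /\ e x = i./2].
have [|||i [x0 [rho [[Ux0 nx0] rho0 HC]]]] := @baire_portion R K C (ex_intro _ x1 (conj Ux1 nx1)).
- move=> x [Ux _]; have [d d0 Hd] := Unear x Ux; exists d => //.
  have -> : K `&` `[x - d, x + d] = `[x - d, x + d] `&` ~` [set x | strip f k 0 x].
    apply/seteqP; split=> y; first by move=> [[Uy ny] yx]; split.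
    move=> [yx ny]; split => //; split => //; apply: Hd.
    by move: yx; rewrite /= in_itv /= ler_distl.
  apply: closedI; first exact: interval_closed.
  apply: open_closedC; rewrite openE => y /strip_near[d' d'0 Hd'].
  by apply/nbhs_ballP; exists d' => //= z; rewrite /ball /= distrC; exact: Hd'.
- move=> i x _; rewrite /C; case: ifPn => oi.
    move=> nD; have [y [t [t0 td yx uy]]] : exists y t, [/\ 0 < t, t < (i./2).+1%:R^-1,
        `|y - x| <= T * t & utr f k t y < - (i./2).+1%:R].
      apply: contrapT => H; apply: nD => y t t0 td yx; rewrite leNgt; apply/negP => uy.
      by apply: H; exists y, t.
    have cy : {for y, continuous (utr f k t)} by exact: (utr_cont (f := f) tk t0).
    have : \forall z \near y, utr f k t z < - (i./2).+1%:R.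
      exact: (cvgr_lt (utr f k t y) cy).
    move=> /nbhs_ballP[d /= d0 Hd].
    (* Moving the violating point along with the vertex from [x] to [z] keeps it in the cone, and
       continuity in [y] preserves the violation. *)
    exists d => // z _ zx Dz.
    have := Dz (y + (z - x)) t t0 td; rewrite (_ : y + (z - x) - z = y - x); last by ring.
    move=> /(_ yx); rewrite leNgt => /negP; apply; apply: Hd.
    by rewrite /ball /= (_ : y - (y + (z - x)) = - (z - x)) ?normrN//; ring.
  (* [e] is injective on [E], so this [C i] has at most one point. *)
  move=> nS.
  have [[w [Ew ew]]|nw] := pselect (exists w, E w /\ e w = i./2); last first.
    by exists 1 => // y _ _ yS; apply: nw; exists y.
  have wx : w != x by apply: contra_notN nS => /eqP <-.
  exists `|w - x|; first by rewrite normr_gt0 subr_eq0.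
  move=> y _ yx [Ey ey]; move: yx.
  by rewrite (eI y w) ?ltxx ?inE// ey.
- move=> x [Ux _]; have [Ex|nEx] := pselect (E x).
    by exists (e x).*2; rewrite /C odd_double doubleK.
  have [M [d [d0 H]]] := lo x Ux nEx.
  pose n := maxn (Num.trunc `|M|) (Num.trunc d^-1).
  exists n.*2.+1; rewrite /C /= odd_double /= uphalf_double => y t t0 tn yx.
  have nM : `|M| <= n.+1%:R.
    apply: le_trans (ltW (truncnS_gt _)) _; by rewrite ler_nat ltnS leq_maxl.
  have nd : d^-1 < n.+1%:R.
    apply: lt_le_trans (truncnS_gt _) _; by rewrite ler_nat ltnS leq_maxr.
  have td : t < d.
    apply: lt_trans tn _; rewrite invf_plt ?posrE//.
  by have := H y t t0 td yx; have := ler_norm M; lra.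
have [d [d0 drho Ud]] : exists d : R, [/\ 0 < d, d <= rho & forall y, `|y - x0| <= d -> U y].
  have [d d0 Hd] := Unear x0 Ux0; exists (Num.min d rho); split.
  - by rewrite lt_min d0.
  - by rewrite ge_min lexx orbT.
  - by move=> y; rewrite le_min => /andP[/Hd].
apply: (nx0); move: HC; rewrite /C; case: ifPn => oi HC.
  set n := i./2 in HC.
  have n0 : 0 < n.+1%:R :> R by rewrite ltr0n.
  apply: (strip_improve hfF hF r0 tk k0 k1 n0 _ nZ); last first.
    by exists d => // y yx; apply: up; apply: Ud; exact: ltW.
  (* Below height [w] the kernel at [(y, t)] stays within [d] of [x0], and [t] is small enough for
     the cone bound [Dn n]. *)
  pose w := Num.min (d / 2) (Num.min n.+1%:R^-1 (d / 2 / r)).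
  have w0 : 0 < w by rewrite !lt_min invr_gt0 n0 !divr_gt0.
  have w1 : w <= d / 2 by rewrite ge_min lexx.
  have w2 : w <= n.+1%:R^-1 by rewrite !ge_min lexx orbT.
  have w3 : w <= d / 2 / r by rewrite !ge_min lexx !orbT.
  exists w => // y t yx t0 tw.
  have rt : r * t < d / 2.
    by rewrite mulrC -ltr_pdivlMr//; exact: lt_le_trans tw w3.
  (* Since [r < T], [(y, t)] is in the cone above any point of [K] within [r * t]
     of [y]. *)
  have [[z [Kz zy]]|nz] := pselect (exists z, K z /\ `|z - y| <= r * t).
    have zx : `|z - x0| < rho.
      have := ler_normD (z - y) (y - x0); rewrite subrKA => H.
      have : `|y - x0| <= w by rewrite ler_norml; lra.
      by lra.
    have := HC z Kz zx y t t0 (lt_le_trans tw w2); apply.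
    by rewrite distrC; apply: le_trans zy _; rewrite ler_wpM2r// ltW.
  have u0 : 0 <= utr f k t y; last by lra.
  apply: (utr_ge0_of_strip r0 tk k0 k1) => // z zy; apply: contrapT => nz'.
  apply: nz; exists z; split; last by rewrite ler_norml; lra.
  by split => //; apply: Ud; rewrite ler_norml; lra.
(* Even index: all points of the portion carry the same code, so injectivity of [e] leaves only
   [x0]. *)
apply: (strip_isolated hfF hF r0 tk k0 k1 d0) => y yx0 yd; apply: contrapT => ny.
have Ky : K y by split => //; apply: Ud; exact: ltW.
have [Ey ey] := HC y Ky (lt_le_trans yd drho).
have [Ex ex] : E x0 /\ e x0 = i./2.
  by apply: HC; [split|rewrite subrr normr0].
by move/eqP: yx0; apply; apply: eI; rewrite ?inE// ey.
Qed.

End Positivity.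

(** * From cone limits to bounds on the transform *)

Section LimitValues.
Context {R : realType} (f : schwartz_distribution R) (phi : R -> R) (r : R)
  (tk : tjet r (fun n => derive1n n phi)).
Implicit Types (x y t theta del eta M : R).

Lemma phi_transformE x t : 0 < t ->
  phi_transform f phi (x, t) = utr f (fun n => derive1n n phi) t x.
Proof. by move=> t0; rewrite (utrE _ tk)// /phi_transform /rescaled /= gtr0_norm. Qed.

(** Giving up 1 makes the inequality strict, so it holds on the cone within some ball of radius [d];
    dividing by [|tan theta| + 1] keeps the cone up to that height inside the ball. *)
Lemma lower_value_cone theta x M : ((- M)%:E <= lower_value f phi theta x)%E ->
  exists del, 0 < del /\
    cone_bound f (fun n => derive1n n phi) (tan theta) (M + 1) del x.
Proof.
rewrite /lower_value /limf_einf EFinN leeN2 => H.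
have : (limf_esup (\- (fun p : R * R => (phi_transform f phi p)%:E))%E
  (within (cone x theta) (nbhs (x, 0%R : R))) < (M + 1)%:E)%E.
  by apply: le_lt_trans H _; rewrite lte_fin; lra.
rewrite limf_esupE => /ereal_inf_lt[_ [V FV <-] HV].
have /nbhs_ballP[d /= d0 Hd] := FV.
pose T := `|tan theta| + 1.
have T0 : 0 < T by rewrite /T; have := normr_ge0 (tan theta); lra.
exists (d / T); split; first by rewrite divr_gt0.
move=> y t t0; rewrite ltr_pdivlMr// => tT yx.
have tt : t * `|tan theta| < d by move: tT; rewrite /T mulrDr mulr1; lra.
have td : t < d.
  by move: tT; rewrite /T mulrDr mulr1; have := mulr_ge0 (ltW t0) (normr_ge0 (tan theta)); lra.
have : V (y, t).
  apply: Hd => //; split; rewrite /ball /=.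
    rewrite distrC; apply: le_lt_trans yx _; apply: le_lt_trans tt.
    by rewrite mulrC ler_wpM2l ?ler_norm// ltW.
  by rewrite sub0r normrN gtr0_norm.
move=> Vyt; have : (- (phi_transform f phi (y, t))%:E < (M + 1)%:E)%E.
  by apply: le_lt_trans HV; apply: ereal_sup_ubound; exists (y, t).
by rewrite phi_transformE// -EFinN lte_fin; lra.
Qed.

(** The cone of aperture 0 is the vertical ray above [x], since [tan 0 = 0]. *)
Lemma upper_value_radial x eta del : (0%:E <= upper_value f phi 0 x)%E ->
  0 < eta -> 0 < del ->
  exists t, [/\ 0 < t, t < del & - eta < utr f (fun n => derive1n n phi) t x].
Proof.
move=> H eta0 del0; apply: contrapT => no.
have : (upper_value f phi 0 x <= (- eta)%:E)%E.
  rewrite /upper_value limf_esupE.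
  pose V := [set p : R * R | [/\ 0 < p.2, p.2 < del & p.1 = x]].
  apply: (@le_trans _ _ (ereal_sup ((fun p => (phi_transform f phi p)%:E) @` V))).
    apply: ereal_inf_lbound; exists V => //.
    apply/nbhs_ballP; exists del => //= -[y t] [_ /=]; rewrite /ball /= sub0r normrN => td.
    rewrite /cone /= tan0 mul0r normr_le0 subr_eq0 => -[t0 /eqP ->].
    by split => //; rewrite gtr0_norm in td.
  apply: ge_ereal_sup => _ [[y t] [/= t0 td ->] <-].
  rewrite phi_transformE// lee_fin leNgt; apply/negP => ut.
  by apply: no; exists t.
by move=> /(le_trans H); rewrite lee_fin; lra.
Qed.

End LimitValues.

(** * Representing measures *)

Section Stieltjes.
Context {R : realType}.
Implicit Types (a b c d x y : R) (h G : R -> R).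
Local Notation RB := (measurableTypeR R).

Lemma stieltjes_exists h : {homo h : x y / x <= y} -> continuous h ->
  exists m : {measure set RB -> \bar R},
    (forall a b, a <= b -> m `]a, b]%classic = (h b - h a)%:E) /\
    (forall m' : {measure set RB -> \bar R},
      (forall a b, a <= b -> m' `]a, b]%classic = (h b - h a)%:E) ->
      forall A, measurable A -> m A = m' A).
Proof.
move=> nh ch.
have rh : right_continuous h by exact: right_continuousW.
pose H : cumulative R R := HB.pack h (isCumulative.Build R _ R h nh rh).
have E a b : a <= b -> lebesgue_stieltjes_measure H `]a, b]%classic = (h b - h a)%:E.
  by move=> ab; apply: etrans (measurable_mu_extE (wlength H) (is_ocitv a b)) _;
    rewrite /= wlength_itv_bnd.
exists (lebesgue_stieltjes_measure H); split; first exact: E.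
move=> m' Hm' A mA; apply: lebesgue_stieltjes_measure_unique => // X.
move=> /ocitvP[->|[[a b] /= ab ->]]; first by rewrite !measure0.
by rewrite Hm' ?ltW// E ?ltW.
Qed.

(** Half-open intervals can be squeezed because [nu] is dominated by the increments of a continuous
    function; outer approximation is carried along because complements exchange the two sides. *)
Lemma inner_regular_finite (nu : {measure set RB -> \bar R}) h :
  (nu setT < +oo)%E -> continuous h ->
  (forall a b, a <= b -> (nu `]a, b]%classic <= (h b - h a)%:E)%E) ->
  forall A, measurable A -> forall eps : R, 0 < eps ->
    exists C, [/\ closed (C : set R), C `<=` A & (nu (A `\` C) <= eps%:E)%E].
Proof.
move=> nuT ch nuh.
(* The sets squeezed between a closed and an open set form a sigma-algebra. *)
pose good : set (set RB) := fun A => measurable A /\ forall eps : R, 0 < eps ->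
  exists C W, [/\ closed (C : set R), open (W : set R), C `<=` A, A `<=` W &
    (nu (W `\` C) <= eps%:E)%E].
have mo (W : set R) : open W -> measurable (W : set RB) by exact: measurable_realfun.open_measurable.
have mc (W : set R) : closed W -> measurable (W : set RB) by exact: measurable_realfun.closed_measurable.
have fin A : measurable A -> (nu A < +oo)%E.
  by move=> mA; apply: le_lt_trans nuT; apply: le_measure; rewrite ?inE.
suff GM : forall A, measurable A -> good A.
  move=> A mA eps e0; have [_ /(_ eps e0)[C [W [cC oW CA AW H]]]] := GM A mA.
  exists C; split => //; apply: le_trans H; apply: le_measure; rewrite ?inE.
  - by apply: measurableD => //; exact: mc.
  - by apply: measurableD; [exact: mo|exact: mc].
  - exact: setSD.
have sg : sigma_algebra setT good.
  split.
  - split; first exact: measurable0.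
    move=> eps e0; exists set0, set0.
    by split; rewrite ?setD0 ?measure0 ?lee_fin ?ltW//; exact: closed0.
  - move=> A [mA HA]; rewrite setTD; split; first exact: measurableC.
    move=> eps e0; have [C [W [cC oW CA AW H]]] := HA eps e0.
    exists (~` W), (~` C); split.
    + exact: open_closedC.
    + exact: closed_openC.
    + exact: subsetC.
    + exact: subsetC.
    + by rewrite setDE setCK setIC -setDE.
  - move=> A HA; have mA n : measurable (A n) by have [] := HA n.
    split; first exact: bigcupT_measurable.
    move=> eps e0.
    pose e (n : nat) : R := eps / 2 / (2 ^ n.+1)%:R.
    have en n : 0 < e n by rewrite !divr_gt0// ltr0n expn_gt0.
    have /choice[CW HCW] : forall n, exists CW : set R * set R,
        [/\ closed CW.1, open CW.2, CW.1 `<=` A n, A n `<=` CW.2 &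
         (nu (CW.2 `\` CW.1) <= (e n)%:E)%E].
      by move=> n; have [_ /(_ (e n) (en n))[C [W H]]] := HA n; exists (C, W).
    pose C n := (CW n).1; pose W n := (CW n).2.
    have mC n : measurable (C n : set RB) by have [/mc] := HCW n.
    have mW n : measurable (W n : set RB) by have [_ /mo] := HCW n.
    pose CC := \bigcup_n C n; pose WW := \bigcup_n W n.
    have mCC : measurable (CC : set RB) by exact: bigcupT_measurable.
    have mWW : measurable (WW : set RB) by exact: bigcupT_measurable.
    pose CN N := \big[setU/set0]_(i < N) C i.
    have mCN N : measurable (CN N : set RB) by apply: bigsetU_measurable.
    have h1 : (nu (WW `\` CC) <= (eps / 2)%:E)%E.
      apply: (@le_trans _ _ (\sum_(n <oo) nu (W n `\` C n))%E).
        have mD n : measurable (W n `\` C n : set RB) by exact: measurableD.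
        apply: (@le_trans _ _ (nu (\bigcup_n (W n `\` C n)))).
          apply: le_measure; rewrite ?inE; [exact: measurableD|exact: bigcupT_measurable|].
          by move=> x [[n _ Wx] nC]; exists n => //; split => // Cx; apply: nC; exists n.
        by apply: measure_sigma_subadditive => //; exact: bigcupT_measurable.
      apply: (@le_trans _ _ (\sum_(n <oo) (e n)%:E)%E).
        by apply: lee_nneseries => // n _; have [_ _ _ _ hn] := HCW n; exact: hn.
      by apply: (@epsilon_trick0 _ (eps / 2) xpredT); rewrite divr_ge0// ltW.
    (* The union of the closed sets need not be closed, so it is cut at a finite stage; continuity
       from above bounds the loss by [eps / 2]. *)
    have [N HN] : exists N, (nu (CC `\` CN N) <= (eps / 2)%:E)%E.
      have cvgC : nu \o (fun N => CC `\` CN N) @ \oo --> nu (\bigcap_N (CC `\` CN N)).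
        apply: nonincreasing_cvg_mu.
        - by apply: fin; exact: measurableD.
        - by move=> n; exact: measurableD.
        - by apply: bigcapT_measurable => n; exact: measurableD.
        - move=> n m nm; apply/subsetPset; apply: setDS.
          by apply: subset_bigsetU.
      rewrite (_ : \bigcap_N _ = set0) ?measure0 in cvgC; last first.
        rewrite -subset0 => x Hx; have [[n _ Cx] _] := Hx 0%N I.
        have [_] := Hx n.+1 I; apply; rewrite /CN big_ord_recr /=; right; exact: Cx.
      have e2 : ((0 : R)%:E < (eps / 2)%:E)%E by rewrite lte_fin divr_gt0.
      have := cvgC _ (open_ereal_lt' e2).
      by move=> [N _ HN]; exists N; apply: ltW; exact: (HN N (leqnn N)).
    exists (CN N), WW; split.
    + by apply: closed_bigsetU => i _; have [] := HCW i.
    + by apply: bigcup_open => n _; have [] := HCW n.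
    + rewrite /CN => x; rewrite -bigcup_mkord => -[i _ Cx]; exists i => //.
      by have [_ _ CA _ _] := HCW i; exact: CA.
    + by move=> x [n _ Ax]; exists n => //; have [_ _ _ AW _] := HCW n; exact: AW.
    + have mD1 : measurable (WW `\` CC : set RB) by exact: measurableD.
      have mD2 : measurable (CC `\` CN N : set RB) by exact: measurableD.
      apply: (@le_trans _ _ (nu ((WW `\` CC) `|` (CC `\` CN N)))).
        apply: le_measure; rewrite ?inE; [exact: measurableD|exact: measurableU|].
        by move=> x [Wx nx]; have [Cx|nCx] := pselect (CC x); [right|left].
      apply: le_trans (measureU2 _ mD1 mD2) _.
      by rewrite [eps]splitr EFinD leeD.
have sub : @measurable _ RB `<=` good; last by move=> A /sub.
apply: smallest_sub => // X /ocitvP[->|[[a b] /= ab ->]].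
  by have [] := sg.
split; first exact: measurable_itv.
move=> eps e0.
have e4 : 0 < eps / 4 by rewrite divr_gt0.
have cvgh x : exists2 d : R, 0 < d & forall y, `|y - x| < d -> `|h y - h x| < eps / 4.
  have /cvgrPdist_lt/(_ _ e4)/nbhs_ballP[d /= d0 Hd] := ch x.
  by exists d => // y yx; rewrite distrC; apply: Hd; rewrite /ball /= distrC.
have [d1 d10 H1] := cvgh a; have [d2 d20 H2] := cvgh b.
(* Over the length [d] the function [h] moves by less than [eps / 4], so the slivers []a, a + d]]
   and []b, b + d]] weigh at most [eps / 2] together. *)
pose d := Num.min (d1 / 2) (Num.min (d2 / 2) (b - a)).
have d0 : 0 < d by rewrite !lt_min !divr_gt0// subr_gt0.
have dd1 : d <= d1 / 2 by rewrite ge_min lexx.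
have dd2 : d <= d2 / 2 by rewrite !ge_min lexx orbT.
exists `[a + d, b]%classic, `]a, b + d[%classic; split.
- exact: interval_closed.
- exact: interval_open.
- by move=> x /=; rewrite !in_itv /=; lra.
- by move=> x /=; rewrite !in_itv /=; lra.
apply: (@le_trans _ _ (nu (`]a, a + d]%classic `|` `]b, b + d]%classic))).
  apply: le_measure; rewrite ?inE; [|by apply: measurableU; exact: measurable_itv|].
    by apply: measurableD; exact: measurable_itv.
  move=> x [] /=; rewrite !in_itv /= => /andP[ax xb] nx.
  have [xa|xa] := leP x (a + d); [left|right]; first by rewrite ax.
  apply/andP; split; last exact: ltW.
  by rewrite ltNge; apply/negP => xb'; apply: nx; rewrite xb' ltW.
have mi x y : measurable (`]x, y]%classic : set RB) by exact: measurable_itv.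
apply: le_trans (measureU2 _ (mi _ _) (mi _ _)) _.
apply: (@le_trans _ _ ((h (a + d) - h a)%:E + (h (b + d) - h b)%:E)%E).
  by apply: leeD; apply: nuh; rewrite lerDl ltW.
rewrite -EFinD lee_fin.
have p : `|h (a + d) - h a| < eps / 4.
  by apply: H1; rewrite addrAC subrr add0r gtr0_norm//; lra.
have q : `|h (b + d) - h b| < eps / 4.
  by apply: H2; rewrite addrAC subrr add0r gtr0_norm//; lra.
by move: p q => /ltr_normlW p /ltr_normlW q; lra.
Qed.

End Stieltjes.

Section OpenStieltjes.
Context {R : realType} (U : set R) (oU : open U) (G : R -> R)
  (Gi : forall a b, a <= b -> `[a, b]%classic `<=` U -> G a <= G b)
  (Gc : forall x, U x -> {for x, continuous G}).
Implicit Types (a b c d x y : R).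
Local Notation RB := (measurableTypeR R).

Definition increments (m : set RB -> \bar R) c d := forall x y, c <= x -> x <= y -> y <= d ->
  m `]x, y]%classic = (G y - G x)%:E.

(** Clamping extends [G] constantly outside [[c, d]] to a monotone continuous function on the line.
    The uniqueness clause will make the measures of overlapping segments agree. *)
Lemma segment_measure c d : c <= d -> `[c, d]%classic `<=` U ->
  exists m0 : {measure set RB -> \bar R}, [/\ increments m0 c d,
    (forall m : {measure set RB -> \bar R}, increments m c d ->
      forall X, measurable X -> X `<=` `]c, d]%classic -> m0 X = m X) &
    forall A, measurable A -> A `<=` `]c, d]%classic -> forall eps : R, 0 < eps ->
      exists C, [/\ compact (C : set R), C `<=` A & (m0 (A `\` C) <= eps%:E)%E]].
Proof.
move=> cd cdU.
pose cl x := Num.min d (Num.max c x).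
have clcd x : c <= cl x <= d by rewrite /cl ge_min lexx le_min le_max lexx cd.
have clE x : c <= x -> x <= d -> cl x = x.
  by move=> cx xd; rewrite /cl (max_idPr cx) (min_idPr xd).
have clm x y : x <= y -> cl x <= cl y.
  move=> xy; rewrite /cl le_min; apply/andP; split; first by rewrite ge_min lexx.
  rewrite ge_min; apply/orP; right; rewrite ge_max; apply/andP.
  by split; rewrite le_max ?lexx ?xy ?orbT.
pose h x := G (cl x).
have ch : continuous h.
  move=> x; apply: (@continuous_comp _ _ _ cl G).
    apply: (@continuous_min R R (fun=> d) (fun y => Num.max c y)).
      exact: cst_continuous.
    apply: (@continuous_max R R (fun=> c) id); first exact: cst_continuous.
    exact: cvg_id.
  by apply: Gc; apply: cdU; rewrite /= in_itv /= clcd.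
have nh : {homo h : x y / x <= y}.
  move=> x y xy; apply: Gi; first exact: clm.
  move=> z; rewrite /= in_itv /= => /andP[xz zy]; apply: cdU.
  by rewrite /= in_itv /=; have := clcd x; have := clcd y; lra.
have [m0 [Hm0 Um0]] := stieltjes_exists nh ch.
have mcd : measurable (`]c, d]%classic : set RB) by exact: measurable_itv.
exists m0; split.
- by move=> x y cx xy yd; rewrite Hm0// /h !clE//; lra.
- move=> m Hm X mX Xcd.
  (* Restricted to []c, d]], [m] has the increments of [h] on the whole line, so uniqueness
     applies. *)
  rewrite (Um0 (mrestr m mcd)) //; first by rewrite /= /mrestr (setIidl Xcd).
  move=> x y xy; rewrite /= /mrestr.
  have -> : `]x, y]%classic `&` `]c, d]%classic = `]Num.max x c, Num.min y d]%classic.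
    apply/seteqP; split=> z /=; rewrite !in_itv /= gt_max le_min.
      by move=> [/andP[-> ->] /andP[-> ->]].
    by move=> /andP[/andP[-> ->] /andP[-> ->]].
  have [le|lt] := leP (Num.max x c) (Num.min y d).
    rewrite Hm//; last 2 first.
    - by rewrite le_max lexx orbT.
    - by rewrite ge_min lexx orbT.
    move: le; rewrite ge_max !le_min => /andP[/andP[_ xd] /andP[cy _]].
    by rewrite /h /cl (max_idPr cy) minC (min_idPr (_ : Num.max c x <= d)) ?(maxC x)// ge_max cd.
  rewrite set_itv_ge ?measure0; last by rewrite bnd_simp -leNgt ltW.
  have [dx|xd] := ltP d x.
    have dy : d < y by lra.
    rewrite /h /cl !(max_idPr _) ?(le_trans cd) ?(ltW dx) ?(ltW dy)//.
    by rewrite !(min_idPl _) ?(ltW dx) ?(ltW dy)// subrr.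
  have yc : y < c.
    move: lt; rewrite lt_max !gt_min => /orP[/orP[|]|/orP[|]]; lra.
  have xc : x < c by lra.
  by rewrite /h /cl !(max_idPl _) ?(ltW xc) ?(ltW yc)// subrr.
- move=> A mA Acd eps e0.
  pose nu : {measure set RB -> \bar R} := mrestr m0 mcd.
  have nuT : (nu setT < +oo)%E by rewrite /= /mrestr setTI Hm0// ltry.
  have nuh a b : a <= b -> (nu `]a, b]%classic <= (h b - h a)%:E)%E.
    move=> ab; rewrite -Hm0//= /mrestr; apply: le_measure; rewrite ?inE.
    - by apply: measurableI => //; exact: measurable_itv.
    - exact: measurable_itv.
    - exact: subIsetl.
  have [C [cC CA H]] := inner_regular_finite nuT ch nuh mA e0.
  exists C; split => //.
    apply: (subclosed_compact cC (@segment_compact R c d)) => x /CA /Acd.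
    by rewrite /= !in_itv /= => /andP[/ltW -> ->].
  apply: le_trans H; rewrite /= /mrestr (setIidl _)//.
  by apply: subset_trans Acd; exact: subDsetl.
Qed.

Lemma open_segment a b : a <= b -> `[a, b]%classic `<=` U ->
  exists p q : rat, [/\ ratr p < a, b < ratr q & `[ratr p, ratr q]%classic `<=` U].
Proof.
move=> ab abU.
have Ua : U a by apply: abU; rewrite /= in_itv /= lexx.
have Ub : U b by apply: abU; rewrite /= in_itv /= lexx ab.
have /nbhs_ballP[d /= d0 Hd] := open_nbhs_nbhs (conj oU Ua).
have /nbhs_ballP[e /= e0 He] := open_nbhs_nbhs (conj oU Ub).
have [p] := @rat_in_itvoo R (a - d) a ltac:(lra).
have [q] := @rat_in_itvoo R b (b + e) ltac:(lra).
rewrite !in_itv /= => /andP[q1 q2] /andP[p1 p2]; exists p, q; split => //.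
move=> z; rewrite /= in_itv /= => /andP[pz zq].
have [za|az] := ltP z a.
  by apply: Hd; rewrite /ball /= ger0_norm; lra.
have [bz|zb] := ltP b z.
  by apply: He; rewrite /ball /= ltr0_norm; lra.
by apply: abU; rewrite /= in_itv /= az.
Qed.

Lemma open_stieltjes : exists mu : {measure set RB -> \bar R},
  (forall a b, a <= b -> `[a, b]%classic `<=` U -> mu `]a, b]%classic = (G b - G a)%:E) /\
  (forall A : set RB, measurable A -> A `<=` U ->
     mu A = ereal_sup [set mu K | K in [set K : set R | compact K /\ K `<=` A]]).
Proof.
(* The Stieltjes measures of the segments of [U] with rational endpoints agree on
   overlaps, so they can be glued along the disjoint pieces [seqDU A n]. *)
pose pr n : R * R := if (unpickle n : option (rat * rat)) is Some pq
  then (ratr pq.1, ratr pq.2) else (0, 0).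
(* Numbers that code no pair receive [(0, 0)], which the strict inequality excludes. *)
pose ok n := (pr n).1 < (pr n).2 /\ `[(pr n).1, (pr n).2]%classic `<=` U.
have /choice[mm Hmm] : forall n, exists m0 : {measure set RB -> \bar R}, ok n ->
    [/\ increments m0 (pr n).1 (pr n).2,
    (forall m : {measure set RB -> \bar R}, increments m (pr n).1 (pr n).2 ->
      forall X, measurable X -> X `<=` `](pr n).1, (pr n).2]%classic -> m0 X = m X) &
    forall A, measurable A -> A `<=` `](pr n).1, (pr n).2]%classic -> forall eps : R, 0 < eps ->
      exists C, [/\ compact (C : set R), C `<=` A & (m0 (A `\` C) <= eps%:E)%E]].
  move=> n; have [[pq pU]|nok] := pselect (ok n); last by exists mzero => /nok.
  by have [m0 H] := segment_measure (ltW pq) pU; exists m0.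
pose A n : set RB := [set x | ok n /\ (pr n).1 < x <= (pr n).2].
have AE n : ok n -> A n = `](pr n).1, (pr n).2]%classic.
  by move=> okn; apply/seteqP; split=> x /=; rewrite in_itv /=; [by case|by split].
have A0 n : ~ ok n -> A n = set0 by move=> nok; rewrite -subset0 => x [/nok].
have mA n : measurable (A n).
  by have [/AE ->|/A0 ->] := pselect (ok n); [exact: measurable_itv|exact: measurable0].
have mB n : measurable (seqDU A n).
  by apply: measurableD => //; apply: bigsetU_measurable => i _.
pose nus n : {measure set RB -> \bar R} := mrestr (mm n) (mB n).
pose mu : {measure set RB -> \bar R} := mseries nus 0.
have muE X : mu X = (\sum_(n <oo) mm n (X `&` seqDU A n))%E by [].
(* Both measures coincide with the one built on the common segment [[c, d]]. *)
have agree n m X : ok n -> ok m -> measurable X -> X `<=` A n -> X `<=` A m -> mm n X = mm m X.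
  move=> okn okm mX Xn Xm.
  have [i1 _ _] := Hmm n okn; have [i2 _ _] := Hmm m okm.
  pose c := Num.max (pr n).1 (pr m).1; pose d := Num.min (pr n).2 (pr m).2.
  have Xcd : X `<=` `]c, d]%classic.
    move=> x Xx; have [_ /andP[h1 h2]] := Xn x Xx; have [_ /andP[h3 h4]] := Xm x Xx.
    by rewrite /= in_itv /= gt_max le_min h1 h2 h3 h4.
  have c1 : (pr n).1 <= c by rewrite le_max lexx.
  have c2 : (pr m).1 <= c by rewrite le_max lexx orbT.
  have d1 : d <= (pr n).2 by rewrite ge_min lexx.
  have d2 : d <= (pr m).2 by rewrite ge_min lexx orbT.
  have [cd|dc] := leP c d; last first.
    have -> : X = set0.
      by rewrite -subset0 => x /Xcd; rewrite /= in_itv /=; lra.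
    by rewrite !measure0.
  have cdU : `[c, d]%classic `<=` U.
    by move=> x; rewrite /= in_itv /= => xcd; apply: okn.2; rewrite /= in_itv /=; lra.
  have [m0 [_ u0 _]] := segment_measure cd cdU.
  rewrite -(u0 (mm n))//; last by move=> x y cx xy yd; apply: i1; lra.
  by rewrite -(u0 (mm m))// => x y cx xy yd; apply: i2; lra.
have muA m X : ok m -> measurable X -> X `<=` A m -> mu X = mm m X.
  move=> okm mX Xm.
  have XB : X = \bigcup_n (X `&` seqDU A n).
    rewrite -setI_bigcupr -seqDU_bigcup_eq; apply/esym/setIidPl => x /Xm Ax.
    by exists m.
  have mXB n : measurable (X `&` seqDU A n) by exact: measurableI.
  rewrite [in RHS]XB measure_semi_bigcup//; last 2 first.
  - by apply: trivIset_setIl; exact: trivIset_seqDU.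
  - by rewrite -XB.
  rewrite muE; apply: eq_eseriesr => n _.
  have [okn|nok] := pselect (ok n).
    apply: agree => //; last by apply: subset_trans Xm; exact: subIsetl.
    by apply: subset_trans (@subset_seqDU _ A n); exact: subIsetr.
  have -> : X `&` seqDU A n = set0; last by rewrite !measure0.
  by rewrite -subset0 => x [_ Bx]; have := subset_seqDU Bx; rewrite A0.
exists mu; split.
  move=> a b ab abU; have [p [q [pa bq pqU]]] := open_segment ab abU.
  pose n := pickle (p, q).
  have prn : pr n = (ratr p, ratr q) by rewrite /pr /n pickleK.
  have okn : ok n by rewrite /ok prn /=; split => //; lra.
  have abA : `]a, b]%classic `<=` A n.
    by rewrite AE// prn => x /=; rewrite !in_itv /=; lra.
  rewrite (muA n)//; have [i1 _ _] := Hmm n okn.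
  by apply: i1; rewrite ?prn /=; lra.
move=> X mX XU; apply/eqP; rewrite eq_le; apply/andP; split; last first.
  apply: ge_ereal_sup => _ [K [cK KX] <-]; apply: le_measure; rewrite ?inE//.
  by apply: measurable_realfun.closed_measurable; apply: compact_closed => //; exact: Rhausdorff.
(* Finite unions of compact sets taken in disjoint pieces exhaust a partial sum of the series; half
   of [eps] goes to the earlier pieces and half to the new one. *)
have part N : forall eps : R, 0 < eps -> exists K : set R,
   [/\ compact K, K `<=` X, K `<=` \bigcup_(i < N) seqDU A i &
    (\sum_(0 <= i < N) mm i (X `&` seqDU A i) <= mu K + eps%:E)%E].
  elim: N => [|N IH] eps e0.
    exists set0; split => //; first exact: compact0.
    by rewrite big_geq// measure0 add0e lee_fin ltW.
  have e2 : 0 < eps / 2 by rewrite divr_gt0.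
  have [K [cK KX KB HK]] := IH _ e2.
  have mXB : measurable (X `&` seqDU A N) by exact: measurableI.
  have [C [cC CX HC]] : exists C : set R, [/\ compact C, C `<=` X `&` seqDU A N &
      (mm N (X `&` seqDU A N) <= mu C + (eps / 2)%:E)%E].
    have [okN|nok] := pselect (ok N); last first.
      exists set0; split => //; first exact: compact0.
      have -> : X `&` seqDU A N = set0.
        by rewrite -subset0 => x [_ Bx]; have := subset_seqDU Bx; rewrite A0.
      by rewrite !measure0 add0e lee_fin ltW.
    have [_ _ reg] := Hmm N okN.
    have XA : X `&` seqDU A N `<=` A N.
      by apply: subset_trans (@subset_seqDU _ A N); exact: subIsetr.
    have [|C [cC CX HC]] := reg _ mXB _ _ e2; first by rewrite -AE.
    exists C; split => //.
    have mC : measurable (C : set RB).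
      by apply: measurable_realfun.closed_measurable; apply: compact_closed => //; exact: Rhausdorff.
    rewrite (muA N)//; last exact: subset_trans XA.
    rewrite -[in leLHS](setDUK CX).
    apply: le_trans (measureU2 _ mC (measurableD mXB mC)) _.
    by rewrite leeD2l.
  have mK : measurable (K : set RB).
    by apply: measurable_realfun.closed_measurable; apply: compact_closed => //; exact: Rhausdorff.
  have mC : measurable (C : set RB).
    by apply: measurable_realfun.closed_measurable; apply: compact_closed => //; exact: Rhausdorff.
  exists (K `|` C); split.
  - exact: compactU.
  - by move=> x [/KX//|/CX[]].
  - move=> x [/KB[i iN Bx]|/CX[_ Bx]]; [exists i => //; exact: ltnW|by exists N => /=].
  - rewrite big_nat_recr//= (measureU mu)//.
      rewrite [eps]splitr EFinD addeACA; exact: leeD.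
    rewrite -subset0 => x [/KB[i iN Bx] /CX[_ Bx']].
    have := @trivIset_seqDU _ A i N I I (ex_intro _ x (conj Bx Bx')).
    by move=> E; rewrite E /= ltnn in iN.
apply/lee_addgt0Pr => e e0.
rewrite muE; apply: lime_le; first by apply: is_cvg_nneseries => n _ _.
apply: nearW => N; have [K [cK KX _ HK]] := part N e e0.
apply: le_trans HK _; rewrite leeD2r//; apply: ereal_sup_ubound.
by exists K.
Qed.

End OpenStieltjes.

Section Grid.
Context {R : realType}.
Implicit Types (a b c d x y eta : R) (p : nat -> R).

Lemma uniform_grid c eta : 0 < c -> 0 < eta -> exists n p,
  [/\ p 0%N = - c, p n = c & forall i, 0 < p i.+1 - p i < eta].
Proof.
move=> c0 e0; pose n := (Num.trunc (2 * c / eta)).+1.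
have n0 : 0 < n%:R :> R by rewrite ltr0n.
pose st := 2 * c / n%:R; have st0 : 0 < st by rewrite !divr_gt0// mulr_gt0.
exists n, (fun i => - c + i%:R * st); split.
- by rewrite mul0r addr0.
- by rewrite /st; field; rewrite gt_eqF.
move=> i; have -> : - c + i.+1%:R * st - (- c + i%:R * st) = st by rewrite -natr1; ring.
rewrite st0 /= /st ltr_pdivrMr// [ltRHS]mulrC -ltr_pdivrMr//.
exact: truncnS_gt.
Qed.

Lemma grid_incr p i j : (forall i, 0 <= p i.+1 - p i) -> (i <= j)%N -> p i <= p j.
Proof.
move=> H; elim: j => [|j IH]; first by rewrite leqn0 => /eqP->.
rewrite leq_eqVlt => /orP[/eqP->//|ij]; apply: le_trans (IH ij) _.
by rewrite -subr_ge0.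
Qed.

Lemma grid_cell p n x : p 0%N < x -> x <= p n ->
  exists i, [/\ (i < n)%N, p i < x & x <= p i.+1].
Proof.
move=> p0; elim: n => [|n IH] xn; first by move: (le_lt_trans xn p0); rewrite ltxx.
have [xp|px] := leP x (p n); last by exists n.
by have [i [i_n h1 h2]] := IH xp; exists i; split => //; exact: ltnW.
Qed.

End Grid.

(** * The Stieltjes measure of the point values represents the distribution *)

Section Representation.
Context {R : realType} (f F : schwartz_distribution R)
  (hfF : is_distr_derivative f F) (hF : lojasiewicz F)
  (k : nat -> R -> R) (r : R) (r0 : 0 < r) (tk : tjet r k)
  (k0 : forall x, 0 <= k 0%N x) (k1 : integ (k 0%N) (- r) r = 1).
Context (U : set R) (oU : open U) (sU : forall x, U x -> strip f k 0 x).
Implicit Types (a b c d x y eps del eta : R) (K : set R) (p : nat -> R).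
Local Notation RB := (measurableTypeR R).
Local Notation G := (pvalue F).

Lemma pvalue_incr_open a b : a <= b -> `[a, b]%classic `<=` U -> G a <= G b.
Proof.
move=> ab abU.
have [del d0 lb] := strip_compact (@segment_compact R a b) (fun x xab => sU (abU x xab)).
have lb' : bounded_below f k 0 del a b by move=> x t xab; apply: lb; rewrite /= in_itv.
have := pvalue_incr hfF hF r0 tk k1 d0 lb' (lexx a) ab (lexx b).
by rewrite !mul0r !addr0.
Qed.

Lemma pvalue_cont_open x : U x -> {for x, continuous G}.
Proof.
move=> Ux; have [del d0 lb] := sU Ux.
by apply: (pvalue_cont hfF hF r0 tk k0 k1 (lexx 0) d0 lb); lra.
Qed.

Lemma compact_margin K : compact K -> K `<=` U ->
  exists2 d : R, 0 < d & forall x y, K x -> `|y - x| <= d -> U y.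
Proof.
move=> /compact_near_coveringP cK KU.
have := @cK R 0^'+ (fun d x => forall y, `|y - x| <= d -> U y) _ _.
case => [x /KU Ux|/= d d0 Hd].
  have /nbhs_ballP[e /= e0 He] := open_nbhs_nbhs (conj oU Ux).
  exists (`]x - e / 2, x + e / 2[%classic, [set t | 0 < t < e / 2]).
    split => /=; first by apply: near_in_itvoo; rewrite in_itv /=; lra.
    near=> t; apply/andP; split; near: t; [exact: nbhs_right_gt|].
    by apply: nbhs_right_lt; rewrite divr_gt0.
  move=> [z t] /= [+ /andP[t0 te]]; rewrite in_itv /= => zx y yz; apply: He.
  by rewrite /ball /=; move: yz; rewrite ler_norml ltr_norml; lra.
exists (d / 2); first by rewrite divr_gt0.
move=> x y Kx; apply: (Hd (d / 2)) => //=; last by rewrite divr_gt0.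
by rewrite sub0r normrN gtr0_norm; lra.
Unshelve. all: by end_near. Qed.

(** Closed cells meeting [K] lie in [U] once the mesh is below the margin of [K]; on the others
    nothing is known of [G]. *)
Definition active K p i := `[< exists x, K x /\ p i <= x <= p i.+1 >].

(** Half-open for disjointness, and empty when inactive so that all indices below [n] can be
    kept. *)
Definition cell K p i : set RB :=
  if active K p i then `]p i, p i.+1]%classic else set0.

Lemma measurable_cell K p i : measurable (cell K p i).
Proof.
by rewrite /cell; case: ifP => _; [exact: measurable_itv|exact: measurable0].
Qed.

Lemma cell_sub K p i : cell K p i `<=` `]p i, p i.+1]%classic.
Proof. by move=> x; rewrite /cell; case: ifP => // _ []. Qed.

Lemma trivIset_cell K p (D : set nat) : (forall i, 0 <= p i.+1 - p i) ->
  trivIset D (cell K p).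
Proof.
move=> pm i j _ _ [x [/cell_sub + /cell_sub]]; rewrite /= !in_itv /= => /andP[h1 h2] /andP[h3 h4].
have [ij|ji|//] := ltngtP i j.
  by have := lt_le_trans h3 (le_trans h2 (grid_incr pm ij)); rewrite ltxx.
by have := lt_le_trans h1 (le_trans h4 (grid_incr pm ji)); rewrite ltxx.
Qed.

Lemma cover_cell K p n : K `<=` `]p 0%N, p n]%classic ->
  K `<=` \big[setU/set0]_(0 <= i < n) cell K p i.
Proof.
move=> Kp x Kx; have := Kp x Kx; rewrite /= in_itv /= => /andP[p0 pn].
have [i [i_n h1 h2]] := grid_cell p0 pn.
rewrite big_mkord -bigcup_mkord; exists i => //; rewrite /cell.
case: ifPn => [_|/asboolPn[]]; first by rewrite /= in_itv /= h1.
by exists x; rewrite h2 (ltW h1).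
Qed.

Lemma active_near K p i eta : 0 < p i.+1 - p i < eta -> active K p i ->
  forall y, p i <= y <= p i.+1 -> exists2 x, K x & `|y - x| < eta.
Proof.
by move=> pi /asboolP[x [Kx xp]] y yp; exists x => //; rewrite ltr_norml; lra.
Qed.

Lemma cells_measure (mu : {measure set RB -> \bar R}) K p n :
  (forall a b, a <= b -> `[a, b]%classic `<=` U -> mu `]a, b]%classic = (G b - G a)%:E) ->
  (forall i, 0 <= p i.+1 - p i) ->
  (forall i, active K p i -> `[p i, p i.+1]%classic `<=` U) ->
  mu (\big[setU/set0]_(0 <= i < n) cell K p i) =
    (\sum_(0 <= i < n | active K p i) (G (p i.+1) - G (p i)))%:E.
Proof.
move=> muE pm pU; rewrite big_mkord measure_bigsetU.
- rewrite big_mkord -sumEFin [RHS]big_mkcond /=; apply: eq_bigr => i _; rewrite /cell.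
  by case: ifPn => [ai|_]; [apply: muE; [rewrite -subr_ge0|exact: pU]|rewrite measure0].
- by move=> i; exact: measurable_cell.
- exact: trivIset_cell.
Qed.

Lemma measure_compact_fin (mu : {measure set RB -> \bar R}) K :
  (forall a b, a <= b -> `[a, b]%classic `<=` U -> mu `]a, b]%classic = (G b - G a)%:E) ->
  compact K -> K `<=` U -> (mu K < +oo)%E.
Proof.
move=> muE cK KU; have [d d0 Hd] := compact_margin cK KU.
have [M [_ HM]] := compact_bounded cK.
pose c := `|M| + 2; have M0 := normr_ge0 M.
have c0 : 0 < c by rewrite /c; lra.
have [n [p [p0 pn pS]]] := uniform_grid c0 d0.
have pm i : 0 <= p i.+1 - p i by have := pS i; lra.
have pU i : active K p i -> `[p i, p i.+1]%classic `<=` U.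
  move=> ai y; rewrite /= in_itv /= => /(active_near (pS i) ai)[x Kx yx].
  by apply: Hd Kx _; exact: ltW.
have Kp : K `<=` `]p 0%N, p n]%classic.
  move=> x Kx; have Mx := ler_norm M.
  have := HM (`|M| + 1) ltac:(lra) x Kx; rewrite /= ler_norml p0 pn in_itv /= /c; lra.
apply: (@le_lt_trans _ _ (mu (\big[setU/set0]_(0 <= i < n) cell K p i))).
  apply: le_measure; rewrite ?inE.
  - by apply: measurable_realfun.closed_measurable; apply: compact_closed => //; exact: Rhausdorff.
  - by apply: bigsetU_measurable => i _; exact: measurable_cell.
  - exact: cover_cell.
by rewrite cells_measure// ltry.
Qed.

(** Both sides lie within [eps * W] of the same Riemann sum, where [W] is the mass of a fixed
    compact neighbourhood of the support. *)
Lemma pair_integral (mu : {measure set RB -> \bar R}) (psi : R -> R) :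
  (forall a b, a <= b -> `[a, b]%classic `<=` U -> mu `]a, b]%classic = (G b - G a)%:E) ->
  test_fun psi -> supp psi `<=` U ->
  (f psi)%:E = (\int[mu]_(x in U) (psi x)%:E)%E.
Proof.
move=> muE tpsi sup; set K := supp psi.
have cK : compact K by case: tpsi.
have [c c0 vpsi] := test_vanish tpsi.
have tg := test_tjet tpsi vpsi; set g := fun n => _ in tg.
have cpsi : continuous psi by exact: (jet_cont (n := 0%N) tg.1).
have Kc : K `<=` `[- c, c] := vanish_supp vpsi.
have [d d0 Hd] := compact_margin cK sup.
(* Active cells of mesh below [d / 2] stay in [V], and the closure of [V] stays in [U]. It is fixed
   before the mesh is chosen, so that [del] and [W] do not depend on [eps]. *)
pose V := [set y | exists2 x, K x & `|y - x| < d / 2].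
pose K2 := closure V.
have V2 : V `<=` K2 by exact: subset_closure.
have cK2 : compact K2.
  apply: (subclosed_compact _ (@segment_compact R (- (c + d)) (c + d))); first exact: closed_closure.
  have /closure_id -> : closed `[- (c + d), c + d]%classic by exact: interval_closed.
  apply: closure_subset => y [x /Kc]; rewrite /= !in_itv /= ltr_norml => ? ?; lra.
have K2U : K2 `<=` U.
  move=> z /(_ (ball z (d / 2))) []; first by apply: nbhsx_ballx; rewrite divr_gt0.
  move=> y [[x Kx yx] zy]; apply: Hd Kx _; move: zy yx; rewrite /ball /= !ltr_norml ler_norml; lra.
have [del del0 lb] := strip_compact cK2 (fun x Kx => sU (K2U x Kx)).
have K2fin := measure_compact_fin muE cK2 K2U.
pose W := fine (mu K2).
have W0 : 0 <= W by rewrite fine_ge0.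
have [B B0 HB] := tjet_bound 1%N tg.
have main eps : 0 < eps -> exists I : R,
    (\int[mu]_(x in U) (psi x)%:E)%E = I%:E /\ `|f psi - I| <= 2 * (eps * W).
  move=> e0.
  have c10 : 0 < c + 1 by lra.
  have eta0 : 0 < Num.min (d / 2) (eps / B) by rewrite lt_min !divr_gt0.
  have [n [p [p0 pn pS]]] := uniform_grid c10 eta0.
  have pS1 i : 0 < p i.+1 - p i < d / 2.
    by have := pS i; rewrite lt_min => /andP[-> /andP[-> _]].
  have pS2 i : p i.+1 - p i < eps / B.
    by have := pS i; rewrite lt_min => /andP[_ /andP[_ ->]].
  have pm i : 0 <= p i.+1 - p i by have := pS1 i; lra.
  have pV i : active K p i -> `[p i, p i.+1]%classic `<=` V.
    by move=> ai y; rewrite /= in_itv /=; exact: (active_near (pS1 i) ai).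
  have pU i : active K p i -> `[p i, p i.+1]%classic `<=` U.
    by move=> /pV H y /H /V2 /K2U.
  have osc i x : p i <= x <= p i.+1 -> `|psi x - psi (p i)| <= eps.
    move=> xp; apply: le_trans (deriv_bound (tg.1 0%N) (fun z _ => HB z)) _.
    have := pS2 i; rewrite ltr_pdivlMr// => H.
    rewrite mulrC; apply: le_trans (ltW H); rewrite ler_wpM2r ?(ltW B0)// ger0_norm; lra.
  have off i x : ~~ active K p i -> p i <= x <= p i.+1 -> psi x = 0.
    move=> /asboolPn nai xp; apply: vanish_out => Kx; apply: nai.
    by exists x.
  have p0psi y : y <= p 0%N -> psi y = 0.
    by rewrite p0 => yp; apply: vpsi; rewrite ltr0_norm; lra.
  have pnpsi y : p n <= y -> psi y = 0.
    by rewrite pn => yp; apply: vpsi; rewrite gtr0_norm; lra.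
  have RE := @riemann_estimate _ f F hfF hF k r r0 tk k0 k1 g c p n (active K p) 0 del eps
    tg (lexx 0) del0 (ltW e0).
  have {RE} : `|f psi - \sum_(0 <= i < n) psi (p i) * (G (p i.+1) - G (p i))| <=
      eps * \sum_(0 <= i < n | active K p i) (G (p i.+1) - G (p i) + 2 * 0 * (p i.+1 - p i)).
    apply: RE => //.
    - by move=> i _; have := pm i; lra.
    - by move=> i _ nai x; exact: off.
    - move=> i _ ai x t xp; apply: lb; apply: V2; apply: (pV i ai).
      by rewrite /= in_itv.
    - by move=> i _ x; exact: osc.
  pose S := \sum_(0 <= i < n | active K p i) (G (p i.+1) - G (p i)).
  have -> : \sum_(0 <= i < n | active K p i) (G (p i.+1) - G (p i) + 2 * 0 * (p i.+1 - p i)) = S.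
    by apply: eq_bigr => i _; rewrite mulr0 mul0r addr0.
  move=> RE.
  pose D := \big[setU/set0]_(0 <= i < n) cell K p i.
  have mD : mu D = S%:E by exact: cells_measure.
  have DV : D `<=` V.
    rewrite /D big_mkord => x; rewrite -bigcup_mkord => -[i _]; rewrite /cell.
    case: ifPn => // ai; rewrite /= in_itv /= => /andP[/ltW h1 h2]; apply: (pV i ai).
    by rewrite /= in_itv /= h1.
  have measD : measurable (D : set RB) by apply: bigsetU_measurable => i _; exact: measurable_cell.
  have SW : S <= W.
    rewrite -lee_fin -mD fineK; last by rewrite ge0_fin_numE.
    apply: le_measure; rewrite ?inE//.
      by apply: measurable_realfun.closed_measurable; exact: closed_closure.
    exact: subset_trans V2.
  have mpsi (A : set RB) : measurable A -> measurable_fun A (psi : RB -> R).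
    by move=> mA; apply: measurable_funTS; exact: measurable_realfun.continuous_measurable_fun.
  have cellfin i : (mu (cell K p i) < +oo)%E.
    rewrite /cell; case: ifPn => [ai|_]; last by rewrite measure0 ltry.
    by rewrite muE; [rewrite ltry|rewrite -subr_ge0|exact: pU].
  have ipsi i : mu.-integrable (cell K p i) (EFin \o psi).
    apply: measurable_bounded_integrable => //; first exact: measurable_cell.
      by apply: mpsi; exact: measurable_cell.
    have [B1 B10 HB1] := tjet_bound 0%N tg.
    by exists B1; split; [exact: num_real|move=> M BM x _; apply: le_trans (HB1 x) (ltW BM)].
  have UD : (\int[mu]_(x in U) (psi x)%:E = \int[mu]_(x in D) (psi x)%:E)%E.
    rewrite integral_mkcond [RHS]integral_mkcond; congr integral; apply/funext => x.
    rewrite /patch; have [xD|nxD] := pselect (D x).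
      by rewrite !mem_set//; apply: K2U; apply: V2; exact: DV.
    rewrite [x \in D]memNset//.
    have -> : psi x = 0; last by case: ifP.
    apply: vanish_out => Kx; apply: nxD; apply: (cover_cell (K := K)) Kx.
    by move=> y /Kc; rewrite /= !in_itv /= p0 pn; lra.
  have Dsum : (\int[mu]_(x in D) (psi x)%:E =
      \sum_(0 <= i < n) \int[mu]_(x in cell K p i) (psi x)%:E)%E.
    apply: (@integral_bigsetU_EFin _ _ _ mu nat (cell K p) psi (index_iota 0 n)).
    - by move=> i; exact: measurable_cell.
    - exact: iota_uniq.
    - exact: trivIset_cell.
    - by apply/measurable_realfun.measurable_EFinP; apply: mpsi.
  pose I i := fine (\int[mu]_(x in cell K p i) (psi x)%:E)%E.
  have IE i : (\int[mu]_(x in cell K p i) (psi x)%:E = (I i)%:E)%E.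
    by rewrite fineK//; apply: integrable_fin_num (ipsi i); exact: measurable_cell.
  have Icell i : `|I i - psi (p i) * (G (p i.+1) - G (p i))| <=
      if active K p i then eps * (G (p i.+1) - G (p i)) else 0.
    case: ifPn => ai; last first.
      rewrite (off i (p i) ai) ?mul0r ?subr0; last by have := pm i; lra.
      by rewrite /I /cell (negbTE ai) integral_set0 normr0.
    have mc : mu (cell K p i) = (G (p i.+1) - G (p i))%:E.
      by rewrite /cell ai muE; [|rewrite -subr_ge0|exact: pU].
    have ic (z : R) : mu.-integrable (cell K p i) (cst z%:E).
      apply: (@measurable_bounded_integrable _ _ _ mu (cst z)) => //.
      - exact: measurable_cell.
      - by exists `|z|; split; [exact: num_real|move=> M zM x _; exact: ltW].
    have cE (z : R) : (\int[mu]_(x in cell K p i) (cst z%:E) x = (z * (G (p i.+1) - G (p i)))%:E)%E.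
      by rewrite integral_cst ?mc//; exact: measurable_cell.
    have cp x : x \in cell K p i -> `|psi x - psi (p i)| <= eps.
      move=> /set_mem /cell_sub; rewrite /= in_itv /= => /andP[/ltW h1 h2].
      by apply: osc; rewrite h1.
    have up : ((I i)%:E <= ((psi (p i) + eps) * (G (p i.+1) - G (p i)))%:E)%E.
      rewrite -IE -cE; apply: le_integral => //; first exact: measurable_cell.
      by move=> x /cp; rewrite lee_fin ler_norml; lra.
    have dn : (((psi (p i) - eps) * (G (p i.+1) - G (p i)))%:E <= (I i)%:E)%E.
      rewrite -IE -cE; apply: le_integral => //; first exact: measurable_cell.
      by move=> x /cp; rewrite lee_fin ler_norml; lra.
    by move: up dn; rewrite !lee_fin ler_norml; lra.
  exists (\sum_(0 <= i < n) I i); split.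
    by rewrite UD Dsum -sumEFin; apply: eq_bigr => i _; exact: IE.
  have E2 : `|\sum_(0 <= i < n) I i - \sum_(0 <= i < n) psi (p i) * (G (p i.+1) - G (p i))| <=
      eps * S.
    rewrite -sumrB; apply: le_trans (ler_norm_sum _ _ _) _.
    rewrite /S mulr_sumr [leRHS]big_mkcond /=; apply: ler_sum => i _; exact: Icell.
  have SW' : eps * S <= eps * W by rewrite ler_wpM2l// ltW.
  move: RE E2; set Q := \sum_(0 <= i < n) psi _ * _ => RE E2.
  have := ler_distD Q (f psi) (\sum_(0 <= i < n) I i).
  by rewrite (distrC Q); lra.
(* Any [eps] shows that the integral is a real number; it is then the same for all [eps]. *)
have [I0 [IE0 _]] := main 1 ltr01.
rewrite IE0; congr EFin; apply/eqP; rewrite -subr_eq0 -normr_le0.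
apply/ler_addgt0Pr => e e0; rewrite add0r.
have W1 : 0 < 2 * (W + 1) by rewrite mulr_gt0//; lra.
have [I [IE H]] := main (e / (2 * (W + 1))) (divr_gt0 e0 W1).
have -> : I0 = I by move: IE; rewrite IE0 => -[].
apply: le_trans H _.
have -> : 2 * (e / (2 * (W + 1)) * W) = e * (W / (W + 1)) by field; rewrite gt_eqF//; lra.
rewrite ger_pMr// ler_pdivrMr; lra.
Qed.

Lemma measure_in_of_strip : measure_in U f.
Proof.
have [mu [muE muR]] := open_stieltjes oU pvalue_incr_open pvalue_cont_open.
exists mu; split => //.
  by move=> K; exact: measure_compact_fin.
by move=> psi; exact: pair_integral.
Qed.

End Representation.

Theorem theorem3p4 (R : realType) (f F : schwartz_distribution R)
  (hfF : is_distr_derivative f F) (hF : lojasiewicz F)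
  (U : set R) (hU : open U)
  (phi : R -> R) (hphi : test_fun phi)
  (hphi1 : \int[@lebesgue_measure R]_x phi x = 1)
  (hphi0 : forall x : R, 0 <= phi x)
  (r : R) (hsupp : supp phi `<=` `[- r, r])
  (theta : R) (htheta : atan r < theta) (htheta2 : theta < pi / 2)
  (hupper : {ae @lebesgue_measure R, forall x : R,
     U x -> (0%:E <= upper_value f phi 0 x)%E})
  (E : set R) (hE : countable E)
  (hlower : forall x : R, (U `\` E) x ->
     exists M : R, 0 < M /\ ((- M)%:E <= lower_value f phi theta x)%E) :
  measure_in U f.
Proof.
have vphi : vanish r phi := supp_vanish hsupp.
pose k n := derive1n n phi.
have tk : tjet r k by exact: test_tjet.
have ck : continuous phi by exact: (jet_cont (n := 0%N) tk.1).
(* A nonpositive [r] would leave [phi] zero off the origin, with integral zero. *)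
have r0 : 0 < r.
  rewrite ltNge; apply/negP => r_le0.
  have v0 : vanish 0 phi by move=> x x0; apply: vphi; exact: le_lt_trans x0.
  move: hphi1; rewrite (integ_test ck (lexx 0) v0) /integ oppr0 subrr => /esym/eqP.
  by rewrite oner_eq0.
have k1 : integ (k 0%N) (- r) r = 1 by rewrite -hphi1 (integ_test ck (ltW r0)).
have rT : r < tan theta.
  rewrite -{1}(atanK r) ltr_tan// in_itv /= ?atan_gtNpi2 ?atan_ltpi2 //.
  by rewrite htheta2 andbT (lt_trans (atan_gtNpi2 r)).
apply: (measure_in_of_strip hfF hF r0 tk hphi0 k1 hU).
apply: (strip_everywhere hfF hF r0 tk hphi0 k1 rT hU hE hupper) => x Ux.
  (* [Z] is the negligible set where the almost everywhere implication fails; elsewhere in [U] the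
     radial upper limit is nonnegative. *)
  have [bad|good] := pselect (U x -> (0%:E <= upper_value f phi 0 x)%E); [right|by left].
  by move=> eta del eta0 del0; exact: (upper_value_radial tk (bad Ux)).
move=> nEx; have [M [M0 HM]] := hlower x (conj Ux nEx).
by have [del [d0 H]] := lower_value_cone tk HM; exists (M + 1), del.
Qed.
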